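(* There exists a separable operator space $X$ (over $\mathbb{C}$) whose underlying Banach space is isometric to an infinite-dimensional Hilbert space such that: (1) $X$ has the $1$-CBAP; (2) $X$ does not have a cb-basis.
   Context: An operator space is a (complex) Banach space $X$ equipped with a norm $\|\cdot\|_{M_n(X)}$ on the space $M_n(X)$ of $n\times n$ matrices over $X$ for each $n\ge 1$, compatible with the norm of $X$ (i.e. the norm on $M_1(X)=X$ is the given norm of $X$), and satisfying Ruan's axioms: (R1) $\|\alpha x\beta\|_{M_n(X)}\le \|\alpha\|_{M_n}\|x\|_{M_n(X)}\|\beta\|_{M_n}$ for all $x\in M_n(X)$ and $\alpha,\beta\in M_n=M_n(\mathbb{C})$ (with the operator norm on $M_n$); (R2) $\|x\oplus y\|_{M_{n+m}(X)}=\max\{\|x\|_{M_n(X)},\|y\|_{M_m(X)}\}$ for all $x\in M_n(X)$, $y\in M_m(X)$, where $x\oplus y$ is the block-diagonal matrix. The underlying Banach space of $X$ is $X$ with its level-one norm; $X$ is separable if this Banach space is separable. For a linear map $T:X\to Y$ between operator spaces, let $T^{(n)}:M_n(X)\to M_n(Y)$, $T^{(n)}([x_{i,j}])=[T(x_{i,j})]$. $T$ is completely bounded if $\|T\|_{\mathrm{cb}}:=\sup_{n\ge1}\|T^{(n)}\|<\infty$, where $\|T^{(n)}\|$ is the operator norm. An operator space $X$ has the $C$-CBAP ($C$-completely bounded approximation property) if there is a net of finite-rank linear operators $T_\alpha:X\to X$ with $T_\alpha x\to x$ for every $x\in X$ and $\sup_\alpha\|T_\alpha\|_{\mathrm{cb}}\le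 C$. The $1$-CBAP is the case $C=1$. A separable operator space $X$ has a cb-basis if $X$ has a Schauder basis $\{e_n\}_{n\ge1}$ whose natural partial-sum projections $P_m\left(\sum_{n\ge1}\alpha_n e_n\right)=\sum_{n=1}^m\alpha_n e_n$ satisfy $\sup_{m\ge1}\|P_m\|_{\mathrm{cb}}<\infty$. *)

(* Defs.v *)
From HB Require Import structures.
From mathcomp Require Import all_boot all_order all_algebra.
From mathcomp Require Import complex.
From mathcomp Require Import all_classical all_reals all_analysis.

Set Implicit Arguments.
Unset Strict Implicit.
Unset Printing Implicit Defensive.

Import Order.TTheory GRing.Theory Num.Theory.
Import numFieldNormedType.Exports.

Local Open Scope classical_set_scope.
Local Open Scope complex_scope.
Local Open Scope ring_scope.

Definition l2norm (R : realType) (n : nat) (v : 'cV[R[i]]_n) : R :=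
  Num.sqrt (\sum_(i < n) complex.Re `|v i 0| ^+ 2).

Definition opnorm (R : realType) (n : nat) (a : 'M[R[i]]_n) : R :=
  sup [set l2norm (a *m v) | v in [set v : 'cV[R[i]]_n | l2norm v <= 1]].

(* The products a x and x b of a scalar matrix and a matrix over the vector
   space X, which has no multiplication, so [*m] does not apply. *)
Definition lscalemx (K : comNzRingType) (X : lmodType K) (n : nat)
    (a : 'M[K]_n) (x : 'M[X]_n) : 'M[X]_n :=
  \matrix_(i, j) \sum_(k < n) a i k *: x k j.

Definition rscalemx (K : comNzRingType) (X : lmodType K) (n : nat)
    (x : 'M[X]_n) (b : 'M[K]_n) : 'M[X]_n :=
  \matrix_(i, j) \sum_(k < n) b k j *: x i k.

(* [`|x|] on a normed space over R[i] takes values in R[i], whereas the matrix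
   norms take values in R. The size 0 is left unconstrained throughout. *)
Record operatorSpace (R : realType) := OperatorSpace {
  os_space :> completeNormedModType R[i];
  mxnorm : forall n : nat, 'M[os_space]_n -> R;
  mxnorm_eq0 : forall (n : nat) (x : 'M[os_space]_n), (0 < n)%N ->
    mxnorm x = 0 -> x = 0;
  mxnormZ : forall (n : nat) (c : R[i]) (x : 'M[os_space]_n), (0 < n)%N ->
    mxnorm (map_mx ( *:%R c) x) = complex.Re `|c| * mxnorm x;
  mxnormD : forall (n : nat) (x y : 'M[os_space]_n), (0 < n)%N ->
    mxnorm (x + y) <= mxnorm x + mxnorm y;
  mxnorm1 : forall x : 'M[os_space]_1, (mxnorm x)%:C = `|x 0 0|;
  ruan1 : forall (n : nat) (a b : 'M[R[i]]_n) (x : 'M[os_space]_n), (0 < n)%N ->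
    mxnorm (rscalemx (lscalemx a x) b) <= opnorm a * mxnorm x * opnorm b;
  ruan2 : forall (n m : nat) (x : 'M[os_space]_n) (y : 'M[os_space]_m),
    (0 < n)%N -> (0 < m)%N ->
    mxnorm (block_mx x 0 0 y) = Num.max (mxnorm x) (mxnorm y)
}.

Definition separable (T : topologicalType) : Prop :=
  exists D : set T, countable D /\ dense D.

Definition in_span (K : nzRingType) (V : lmodType K) (n : nat)
    (v : 'I_n -> V) (x : V) : Prop :=
  exists c : 'I_n -> K, x = \sum_(i < n) c i *: v i.

Definition infinite_dimensional (K : nzRingType) (V : lmodType K) : Prop :=
  ~ exists (n : nat) (v : 'I_n -> V), forall x : V, in_span v x.

Definition finite_rank (K : nzRingType) (V W : lmodType K) (T : V -> W) : Prop :=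
  exists (n : nat) (w : 'I_n -> W), forall x : V, in_span w (T x).

Definition is_hilbert (R : realType) (H : completeNormedModType R[i]) : Prop :=
  exists ip : {dot H for Num.conj}, forall x : H, `|x| ^+ 2 = ip x x.

Definition linearly_isometric (R : realType) (V W : normedModType R[i]) : Prop :=
  exists u : {linear V -> W},
    (forall x : V, `|u x| = `|x|) /\ (forall y : W, exists x : V, u x = y).

Section CompletelyBounded.
Variables (R : realType) (X Y : operatorSpace R).
Local Open Scope ereal_scope.

(* Defined for arbitrary functions, but only meant for linear ones. *)
Definition amp_norm (T : X -> Y) (n : nat) : \bar R :=
  ereal_sup [set (mxnorm (map_mx T x))%:E
            | x in [set x : 'M[X]_n | (mxnorm x <= 1)%R]].

Definition cb_norm (T : X -> Y) : \bar R :=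
  ereal_sup [set amp_norm T n | n in [set n : nat | (0 < n)%N]].

End CompletelyBounded.

Record directed (I : Type) (le : I -> I -> Prop) : Prop := Directed {
  directed_inhabited : inhabited I;
  directed_refl : forall a, le a a;
  directed_trans : forall a b c, le a b -> le b c -> le a c;
  directed_ub : forall a b, exists c, le a c /\ le b c
}.

Definition tails (I : Type) (le : I -> I -> Prop) : set_system I :=
  filter_from setT (fun a => [set b | le a b]).

Definition CBAP (R : realType) (C : R) (X : operatorSpace R) : Prop :=
  exists (I : Type) (le : I -> I -> Prop) (T : I -> {linear X -> X}),
    [/\ directed le,
        forall a, finite_rank (T a),
        forall x : X, T a x @[a --> tails le] --> x
      & (ereal_sup [set cb_norm (T a) | a in [set: I]] <= C%:E)%E].

Section Basis.
Variables (R : realType) (X : operatorSpace R) (e : nat -> X).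

Definition expands (x : X) (c : nat -> R[i]) : Prop :=
  series (fun n => c n *: e n) @ \oo --> x.

Definition schauder_basis : Prop :=
  forall x : X, exists! c : nat -> R[i], expands x c.

(* The coordinates of x; unspecified unless e is a Schauder basis. *)
Definition coords (x : X) : nat -> R[i] := xget (fun=> 0) (expands x).

Definition basis_proj (m : nat) (x : X) : X :=
  series (fun n => coords x n *: e n) m.

End Basis.

Definition has_cb_basis (R : realType) (X : operatorSpace R) : Prop :=
  exists e : nat -> X, schauder_basis e /\
    (ereal_sup [set cb_norm (basis_proj e m) | m in [set m : nat | (0 < m)%N]]
       < +oo)%E.

(* Main.v *)
Require Import Defs.
From HB Require Import structures.
From mathcomp Require Import all_boot all_order all_algebra.
From mathcomp Require Import complex.
From mathcomp Require Import all_classical all_reals all_analysis.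
From mathcomp Require Import ring lra zify.

Set Implicit Arguments.
Unset Strict Implicit.
Unset Printing Implicit Defensive.

Import Order.TTheory GRing.Theory Num.Theory.
Import numFieldNormedType.Exports.
Import ComplexField.Normc.

Local Open Scope classical_set_scope.
Local Open Scope complex_scope.
Local Open Scope ring_scope.


(** The space is l2 with matrix norms [||x|| = sup ||(phi (x i k))_(i,k)||], the
    supremum running over a family of contractions [phi] from l2 to spaces of
    rectangular scalar matrices. If the family contains enough functionals, the
    norm at level one is the Hilbert norm; Ruan's axioms hold for every family
    ([familySpace]).

    The other contractions live on disjoint blocks of coordinates. The n-th block
    is a copy of [C^T + C^T], where [T] is the set of words of [s] bits and
    [N = 2 ^ s]. For each of six unitaries [g] of [C^T] (1, -1, i, the rotation of
    the bits, the flip of one bit and the sign of that bit) the contraction sends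
    [(x, y)] to [(y - g x) / sqrt 2], arranges these [N] numbers in a matrix with
    [A] rows and [B] columns, [A * B = N], and multiplies it by the weight
    [N ^ (-1/4)]. The eccentricities [B / A] of all the shapes used, over all
    unitaries and all blocks, are far apart. By a Haagerup type inequality
    ([haagerup_bound]) two such contractions hardly see one another, so a family
    of matrices tailored to one of them is small in all the others. Testing a
    completely bounded map [P] on it gives [hilbert_schmidt_bound]: the part of
    [P] that starts in the kernel of one contraction and is seen by the same
    contraction has Hilbert-Schmidt norm much smaller than [sqrt N].

    Hence [P] almost preserves the graph of each [g], up to small Hilbert-Schmidt
    errors, and hardly maps the outside of the block into the block. The graphs of
    1, -1 and i force the compression of [P] to the block to be close to [D + D]
    with a single [D] on [C^T]; the other three graphs force [D] almost to commute
    with the rotation, the flip and the sign. Words of length polynomial in [s] in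
    these three generate the Pauli matrices, so [D] is close to a scalar [tau]
    ([near_scalar]). The loss is polynomial in [s], while the gap between the
    shapes is exponential in the index of the block, where [s] is only quadratic.
    If moreover [P] is idempotent, a comparison of the traces of [P] and [P ^ 2]
    shows that [tau - tau ^ 2] is small ([corner_mean_idem]).

    For the partial sum projections of a cb-basis, [tau] goes from 0 to 1 in steps
    of size at most [2 K / N], because consecutive projections differ by an
    operator of rank one. So some [tau] is close to 1/2, and [tau - tau ^ 2] is
    not small: there is no cb-basis ([no_cb_basis]). On the other hand, truncation
    to finitely many blocks turns each contraction of the family into another one,
    or into zero, and so is completely contractive: the space has the 1-CBAP
    ([block_space_cbap]). *)

(** * Euclidean norms of finite families *)

Section HS.
Variable R : realType.
Local Notation C := R[i].
Implicit Types (I J : finType).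

Lemma normc_ge0 (z : C) : 0 <= normc z.
Proof. by case: z => a b; apply: sqrtr_ge0. Qed.

Lemma normcD (z1 z2 : C) : normc (z1 + z2) <= normc z1 + normc z2.
Proof. exact: le_normcD. Qed.

Lemma normcN1 (z : C) : normc (- z) = normc z.
Proof. exact: normcN. Qed.

Lemma normcB (z1 z2 : C) : normc (z1 - z2) <= normc z1 + normc z2.
Proof. by rewrite -[X in _ <= _ + X]normcN1 normcD. Qed.

Lemma normc_i : normc ('i : C) = 1.
Proof. by rewrite /= expr0n expr1n add0r sqrtr1. Qed.

Lemma i_mul_i : 'i * 'i = -1 :> C.
Proof. by rewrite -expr2 sqr_i. Qed.

Lemma normc_conj (z : C) : normc z^* = normc z.
Proof. by case: z => a b /=; rewrite sqrrN. Qed.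

Lemma normc_sum I (P : pred I) (f : I -> C) :
  normc (\sum_(i | P i) f i) <= \sum_(i | P i) normc (f i).
Proof.
elim/big_ind2: _ => [|z1 a z2 b h1 h2|//]; first by rewrite normc0.
by apply: le_trans (normcD _ _) _; apply: lerD.
Qed.

Lemma normc_real (a : R) : 0 <= a -> normc a%:C = a.
Proof. by move=> a0 /=; rewrite expr0n addr0 sqrtr_sqr ger0_norm. Qed.

Lemma cjK (z : C) : z^*^* = z.
Proof. exact: conjcK. Qed.

Lemma cjM (z w : C) : (z * w)^* = z^* * w^*.
Proof. exact: (rmorphM (@conjc R)). Qed.

Lemma cjD (z w : C) : (z + w)^* = z^* + w^*.
Proof. exact: (rmorphD (@conjc R)). Qed.

Lemma cjN (z : C) : (- z)^* = - z^*.
Proof. exact: (rmorphN (@conjc R)). Qed.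

Lemma cj_sum (I : finType) (f : I -> C) : (\sum_i f i)^* = \sum_i (f i)^*.
Proof. exact: (rmorph_sum (@conjc R)). Qed.

Lemma mul_conjc (z : C) : z^* * z = (normc z ^+ 2)%:C.
Proof.
case: z => a b /=; rewrite sqr_sqrtr ?addr_ge0 ?sqr_ge0 //.
by apply/eqP; rewrite eq_complex /=; apply/andP; split; apply/eqP; ring.
Qed.

(** The difference of the two sides is half the sum of the squares of all 2
    x 2 minors (Lagrange). *)
Lemma cauchy_schwarz_real I (a b : I -> R) :
  (\sum_i a i * b i) ^+ 2 <= (\sum_i a i ^+ 2) * (\sum_i b i ^+ 2).
Proof.
rewrite -subr_ge0.
have -> : (\sum_i a i ^+ 2) * (\sum_i b i ^+ 2) - (\sum_i a i * b i) ^+ 2 =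
   \sum_i \sum_j (a i * b j - a j * b i) ^+ 2 / 2.
  have e1 : (\sum_i a i ^+ 2) * (\sum_i b i ^+ 2)
      = \sum_i \sum_j (a i * b j) ^+ 2.
    rewrite mulr_suml; apply: eq_bigr => i _; rewrite mulr_sumr.
    by apply: eq_bigr => j _; rewrite exprMn.
  have e2 : \sum_i \sum_j (a j * b i) ^+ 2 = \sum_i \sum_j (a i * b j) ^+ 2.
    by rewrite exchange_big.
  have e3 : (\sum_i a i * b i) ^+ 2 =
      \sum_i \sum_j (a i * b j) * (a j * b i).
    rewrite expr2 mulr_suml; apply: eq_bigr => i _; rewrite mulr_sumr.
    by apply: eq_bigr => j _; ring.
  have -> : \sum_i \sum_j (a i * b j - a j * b i) ^+ 2 / 2 =
     (\sum_i \sum_j (a i * b j) ^+ 2) / 2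
     + (\sum_i \sum_j (a j * b i) ^+ 2) / 2
     - \sum_i \sum_j (a i * b j) * (a j * b i).
    rewrite !mulr_suml -big_split /= -sumrB; apply: eq_bigr => i _.
    rewrite !mulr_suml -big_split /= -sumrB; apply: eq_bigr => j _.
    by field.
  by rewrite e1 e2 e3; field.
by apply: sumr_ge0 => i _; apply: sumr_ge0 => j _; rewrite divr_ge0 ?sqr_ge0.
Qed.

Definition norm2 I (f : I -> C) : R := Num.sqrt (\sum_i normc (f i) ^+ 2).

Lemma sumsq_ge0 I (f : I -> R) : 0 <= \sum_i f i ^+ 2.
Proof. by apply: sumr_ge0 => i _; apply: sqr_ge0. Qed.

Lemma norm2_ge0 I (f : I -> C) : 0 <= norm2 f.
Proof. exact: sqrtr_ge0. Qed.

Lemma norm2_sqr I (f : I -> C) : norm2 f ^+ 2 = \sum_i normc (f i) ^+ 2.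
Proof. by rewrite sqr_sqrtr ?sumsq_ge0. Qed.

Lemma eq_norm2 I (f g : I -> C) : f =1 g -> norm2 f = norm2 g.
Proof. by move=> e; rewrite /norm2; congr Num.sqrt; apply: eq_bigr => i _; rewrite e. Qed.

Lemma norm2_le_sqr I (f : I -> C) (B : R) :
  0 <= B -> \sum_i normc (f i) ^+ 2 <= B ^+ 2 -> norm2 f <= B.
Proof. by move=> B0; rewrite -norm2_sqr ler_sqr ?nnegrE ?norm2_ge0. Qed.

Lemma le_norm2 I (f g : I -> C) :
  (forall i, normc (f i) <= normc (g i)) -> norm2 f <= norm2 g.
Proof.
move=> h; rewrite norm2_le_sqr ?norm2_ge0 // norm2_sqr ler_sum // => i _.
by rewrite ler_sqr ?nnegrE ?normc_ge0.
Qed.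

Lemma norm2_normc I (f : I -> C) : norm2 (fun i => (normc (f i))%:C) = norm2 f.
Proof. by rewrite /norm2; congr Num.sqrt; apply: eq_bigr => i _; rewrite normc_real ?normc_ge0. Qed.

Lemma norm2_conj I (f : I -> C) : norm2 (fun i => (f i)^*) = norm2 f.
Proof. by rewrite /norm2; congr Num.sqrt; apply: eq_bigr => i _; rewrite normc_conj. Qed.

Lemma sum_normc_le I (f g : I -> C) :
  \sum_i normc (f i) * normc (g i) <= norm2 f * norm2 g.
Proof.
have h0 : 0 <= \sum_i normc (f i) * normc (g i).
  by apply: sumr_ge0 => i _; rewrite mulr_ge0 ?normc_ge0.
rewrite -ler_sqr ?nnegrE ?mulr_ge0 ?norm2_ge0 // exprMn !norm2_sqr.
exact: cauchy_schwarz_real.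
Qed.

Lemma cauchy_schwarz I (f g : I -> C) :
  normc (\sum_i f i * g i) <= norm2 f * norm2 g.
Proof.
apply: le_trans (normc_sum _ _) _; apply: le_trans (sum_normc_le f g).
by apply: ler_sum => i _; rewrite normcM.
Qed.

Lemma norm2D I (f g : I -> C) : norm2 (fun i => f i + g i) <= norm2 f + norm2 g.
Proof.
apply: norm2_le_sqr; first by rewrite addr_ge0 ?norm2_ge0.
have -> : (norm2 f + norm2 g) ^+ 2 = norm2 f ^+ 2 + norm2 g ^+ 2 + (norm2 f * norm2 g) *+ 2.
  by rewrite sqrrD addrAC.
apply: (@le_trans _ _ (\sum_i (normc (f i) + normc (g i)) ^+ 2)).
  apply: ler_sum => i _; rewrite ler_sqr ?nnegrE ?addr_ge0 ?normc_ge0 //.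
  exact: normcD.
have -> : \sum_i (normc (f i) + normc (g i)) ^+ 2 =
  norm2 f ^+ 2 + norm2 g ^+ 2 + (\sum_i normc (f i) * normc (g i)) *+ 2.
  rewrite !norm2_sqr -sumrMnl -!big_split /=; apply: eq_bigr => i _.
  by rewrite sqrrD addrAC.
by rewrite lerD2l lerMn2r /= sum_normc_le.
Qed.

Lemma norm2Z I (c : C) (f : I -> C) : norm2 (fun i => c * f i) = normc c * norm2 f.
Proof.
apply: (@pexpIrn _ 2); rewrite ?nnegrE ?mulr_ge0 ?norm2_ge0 ?normc_ge0 //.
rewrite exprMn !norm2_sqr mulr_sumr; apply: eq_bigr => i _.
by rewrite normcM exprMn.
Qed.

Lemma norm2N I (f : I -> C) : norm2 (fun i => - f i) = norm2 f.
Proof. by rewrite /norm2; congr Num.sqrt; apply: eq_bigr => i _; rewrite normcN1. Qed.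

Lemma norm2B I (f g : I -> C) : norm2 (fun i => f i - g i) <= norm2 f + norm2 g.
Proof. by apply: le_trans (norm2D _ _) _; rewrite norm2N. Qed.

Lemma norm20 I : norm2 (fun _ : I => 0 : C) = 0.
Proof.
rewrite /norm2 big1 ?sqrtr0 // => i _; by rewrite normc0 expr0n.
Qed.

Lemma norm2_sum I J (P : pred J) (f : J -> I -> C) :
  norm2 (fun i => \sum_(j | P j) f j i) <= \sum_(j | P j) norm2 (f j).
Proof.
pose K (g : I -> C) (b : R) := norm2 g <= b.
suff: K (fun i => \sum_(j | P j) f j i) (\sum_(j | P j) norm2 (f j)) by [].
have -> : (fun i => \sum_(j | P j) f j i) = \sum_(j | P j) f j.
  by apply/funext => i; rewrite fct_sumE.
elim/big_ind2: _ => [|g a g' b h h'|j _]; rewrite /K ?norm20 //.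
by apply: le_trans (norm2D _ _) _; apply: lerD.
Qed.

Lemma norm2_coord I (f : I -> C) i : normc (f i) <= norm2 f.
Proof.
rewrite -ler_sqr ?nnegrE ?normc_ge0 ?norm2_ge0 // norm2_sqr (bigD1 i) //= lerDl.
by apply: sumr_ge0 => j _; apply: sqr_ge0.
Qed.

Lemma norm2_eq0 I (f : I -> C) : norm2 f = 0 -> forall i, f i = 0.
Proof.
move=> h i; apply: eq0_normc; apply/eqP; rewrite eq_le normc_ge0 andbT.
by rewrite -h norm2_coord.
Qed.

Lemma norm2_inj I J (k : I -> J) (f : J -> C) :
  injective k -> norm2 (f \o k) <= norm2 f.
Proof.
move=> kinj; apply: norm2_le_sqr; rewrite ?norm2_ge0 // norm2_sqr /=.
rewrite -(big_imset (fun j => normc (f j) ^+ 2)) /=; last by move=> ? ? _ _; apply: kinj.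
rewrite [leRHS](bigID (mem [set k i | i : I])) /= lerDl.
by apply: sumr_ge0 => j _; apply: sqr_ge0.
Qed.

Lemma norm2_bij I J (k : I -> J) (f : J -> C) :
  bijective k -> norm2 (f \o k) = norm2 f.
Proof.
case=> k' kK k'K; apply/eqP; rewrite eq_le norm2_inj; last exact: can_inj kK.
have := norm2_inj (f \o k) (can_inj k'K).
by rewrite (_ : (f \o k) \o k' = f) //; apply/funext => j /=; rewrite k'K.
Qed.

Lemma norm2_delta I (i : I) : norm2 (fun j => (j == i)%:R) = 1 :> R.
Proof.
rewrite /norm2 (bigD1 i) //= eqxx normc1 expr1n big1 ?addr0 ?sqrtr1 //.
by move=> j /negbTE ->; rewrite normc0 expr0n.
Qed.

Lemma norm2_const I (c : C) : norm2 (fun _ : I => c) = Num.sqrt #|I|%:R * normc c.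
Proof.
rewrite /norm2 sumr_const -[in LHS]mulr_natl sqrtrM ?ler0n // sqrtr_sqr.
by rewrite ger0_norm ?normc_ge0.
Qed.

(** Pairing [f] with its own conjugate attains the norm. *)
Lemma norm2_dual I (f : I -> C) (B : R) : 0 <= B ->
  (forall g : I -> C, normc (\sum_i g i * f i) <= B * norm2 g) -> norm2 f <= B.
Proof.
move=> B0 /(_ (fun i => (f i)^*)).
have -> : \sum_i (f i)^* * f i = (norm2 f ^+ 2)%:C.
  by rewrite norm2_sqr rmorph_sum; apply: eq_bigr => i _; rewrite mul_conjc.
rewrite normc_real ?sqr_ge0 // norm2_conj expr2 => h.
have [->//|hn0] := eqVneq (norm2 f) 0.
by rewrite -(ler_pM2r (_ : 0 < norm2 f)) // lt_def hn0 norm2_ge0.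
Qed.

Lemma norm2_pair I J (f : I * J -> C) :
  norm2 f ^+ 2 = \sum_i norm2 (fun j => f (i, j)) ^+ 2.
Proof.
rewrite norm2_sqr; transitivity (\sum_p normc (f (p.1, p.2)) ^+ 2).
  by apply: eq_bigr => -[].
rewrite -(pair_bigA _ (fun i j => normc (f (i, j)) ^+ 2)) /=.
by apply: eq_bigr => i _; rewrite norm2_sqr.
Qed.

Lemma sum_norm2_le I J (f : I * J -> C) :
  \sum_i norm2 (fun j => f (i, j)) <= Num.sqrt #|I|%:R * norm2 f.
Proof.
have h0 : 0 <= \sum_i norm2 (fun j => f (i, j)).
  by apply: sumr_ge0 => i _; apply: norm2_ge0.
rewrite -ler_sqr ?nnegrE ?mulr_ge0 ?norm2_ge0 ?sqrtr_ge0 // exprMn.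
rewrite sqr_sqrtr ?ler0n // norm2_pair.
have := cauchy_schwarz_real (fun _ : I => 1) (fun i => norm2 (fun j => f (i, j))).
under eq_bigr do rewrite mul1r.
by under [X in _ <= X * _]eq_bigr do rewrite expr1n; rewrite sumr_const.
Qed.

Lemma norm2_swap I J (f : I * J -> C) : norm2 (fun p : J * I => f (p.2, p.1)) = norm2 f.
Proof.
rewrite -(@norm2_bij _ _ (fun p : J * I => (p.2, p.1)) f) //.
by exists (fun p => (p.2, p.1)); case.
Qed.

End HS.

(** * The Hilbert space l2 *)

Section L2.
Variable R : realType.
Local Notation C := R[i].

(** The norm of l2 is the supremum of these truncated norms, which inherit
    all inequalities of finite sums. *)
Definition norm2_upto (m : nat) (x : nat -> C) : R := norm2 (fun i : 'I_m => x i).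

Lemma norm2_upto_mono m n x : (m <= n)%N -> norm2_upto m x <= norm2_upto n x.
Proof.
move=> mn; rewrite /norm2_upto.
apply: (@norm2_inj _ _ _ (widen_ord mn) (fun i : 'I_n => x i)).
by move=> i j /(congr1 val) /= /val_inj.
Qed.

Lemma norm2_uptoD m x y : norm2_upto m (x + y) <= norm2_upto m x + norm2_upto m y.
Proof. exact: norm2D. Qed.

Definition l2mem : {pred (nat -> C)} :=
  fun x => `[< exists B : R, forall m, norm2_upto m x <= B >].

Fact l2mem_submod : submod_closed l2mem.
Proof.
split=> [|c x y].
  apply/asboolP; exists 0 => m; rewrite /norm2_upto norm2_le_sqr // big1 ?expr0n //.
  by move=> i _; rewrite normc0 expr0n.
move=> /asboolP [B hB] /asboolP [B' hB']; apply/asboolP.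
exists (normc c * B + B') => m; apply: le_trans (norm2_uptoD _ _ _) _.
apply: lerD => //.
by rewrite (_ : norm2_upto m _ = normc c * norm2_upto m x) ?ler_wpM2l ?normc_ge0 // -norm2Z.
Qed.
HB.instance Definition _ := GRing.isSubmodClosed.Build C (nat -> C) l2mem
  l2mem_submod.

Record l2 := L2 { l2f :> nat -> C; l2P : l2f \in l2mem }.
HB.instance Definition _ := [isSub for l2f].
HB.instance Definition _ := [Choice of l2 by <:].
HB.instance Definition _ := [SubChoice_isSubLmodule of l2 by <:].


Implicit Types x y : l2.

Lemma l2P_ex x : exists B : R, forall m, norm2_upto m x <= B.
Proof. by apply/asboolP; apply: (valP x). Qed.

Lemma l2_eq x y : (forall i, x i = y i) -> x = y.
Proof. by move=> e; apply: val_inj; apply/funext. Qed.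

Lemma l2D x y i : (x + y) i = x i + y i. Proof. by []. Qed.
Lemma l2B x y i : (x - y) i = x i - y i. Proof. by []. Qed.
Lemma l2Z c x i : (c *: x) i = c * x i. Proof. by []. Qed.
Lemma l20 i : (0 : l2) i = 0. Proof. by []. Qed.
Lemma l2sum (I : Type) (r : seq I) (P : pred I) (f : I -> l2) i :
  (\sum_(j <- r | P j) f j) i = \sum_(j <- r | P j) f j i.
Proof. by elim/big_rec2: _ => // j a b _ <-. Qed.

Definition l2nrm x : R := sup (range (fun m => norm2_upto m x)).

Lemma l2nrm_has_sup x : has_sup (range (fun m => norm2_upto m x)).
Proof.
split; first by exists (norm2_upto 0 x); exists 0%N.
by have [B hB] := l2P_ex x; exists B => _ [m _ <-].
Qed.

Lemma norm2_upto_le m x : norm2_upto m x <= l2nrm x.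
Proof. by apply: sup_ubound; [case: (l2nrm_has_sup x)|exists m]. Qed.

Lemma l2nrm_le x (B : R) : (forall m, norm2_upto m x <= B) -> l2nrm x <= B.
Proof.
by move=> h; apply: ge_sup => [|_ [m _ <-]//]; exists (norm2_upto 0 x); exists 0%N.
Qed.

Lemma l2nrm_ge0 x : 0 <= l2nrm x.
Proof. exact: le_trans (norm2_ge0 _) (norm2_upto_le 0 x). Qed.

Lemma l2nrmD x y : l2nrm (x + y) <= l2nrm x + l2nrm y.
Proof.
apply: l2nrm_le => m; apply: le_trans (norm2D _ _) _.
by apply: lerD; exact: norm2_upto_le.
Qed.

Lemma l2nrmZ c x : l2nrm (c *: x) = normc c * l2nrm x.
Proof.
have le1 (d : C) (z : l2) : l2nrm (d *: z) <= normc d * l2nrm z.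
  apply: l2nrm_le => m; rewrite (_ : norm2_upto m _ = normc d * norm2_upto m z) -?norm2Z //.
  by rewrite norm2Z ler_wpM2l ?normc_ge0 ?norm2_upto_le.
apply/eqP; rewrite eq_le le1 /=.
have [->|c0] := eqVneq c 0; first by rewrite normc0 mul0r l2nrm_ge0.
have := le1 c^-1 (c *: x); rewrite scalerA mulVf // scale1r normcV.
rewrite -ler_pdivlMl ?invr_gt0 ?invrK //.
by rewrite lt_def normc_ge0 andbT; apply: contra c0 => /eqP /eq0_normc ->.
Qed.

Lemma l2nrm_coord x i : normc (x i) <= l2nrm x.
Proof.
apply: le_trans (norm2_upto_le i.+1 x).
exact: (norm2_coord (fun j : 'I_i.+1 => x j) ord_max).
Qed.

Lemma l2nrm_eq0 x : l2nrm x = 0 -> x = 0.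
Proof.
move=> h; apply: l2_eq => i; apply: eq0_normc; apply/eqP.
by rewrite eq_le normc_ge0 andbT -h l2nrm_coord.
Qed.

Lemma norm2_subfamily (I : finType) (k : I -> nat) x :
  injective k -> norm2 (fun i => x (k i)) <= l2nrm x.
Proof.
move=> kinj; pose m := (\max_i k i).+1.
have km i : (k i < m)%N by rewrite ltnS; apply: leq_bigmax.
apply: le_trans (norm2_upto_le m x).
apply: (@norm2_inj _ _ _ (fun i => Ordinal (km i)) (fun j : 'I_m => x j)).
by move=> i j [] /kinj.
Qed.

Lemma l2nrmC_D x y : (l2nrm (x + y))%:C <= (l2nrm x)%:C + (l2nrm y)%:C :> C.
Proof. by rewrite -rmorphD lecR l2nrmD. Qed.

Lemma l2nrmC_Z (c : C) x : (l2nrm (c *: x))%:C = `|c| * (l2nrm x)%:C :> C.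
Proof. by rewrite l2nrmZ rmorphM. Qed.

Lemma l2nrmC_eq0 x : (l2nrm x)%:C = 0 :> C -> x = 0.
Proof. by move=> /complexI /l2nrm_eq0. Qed.

HB.instance Definition _ := Lmodule_isNormed.Build C l2 l2nrmC_D l2nrmC_Z l2nrmC_eq0.

Lemma ballE x (e : R) y : ball x e%:C y <-> l2nrm (x - y) < e.
Proof. by rewrite -ball_normE /= -ltcR. Qed.

Lemma posC (e : C) : 0 < e -> exists2 d : R, 0 < d & e = d%:C.
Proof.
case: e => a b; rewrite ltcE /= => /andP[/eqP -> a0]; by exists a.
Qed.

Lemma ReB (z w : C) : complex.Re (z - w) = complex.Re z - complex.Re w.
Proof. by case: z w => a b [c d]. Qed.

Lemma ImB (z w : C) : complex.Im (z - w) = complex.Im z - complex.Im w.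
Proof. by case: z w => a b [c d]. Qed.

Lemma Re_le (z : C) : `|complex.Re z| <= normc z.
Proof. by case: z => a b /=; rewrite -sqrtr_sqr ler_wsqrtr // lerDl sqr_ge0. Qed.

Lemma Im_le (z : C) : `|complex.Im z| <= normc z.
Proof. by case: z => a b /=; rewrite -sqrtr_sqr ler_wsqrtr // lerDr sqr_ge0. Qed.

(** Coordinatewise limits exist because real and imaginary parts are Cauchy;
    the bound on each truncated norm of the difference passes to the limit
    with a uniform constant. *)
Lemma l2_complete (F : set_system l2) : ProperFilter F -> cauchy F -> cvg F.
Proof.
move=> FF Fc.
have FcE (e : R) : 0 < e -> exists x, F [set y | l2nrm (x - y) < e].
  move=> e0; have /cauchyP Fc' := Fc; have eC : 0 < e%:C :> C by rewrite ltcR.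
  have [x hx] := Fc' _ eC.
  by exists x; apply: filterS hx => y /ballE.
have coord (f : C -> R) : (forall z w, f (z - w) = f z - f w) ->
    (forall z, `|f z| <= normc z) ->
    forall i, exists a : R, forall e : R, 0 < e ->
      F [set y : l2 | `|a - f (y i)| < e].
  move=> fB fle i; pose g (y : l2) : R^o := f (y i).
  have : cvg (g @ F).
    apply: cauchy_cvg; apply: cauchy_exP => e e0.
    have [x hx] := FcE e e0; exists (g x); rewrite /nbhs /= /nbhs /=.
    apply: filterS hx => y /= hy; rewrite /ball /= /g -fB.
    by apply: le_lt_trans (fle _) _; apply: le_lt_trans hy; exact: (l2nrm_coord (x - y)).
  move=> /cvg_ex [a ha]; exists a => e e0.
  by move/cvgrPdist_lt : ha => /(_ e e0).
have [re hre] : exists re : nat -> R, forall i e, 0 < e ->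
    F [set y : l2 | `|re i - complex.Re (y i)| < e].
  by have /boolp.choice [w hw] := coord _ ReB Re_le; exists w.
have [im him] : exists im : nat -> R, forall i e, 0 < e ->
    F [set y : l2 | `|im i - complex.Im (y i)| < e].
  by have /boolp.choice [w hw] := coord _ ImB Im_le; exists w.
pose l (i : nat) : C := re i +i* im i.
have hl i (e : R) : 0 < e -> F [set y : l2 | normc (l i - y i) < e].
  move=> e0; have e2 : 0 < e / 2 by rewrite divr_gt0.
  apply: filterS2 (hre i _ e2) (him i _ e2) => y /= h1 h2.
  have -> : l i - y i = (re i - complex.Re (y i))%:C
      + 'i * (im i - complex.Im (y i))%:C.
    by rewrite /l; case: (y i) => a b; simpc.
  apply: le_lt_trans (normcD _ _) _; rewrite normcM normc_i mul1r /= expr0n /= !addr0 !sqrtr_sqr [e in _ < e]splitr.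
  by rewrite ltrD.
have key (e : R) x : 0 < e -> F [set y | l2nrm (x - y) < e] ->
    forall m, norm2_upto m (fun i => l i - x i) <= e.
  move=> e0 hx m; apply/ler_addgt0Pr => d d0.
  have dm : 0 < d / m.+1%:R by rewrite divr_gt0 ?ltr0n.
  have hall : F [set y : l2 | forall i : 'I_m, normc (l i - y i) < d / m.+1%:R].
    by apply: filter_forall => i; exact: hl.
  have [y [/= hy1 hy2]] := filter_ex (filterI hx hall).
  have -> : norm2_upto m (fun i => l i - x i) = norm2 (fun i : 'I_m => (l i - y i) - (x - y) i).
    by apply: eq_norm2 => i; rewrite l2B opprB addrA subrK.
  apply: le_trans (norm2B _ _) _; rewrite addrC lerD //.
    by apply: le_trans (ltW hy1); exact: norm2_upto_le.
  apply: le_trans (_ : \sum_(i < m) d / m.+1%:R <= d); last first.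
    rewrite sumr_const card_ord -[leLHS]mulr_natr -mulrA ler_piMr ?(ltW d0) //.
    by rewrite ler_pdivrMl ?ltr0n // mulr1 ler_nat.
  apply: norm2_le_sqr; first by apply: sumr_ge0 => _ _; exact: ltW.
  rewrite expr2 [leRHS]mulr_suml ler_sum // => i _.
  rewrite expr2 ler_pM ?normc_ge0 ?(ltW (hy2 i)) //.
  apply: le_trans (ltW (hy2 i)) _; rewrite (bigD1 i) //= lerDl.
  by apply: sumr_ge0 => _ _; exact: ltW.
have lmem : l \in l2mem.
  have [x hx] := FcE 1 ltr01; have [B hB] := l2P_ex x.
  apply/asboolP; exists (1 + B) => m.
  have -> : norm2_upto m l = norm2 (fun i : 'I_m => (l i - x i) + x i).
    by apply: eq_norm2 => i; rewrite subrK.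
  by apply: le_trans (norm2D _ _) _; apply: lerD; [exact: key|exact: hB].
apply/cvg_ex; exists (L2 lmem); apply/fcvg_ballP => e /posC [d d0 ->].
have d3 : 0 < d / 3 by rewrite divr_gt0.
have [x hx] := FcE _ d3.
have h1 : l2nrm (L2 lmem - x) <= d / 3 by apply: l2nrm_le => m; exact: (key (d / 3) x d3 hx m).
apply: filterS hx => y /= hy; apply/ballE.
rewrite -(subrK x (L2 lmem)) -addrA.
apply: le_lt_trans (l2nrmD _ _) _.
lra.
Qed.

HB.instance Definition _ := Uniform_isComplete.Build l2 l2_complete.

Definition l2cnm : completeNormedModType C := l2.

End L2.

(** * Coordinate vectors and truncations in l2 *)

Section L2basis.
Variable R : realType.
Local Notation C := R[i].
Local Notation H := (l2 R).

Lemma l2mask_mem (M : nat -> bool) (x : H) :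
  (fun i => if M i then x i else 0) \in @l2mem R.
Proof.
have [B hB] := l2P_ex x; apply/asboolP; exists B => m.
apply: le_trans (hB m); apply: le_norm2 => i.
by case: (M i); rewrite ?normc0 ?normc_ge0.
Qed.

Definition l2mask M (x : H) : H := L2 (l2mask_mem M x).

Lemma l2maskE M x i : l2mask M x i = if M i then x i else 0.
Proof. by []. Qed.

Lemma l2nrm_mask M x : l2nrm (l2mask M x) <= l2nrm x.
Proof.
apply: l2nrm_le => m; apply: le_trans (norm2_upto_le m x); apply: le_norm2 => i.
by rewrite l2maskE; case: (M i); rewrite ?normc0 ?normc_ge0.
Qed.

Lemma l2mask_linear M c x y : l2mask M (c *: x + y) = c *: l2mask M x + l2mask M y.
Proof.
apply: l2_eq => i; rewrite !l2D !l2Z !l2maskE l2D l2Z.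
by case: (M i); rewrite ?mulr0 ?addr0.
Qed.

Fact l2delta_mem (i : nat) : (fun j => (j == i)%:R) \in @l2mem R.
Proof.
apply/asboolP; exists 1 => m.
have [im|mi] := ltnP i m.
  by rewrite -[leRHS](norm2_delta R (Ordinal im)) le_norm2 // => j.
rewrite -[leRHS](norm2_delta R tt) (_ : norm2_upto m _ = norm2 (fun j : 'I_m => 0 : C)).
  by rewrite norm20 norm2_ge0.
by rewrite /norm2_upto; apply: eq_norm2 => j; rewrite ltn_eqF // (leq_trans (ltn_ord j)).
Qed.

Definition l2delta (i : nat) : H := L2 (l2delta_mem i).

Lemma l2deltaE i j : l2delta i j = (j == i)%:R. Proof. by []. Qed.

Lemma l2nrm_delta_sum (I : finType) (k : I -> nat) (v : I -> C) :
  injective k -> l2nrm (\sum_i v i *: l2delta (k i)) <= norm2 v.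
Proof.
move=> kinj; apply: l2nrm_le => m; apply: norm2_le_sqr; rewrite ?norm2_ge0 //.
have -> : \sum_(j < m) normc ((\sum_i v i *: l2delta (k i) : H) j) ^+ 2 =
    \sum_(j < m) \sum_i ((nat_of_ord j == k i)%:R * normc (v i) ^+ 2).
  apply: eq_bigr => j _; rewrite l2sum.
  rewrite (eq_bigr (fun i => v i * (nat_of_ord j == k i)%:R)) //.
  have [[i ji]|no] := pselect (exists i, nat_of_ord j = k i).
    rewrite ji (bigD1 i) //= [X in _ + X]big1 => [|i' ni]; last first.
      by rewrite (inj_eq kinj) eq_sym (negbTE ni) ?mulr0.
    rewrite [RHS](bigD1 i) //= [X in _ = _ + X]big1 => [|i' ni]; last first.
      by rewrite (inj_eq kinj) eq_sym (negbTE ni) ?mul0r.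
    by rewrite eqxx mulr1 mul1r !addr0.
  rewrite !big1 ?normc0 ?expr0n // => i _.
    by case: eqP => [e|_]; [case: no; exists i|rewrite mul0r].
  by case: eqP => [e|_]; [case: no; exists i|rewrite mulr0].
rewrite exchange_big norm2_sqr ler_sum // => i _; rewrite -mulr_suml.
rewrite ler_piMl ?sqr_ge0 // -natr_sum -[1]/(1%:R) ler_nat.
have [im|mi] := ltnP (k i) m.
  rewrite (bigD1 (Ordinal im)) //= eqxx big1 // => j; rewrite -val_eqE /=.
  by move=> /negbTE ->.
by rewrite big1 // => j _; rewrite ltn_eqF // (leq_trans (ltn_ord j)).
Qed.

Lemma l2nrm_delta i : l2nrm (l2delta i) <= 1.
Proof.
have := @l2nrm_delta_sum 'I_1 (fun=> i) (fun=> 1) _; rewrite big_ord1 scale1r.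
move=> /(_ _)/le_trans; apply; first by move=> a b _; rewrite !ord1.
by rewrite norm2_const card_ord sqrtr1 normc1 mulr1.
Qed.

(** Once the first [m0] coordinates carry almost all of the norm, the part
    dropped by any mask that keeps them is small by Pythagoras. Stating this
    for arbitrary masks serves both the truncations to intervals and those
    to blocks. *)
Lemma trunc_tail (x : H) (e : R) : 0 < e ->
  exists m0, forall M : nat -> bool, (forall i, (i < m0)%N -> M i) -> l2nrm (x - l2mask M x) <= e.
Proof.
move=> e0; have [x0|xn0] := eqVneq (l2nrm x) 0.
  exists 0%N => M _; rewrite (l2nrm_eq0 x0).
  rewrite (_ : 0 - _ = 0); last by apply: l2_eq => i; rewrite l2B l2maskE l20 if_same subrr.
  by rewrite (_ : l2nrm 0 = 0) ?ltW // -x0 (l2nrm_eq0 x0).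
have xgt0 : 0 < l2nrm x by rewrite lt_def xn0 l2nrm_ge0.
pose d := e ^+ 2 / (2 * l2nrm x).
have d0 : 0 < d by rewrite divr_gt0 ?exprn_gt0 ?mulr_gt0.
have [_ [m0 _ <-] hm0] := sup_adherent d0 (l2nrm_has_sup x).
exists m0 => M hM; apply: l2nrm_le => m.
pose m1 := maxn m m0.
apply: le_trans (norm2_upto_mono _ (leq_maxl m m0)) _; rewrite -/m1.
apply: norm2_le_sqr; first exact: ltW.
have wE i : (x - l2mask M x) i = if M i then 0 else x i.
  by rewrite l2B l2maskE; case: (M i); rewrite ?subrr ?subr0.
move: (x - l2mask M x) wE => w wE.
have sp : \sum_(i < m1) normc (w i) ^+ 2 + norm2_upto m0 x ^+ 2 <= norm2_upto m1 x ^+ 2.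
  have m01 : (m0 <= m1)%N by rewrite leq_maxr.
  rewrite /norm2_upto !norm2_sqr.
  rewrite (big_ord_widen m1 (fun i => normc (x i) ^+ 2) m01) /=.
  rewrite [X in _ + X <= _]big_mkcond -big_split ler_sum // => i _ /=.
  rewrite wE; case: ltnP => [/hM ->|_].
    by rewrite normc0 expr0n add0r.
  by rewrite addr0; case: (M i); rewrite ?normc0 ?expr0n ?sqr_ge0.
have h1 : norm2_upto m1 x ^+ 2 <= l2nrm x ^+ 2.
  by rewrite ler_sqr ?nnegrE ?l2nrm_ge0 ?norm2_ge0 // norm2_upto_le.
have h2 : l2nrm x ^+ 2 - norm2_upto m0 x ^+ 2 <= e ^+ 2.
  rewrite subr_sqr.
  have a1 : l2nrm x - norm2_upto m0 x <= d by rewrite lerBlDr -lerBlDl ltW.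
  have a2 : l2nrm x + norm2_upto m0 x <= 2 * l2nrm x by have := norm2_upto_le m0 x; lra.
  have a3 : 0 <= l2nrm x - norm2_upto m0 x by rewrite subr_ge0 norm2_upto_le.
  have a4 : 0 <= l2nrm x + norm2_upto m0 x by rewrite addr_ge0 ?l2nrm_ge0 ?norm2_ge0.
  apply: le_trans (ler_pM a3 a4 a1 a2) _.
  by rewrite /d divfK // mulf_neq0.
lra.
Qed.

Lemma mask_upto (m : nat) (x : H) :
  l2mask (fun i => (i < m)%N) x = \sum_(c < m) x c *: l2delta c.
Proof.
apply: l2_eq => i; rewrite l2sum l2maskE; case: ltnP => [im|mi].
  rewrite (eq_bigr (fun c : 'I_m => x c * (i == c)%:R)) //.
  rewrite (bigD1 (Ordinal im)) //= eqxx mulr1 big1 ?addr0 // => c nc.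
  case: eqP => [e|_]; last by rewrite mulr0.
  by case/eqP: nc; apply: val_inj.
rewrite (eq_bigr (fun c : 'I_m => x c * (i == c)%:R)) //.
by rewrite big1 // => c _; rewrite gtn_eqF ?mulr0 // (leq_trans (ltn_ord c)).
Qed.

End L2basis.

(** * Operator spaces given by a family of contractions *)

Section Opnorm.
Variables (R : realType) (n : nat).
Local Notation C := R[i].

Lemma l2normE (v : 'cV[C]_n) : l2norm v = norm2 (fun i => v i 0).
Proof. by []. Qed.

Lemma opnorm_has_ubound (a : 'M[C]_n) :
  has_ubound [set l2norm (a *m v) | v in [set v : 'cV[C]_n | l2norm v <= 1]].
Proof.
exists (\sum_i \sum_j normc (a i j)) => _ [v /= v1 <-]; rewrite l2normE.
apply: norm2_le_sqr => [|].
  by apply: sumr_ge0 => i _; apply: sumr_ge0 => j _; apply: normc_ge0.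
have h0 i : 0 <= \sum_j normc (a i j).
  by apply: sumr_ge0 => j _; apply: normc_ge0.
rewrite expr2 mulr_suml ler_sum // => i _; rewrite expr2 ler_pM ?normc_ge0 //.
  rewrite mxE; apply: le_trans (normc_sum _ _) _; apply: ler_sum => j _.
  rewrite normcM ler_piMr ?normc_ge0 //; apply: le_trans v1.
  exact: (norm2_coord (fun i => v i 0)).
apply: (@le_trans _ _ (\sum_j normc (a i j))).
  rewrite mxE; apply: le_trans (normc_sum _ _) _; apply: ler_sum => j _.
  rewrite normcM ler_piMr ?normc_ge0 //; apply: le_trans v1.
  exact: (norm2_coord (fun i => v i 0)).
by rewrite [leRHS](bigD1 i) //= lerDl; apply: sumr_ge0.
Qed.

Lemma opnormP (a : 'M[C]_n) (v : 'cV[C]_n) :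
  l2norm (a *m v) <= opnorm a * l2norm v.
Proof.
have [v0|vn0] := eqVneq (l2norm v) 0.
  have -> : v = 0 by apply/matrixP => i j; rewrite (ord1 j) mxE (norm2_eq0 v0).
  rewrite mulmx0 !l2normE (_ : (fun i => _) = fun=> 0) ?norm20 ?mulr0 //.
  by apply/funext => i; rewrite mxE.
have vgt0 : 0 < l2norm v by rewrite lt_def vn0 norm2_ge0.
have scal (c : C) (w : 'cV[C]_n) : l2norm (c *: w) = normc c * l2norm w.
  by rewrite !l2normE -norm2Z; apply: eq_norm2 => i; rewrite mxE.
rewrite -ler_pdivrMr //.
have nc : normc ((l2norm v)^-1%:C : C) = (l2norm v)^-1.
  by rewrite normc_real ?invr_ge0 ?ltW.
rewrite mulrC -[X in X * _]nc -scal scalemxAr.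
apply: sup_ubound; first exact: opnorm_has_ubound.
by exists ((l2norm v)^-1%:C *: v) => //=; rewrite scal nc mulVf.
Qed.

Lemma opnorm_ge0 (a : 'M[C]_n) : 0 <= opnorm a.
Proof.
apply: (@le_trans _ _ (l2norm (a *m 0))); first exact: norm2_ge0.
apply: sup_ubound; first exact: opnorm_has_ubound.
exists 0 => //=; rewrite l2normE (_ : (fun i => _) = fun=> 0) ?norm20 //.
by apply/funext => i; rewrite mxE.
Qed.

Lemma norm2_mulmxl (S : finType) (a : 'M[C]_n) (f : 'I_n * S -> C) :
  norm2 (fun p : 'I_n * S => \sum_k a p.1 k * f (k, p.2)) <= opnorm a * norm2 f.
Proof.
apply: norm2_le_sqr; first by rewrite mulr_ge0 ?opnorm_ge0 ?norm2_ge0.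
rewrite exprMn -(norm2_swap f) norm2_pair mulr_sumr -norm2_sqr -norm2_swap norm2_pair /=.
apply: ler_sum => s _; rewrite -exprMn ler_sqr ?nnegrE ?mulr_ge0 ?opnorm_ge0 ?norm2_ge0 //.
have := opnormP a (\col_k f (k, s)); rewrite !l2normE.
rewrite (_ : (fun i => (\col_k _) i 0) = fun i => f (i, s)); last first.
  by apply/funext => i; rewrite mxE.
rewrite (_ : (fun i => (a *m _) i 0) = fun i => \sum_k a i k * f (k, s)) //.
by apply/funext => i; rewrite mxE; apply: eq_bigr => k _; rewrite mxE.
Qed.

(** This is the bound for the transpose, obtained by duality since the
    operator norm is only defined by the action on columns. *)
Lemma norm2_mulmxr (S : finType) (a : 'M[C]_n) (f : 'I_n * S -> C) :
  norm2 (fun p : 'I_n * S => \sum_k f (k, p.2) * a k p.1) <= opnorm a * norm2 f.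
Proof.
apply: norm2_dual => [|g]; first by rewrite mulr_ge0 ?opnorm_ge0 ?norm2_ge0.
rewrite (_ : \sum_i _ = \sum_p f p * \sum_k a p.1 k * g (k, p.2)).
  apply: le_trans (cauchy_schwarz _ _) _; rewrite [opnorm a * _]mulrC -mulrA.
  by rewrite ler_wpM2l ?norm2_ge0 ?norm2_mulmxl.
transitivity (\sum_(s : S) \sum_(i : 'I_n) \sum_(k : 'I_n) g (i, s) * f (k, s) * a k i).
  rewrite exchange_big pair_bigA; apply: eq_bigr => -[i s] _ /=.
  by rewrite mulr_sumr; apply: eq_bigr => k _; rewrite mulrA.
rewrite [RHS](eq_bigr (fun p => \sum_k f (p.1, p.2) * (a p.1 k * g (k, p.2)))); last first.
  by move=> -[k s] _ /=; rewrite mulr_sumr.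
rewrite -(pair_bigA _ (fun i s => \sum_k f (i, s) * (a i k * g (k, s)))) /=.
rewrite [RHS]exchange_big; apply: eq_bigr => s _.
rewrite exchange_big; apply: eq_bigr => k _; apply: eq_bigr => i _ /=.
by ring.
Qed.

End Opnorm.

(** The contraction with index [j] sends [x] to the matrix indexed by [testA
    j * testB j] that has [test_fun l x] at the cell [(test_row l, test_col
    l)], contributions to the same cell being added. Its norm is the
    supremum of the bilinear forms with unit vectors [eta], [xi]; bilinear
    rather than sesquilinear forms avoid conjugates and have the same
    supremum. *)
Record testFamily (R : realType) (X : completeNormedModType R[i]) := TestFamily {
  test_idx : Type;
  test_pt : test_idx;
  testL : test_idx -> finType;
  testA : test_idx -> finType;
  testB : test_idx -> finType;
  test_row : forall j, testL j -> testA j;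
  test_col : forall j, testL j -> testB j;
  test_fun : forall j, testL j -> X -> R[i];
  test_linear : forall j l (a : R[i]) (x y : X),
    test_fun (j:=j) l (a *: x + y) = a * test_fun (j:=j) l x + test_fun (j:=j) l y;
  test_le : forall j (eta : testA j -> R[i]) (xi : testB j -> R[i]) (x : X),
    normc (\sum_(l : testL j) eta (test_row l) * xi (test_col l) * test_fun l x)
      <= norm2 eta * norm2 xi * complex.Re `|x|;
  test_norming : forall (x : X) (b : R),
    (forall j (eta : testA j -> R[i]) (xi : testB j -> R[i]),
       norm2 eta <= 1 -> norm2 xi <= 1 ->
       normc (\sum_(l : testL j) eta (test_row l) * xi (test_col l) * test_fun l x)
         <= b) -> complex.Re `|x| <= b
}.

Arguments test_pt {R X} _.
Arguments testL {R X} _ _.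
Arguments testA {R X} _ _.
Arguments testB {R X} _ _.
Arguments test_norming {R X} _ _ _ _.

Section FamilyNorm.
Variables (R : realType) (X : completeNormedModType R[i]) (F : testFamily X).
Local Notation C := R[i].
Local Notation rn x := (complex.Re `|x|).

Lemma rn_ge0 (x : X) : 0 <= rn x.
Proof. by have := normr_ge0 x; rewrite lecE => /andP[]. Qed.

Lemma rnC (x : X) : (rn x)%:C = `|x|.
Proof. by apply: RRe_real; exact: normr_real. Qed.

Lemma test_fun0 j (l : testL F j) : test_fun l 0 = 0.
Proof. by have := test_linear l (-1) 0 0; rewrite scaler0 addr0 mulN1r addNr. Qed.

Lemma test_funD j (l : testL F j) (x y : X) :
  test_fun l (x + y) = test_fun l x + test_fun l y.
Proof. by have := test_linear l 1 x y; rewrite scale1r mul1r. Qed.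

Lemma test_funZ j (l : testL F j) c (x : X) :
  test_fun l (c *: x) = c * test_fun l x.
Proof. by have := test_linear l c x 0; rewrite addr0 test_fun0 addr0. Qed.

Lemma test_fun_sum j (l : testL F j) (I : Type) (r : seq I) (P : pred I) (f : I -> X) :
  test_fun l (\sum_(i <- r | P i) f i) = \sum_(i <- r | P i) test_fun l (f i).
Proof.
by apply: (big_morph _ (test_funD l) (test_fun0 l)).
Qed.

(** A vector of [C^n] tensor [C^A] is a function on ['I_n * A]; this is the
    matrix coefficient of the amplified contraction. *)
Definition test_form n j (eta : 'I_n * testA F j -> C) (xi : 'I_n * testB F j -> C)
    (x : 'M[X]_n) : C :=
  \sum_i \sum_k \sum_(l : testL F j)
    eta (i, test_row l) * xi (k, test_col l) * test_fun l (x i k).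

Definition test_mxnorm n (x : 'M[X]_n) : R :=
  sup [set b | exists j (eta : 'I_n * testA F j -> C) (xi : 'I_n * testB F j -> C),
        [/\ norm2 eta <= 1, norm2 xi <= 1 & b = normc (test_form eta xi x)]].

Lemma test_formD n j eta xi (x y : 'M[X]_n) :
  @test_form n j eta xi (x + y) = test_form eta xi x + test_form eta xi y.
Proof.
rewrite /test_form -big_split; apply: eq_bigr => i _.
rewrite -big_split; apply: eq_bigr => k _.
rewrite -big_split; apply: eq_bigr => l _ /=.
by rewrite mxE test_funD mulrDr.
Qed.

Lemma test_formZ n j eta xi c (x : 'M[X]_n) :
  @test_form n j eta xi (map_mx ( *:%R c) x) = c * test_form eta xi x.
Proof.
rewrite /test_form mulr_sumr; apply: eq_bigr => i _.
rewrite mulr_sumr; apply: eq_bigr => k _.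
rewrite mulr_sumr; apply: eq_bigr => l _ /=.
by rewrite mxE test_funZ; ring.
Qed.

Lemma test_form_scale n j eta xi (a b : C) (x : 'M[X]_n) :
  @test_form n j (fun p => a * eta p) (fun p => b * xi p) x = a * b * test_form eta xi x.
Proof.
rewrite /test_form mulr_sumr; apply: eq_bigr => i _.
rewrite mulr_sumr; apply: eq_bigr => k _.
rewrite mulr_sumr; apply: eq_bigr => l _ /=.
by ring.
Qed.

Lemma test_form_bound n j eta xi (x : 'M[X]_n) :
  normc (@test_form n j eta xi x) <= norm2 eta * norm2 xi * \sum_i \sum_k rn (x i k).
Proof.
rewrite /test_form mulr_sumr; apply: le_trans (normc_sum _ _) _.
apply: ler_sum => i _; rewrite mulr_sumr; apply: le_trans (normc_sum _ _) _.
apply: ler_sum => k _.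
apply: le_trans (test_le (fun s => eta (i, s)) (fun s => xi (k, s)) (x i k)) _.
rewrite ler_wpM2r ?rn_ge0 // ler_pM ?norm2_ge0 //.
  by apply: (norm2_inj eta) => s t [].
by apply: (norm2_inj xi) => s t [].
Qed.

Lemma test_mxnorm_has_sup n (x : 'M[X]_n) :
  has_sup [set b | exists j (eta : 'I_n * testA F j -> C) (xi : 'I_n * testB F j -> C),
        [/\ norm2 eta <= 1, norm2 xi <= 1 & b = normc (test_form eta xi x)]].
Proof.
split.
  exists (normc (@test_form n (test_pt F) (fun=> 0) (fun=> 0) x)).
  by exists (test_pt F), (fun=> 0), (fun=> 0); rewrite !norm20.
exists (\sum_i \sum_k rn (x i k)) => _ [j [eta [xi [h1 h2 ->]]]].
apply: le_trans (test_form_bound _ _ _) _; rewrite ler_piMl ?mulr_ile1 ?norm2_ge0 //.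
by apply: sumr_ge0 => i _; apply: sumr_ge0 => k _; apply: rn_ge0.
Qed.

Lemma test_mxnorm_ge0 n (x : 'M[X]_n) : 0 <= test_mxnorm x.
Proof.
apply: (@le_trans _ _ (normc (@test_form n (test_pt F) (fun=> 0) (fun=> 0) x))).
  exact: normc_ge0.
apply: sup_ubound; first by case: (test_mxnorm_has_sup x).
by exists (test_pt F), (fun=> 0), (fun=> 0); rewrite !norm20.
Qed.

Lemma test_form_le n j eta xi (x : 'M[X]_n) :
  normc (@test_form n j eta xi x) <= norm2 eta * norm2 xi * test_mxnorm x.
Proof.
have [e0|en0] := eqVneq (norm2 eta) 0.
  by rewrite e0 !mul0r (le_trans (test_form_bound _ _ _)) // e0 !mul0r.
have [x0|xn0] := eqVneq (norm2 xi) 0.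
  by rewrite x0 mulr0 mul0r (le_trans (test_form_bound _ _ _)) // x0 mulr0 mul0r.
have egt0 : 0 < norm2 eta by rewrite lt_def en0 norm2_ge0.
have xgt0 : 0 < norm2 xi by rewrite lt_def xn0 norm2_ge0.
have nc (a : R) : 0 < a -> normc (a^-1%:C : C) = a^-1.
  by move=> a0; rewrite normc_real ?invr_ge0 ?ltW.
rewrite -ler_pdivrMl ?mulr_gt0 // invfM.
rewrite -(nc _ egt0) -(nc _ xgt0) -!normcM -test_form_scale.
apply: sup_ubound; first by case: (test_mxnorm_has_sup x).
by eexists j, _, _; split; last reflexivity; rewrite norm2Z nc ?mulVf.
Qed.

Lemma test_mxnorm_le n (x : 'M[X]_n) (b : R) : 0 <= b ->
  (forall j eta xi, normc (@test_form n j eta xi x) <= norm2 eta * norm2 xi * b) ->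
  test_mxnorm x <= b.
Proof.
move=> b0 h; apply: ge_sup => [|_ [j [eta [xi [h1 h2 ->]]]]].
  by case: (test_mxnorm_has_sup x).
by apply: le_trans (h _ _ _) _; rewrite ler_piMl ?mulr_ile1 ?norm2_ge0.
Qed.

Lemma test_mxnormD n (x y : 'M[X]_n) : test_mxnorm (x + y) <= test_mxnorm x + test_mxnorm y.
Proof.
apply: test_mxnorm_le => [|j eta xi]; first by rewrite addr_ge0 ?test_mxnorm_ge0.
rewrite test_formD mulrDr; apply: le_trans (normcD _ _) _.
by apply: lerD; exact: test_form_le.
Qed.

Lemma test_mxnormZ n c (x : 'M[X]_n) : test_mxnorm (map_mx ( *:%R c) x) = normc c * test_mxnorm x.
Proof.
have le1 (d : C) (z : 'M[X]_n) : test_mxnorm (map_mx ( *:%R d) z) <= normc d * test_mxnorm z.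
  apply: test_mxnorm_le => [|j eta xi]; first by rewrite mulr_ge0 ?test_mxnorm_ge0 ?normc_ge0.
  by rewrite test_formZ normcM mulrCA ler_wpM2l ?normc_ge0 ?test_form_le.
apply/eqP; rewrite eq_le le1 /=.
have [->|c0] := eqVneq c 0; first by rewrite normc0 mul0r test_mxnorm_ge0.
have := le1 c^-1 (map_mx ( *:%R c) x).
rewrite (_ : map_mx _ (map_mx _ x) = x); last first.
  by apply/matrixP => i k; rewrite !mxE scalerA mulVf // scale1r.
rewrite normcV -ler_pdivlMl ?invr_gt0 ?invrK //.
by rewrite lt_def normc_ge0 andbT; apply: contra c0 => /eqP /eq0_normc ->.
Qed.

(** Test the amplification on vectors supported by the row [i] and the
    column [k]. *)
Lemma test_mxnorm_entry n (x : 'M[X]_n) i k : rn (x i k) <= test_mxnorm x.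
Proof.
apply: (test_norming F) => j eta xi h1 h2.
pose E (T : finType) (i : 'I_n) (f : T -> C) (p : 'I_n * T) : C :=
  if p.1 == i then f p.2 else 0.
have hE (T : finType) (i0 : 'I_n) (f : T -> C) : norm2 f <= 1 -> norm2 (E T i0 f) <= 1.
  move=> f1; rewrite norm2_le_sqr // -norm2_sqr norm2_pair (bigD1 i0) //= big1 => [|i' /negbTE ni].
    rewrite addr0 expr1n (_ : (fun j0 => _) = f) ?expr_le1 ?norm2_ge0 //.
    by apply/funext => t; rewrite /E /= eqxx.
  by rewrite (_ : (fun j0 => _) = fun=> 0) ?norm20 ?expr0n //; apply/funext => t; rewrite /E /= ni.
have := test_form_le (E _ i eta) (E _ k xi) x.
have -> : test_form (E _ i eta) (E _ k xi) x =
    \sum_(l : testL F j) eta (test_row l) * xi (test_col l) * test_fun l (x i k).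
  rewrite /test_form (bigD1 i) //= [X in _ + X]big1 ?addr0 => [|i' /negbTE ni]; last first.
    by rewrite big1 // => k' _; rewrite big1 // => l _; rewrite /E /= ni !mul0r.
  rewrite (bigD1 k) //= [X in _ + X]big1 ?addr0 => [|k' /negbTE nk]; last first.
    by rewrite big1 // => l _; rewrite /E /= nk mulr0 mul0r.
  by apply: eq_bigr => l _; rewrite /E /= !eqxx.
move/le_trans; apply; rewrite ler_piMl ?test_mxnorm_ge0 // mulr_ile1 ?norm2_ge0 ?hE //.
Qed.

Lemma test_mxnorm_eq0 n (x : 'M[X]_n) : test_mxnorm x = 0 -> x = 0.
Proof.
move=> h; apply/matrixP => i k; rewrite [RHS]mxE; apply/normr0_eq0; rewrite -rnC.
by apply/eqP; rewrite (inj_eq (@complexI R)) eq_le rn_ge0 andbT -h test_mxnorm_entry.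
Qed.

Lemma test_mxnorm1 (x : 'M[X]_1) : (test_mxnorm x)%:C = `|x 0 0|.
Proof.
rewrite -rnC; congr (_%:C); apply/eqP; rewrite eq_le test_mxnorm_entry andbT.
apply: test_mxnorm_le => [|j eta xi]; first exact: rn_ge0.
by apply: le_trans (test_form_bound _ _ _) _; rewrite !big_ord1.
Qed.

(** Multiplications of [x] by scalar matrices move to the test vectors. *)
Lemma test_mxnorm_ruan1 n (a b : 'M[C]_n) (x : 'M[X]_n) :
  test_mxnorm (rscalemx (lscalemx a x) b) <= opnorm a * test_mxnorm x * opnorm b.
Proof.
apply: test_mxnorm_le => [|j eta xi]; first by rewrite !mulr_ge0 ?test_mxnorm_ge0 ?opnorm_ge0.
pose eta' p := \sum_k eta (k, p.2) * a k p.1.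
pose xi' p := \sum_k b p.1 k * xi (k, p.2).
have -> : test_form eta xi (rscalemx (lscalemx a x) b) = test_form eta' xi' x.
  transitivity (\sum_(l : testL F j) \sum_i \sum_k \sum_p \sum_q
     eta (i, test_row l) * xi (k, test_col l) * (b p k * (a i q * test_fun l (x q p)))).
    rewrite /test_form; under eq_bigr do rewrite exchange_big.
    rewrite exchange_big; apply: eq_bigr => l _; apply: eq_bigr => i _.
    apply: eq_bigr => k _; rewrite mxE test_fun_sum mulr_sumr.
    apply: eq_bigr => p _; rewrite test_funZ mxE test_fun_sum !mulr_sumr.
    by apply: eq_bigr => q _; rewrite test_funZ.
  rewrite /test_form; under [RHS]eq_bigr do rewrite exchange_big.
  rewrite [RHS]exchange_big; apply: eq_bigr => l _.
  transitivity (\sum_q \sum_p \sum_i \sum_k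
     eta (i, test_row l) * xi (k, test_col l) * (b p k * (a i q * test_fun l (x q p)))).
    under eq_bigr do rewrite exchange_big /=.
    rewrite exchange_big /= [RHS]exchange_big /=; apply: eq_bigr => p _.
    under eq_bigr do rewrite exchange_big /=.
    by rewrite exchange_big.
  apply: eq_bigr => q _; apply: eq_bigr => p _.
  rewrite /eta' /xi' /= mulr_suml mulr_suml; apply: eq_bigr => i _.
  rewrite mulr_sumr mulr_suml; apply: eq_bigr => k _; ring.
apply: le_trans (test_form_le _ _ _) _.
have := norm2_mulmxr a eta; have := norm2_mulmxl b xi; rewrite -/eta' -/xi' => h1 h2.
have E (e f a' m b' : R) : e * f * (a' * m * b') = (a' * e) * (b' * f) * m by ring.
rewrite E.
by rewrite ler_wpM2r ?test_mxnorm_ge0 // ler_pM ?norm2_ge0.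
Qed.

Lemma test_form_block n m j (eta : 'I_(n + m) * testA F j -> C) xi (x : 'M[X]_n) (y : 'M[X]_m) :
  test_form eta xi (block_mx x 0 0 y) =
    test_form (fun p => eta (lshift m p.1, p.2)) (fun p => xi (lshift m p.1, p.2)) x
  + test_form (fun p => eta (rshift n p.1, p.2)) (fun p => xi (rshift n p.1, p.2)) y.
Proof.
rewrite /test_form big_split_ord /=; congr (_ + _); apply: eq_bigr => i _;
  rewrite big_split_ord /=.
- rewrite [X in _ + X]big1 ?addr0 => [|k _]; last first.
    by rewrite big1 // => l _; rewrite block_mxEur mxE test_fun0 mulr0.
  by apply: eq_bigr => k _; apply: eq_bigr => l _; rewrite block_mxEul.
- rewrite [X in X + _]big1 ?add0r => [|k _]; last first.
    by rewrite big1 // => l _; rewrite block_mxEdl mxE test_fun0 mulr0.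
  by apply: eq_bigr => k _; apply: eq_bigr => l _; rewrite block_mxEdr.
Qed.

Lemma norm2_split n m (T : finType) (f : 'I_(n + m) * T -> C) :
  norm2 f ^+ 2 = norm2 (fun p : 'I_n * T => f (lshift m p.1, p.2)) ^+ 2
            + norm2 (fun p : 'I_m * T => f (rshift n p.1, p.2)) ^+ 2.
Proof. by rewrite !norm2_pair big_split_ord. Qed.

Lemma test_mxnorm_ruan2 n m (x : 'M[X]_n) (y : 'M[X]_m) :
  test_mxnorm (block_mx x 0 0 y) = Num.max (test_mxnorm x) (test_mxnorm y).
Proof.
apply/eqP; rewrite eq_le; apply/andP; split.
  apply: test_mxnorm_le => [|j eta xi]; first by rewrite le_max test_mxnorm_ge0.
  rewrite test_form_block; apply: le_trans (normcD _ _) _.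
  set e1 := (fun p => eta (lshift m p.1, p.2)); set e2 := (fun p => eta (rshift n p.1, p.2)).
  set x1 := (fun p => xi (lshift m p.1, p.2)); set x2 := (fun p => xi (rshift n p.1, p.2)).
  set M := Num.max _ _; have M0 : 0 <= M by rewrite le_max test_mxnorm_ge0.
  apply: (@le_trans _ _ ((norm2 e1 * norm2 x1 + norm2 e2 * norm2 x2) * M)).
    rewrite mulrDl; apply: lerD; apply: le_trans (test_form_le _ _ _) _;
      by rewrite ler_wpM2l ?mulr_ge0 ?norm2_ge0 // le_max lexx ?orbT.
  rewrite ler_wpM2r //.
  rewrite -ler_sqr ?nnegrE ?addr_ge0 ?mulr_ge0 ?norm2_ge0 // exprMn !norm2_split.
  rewrite -/e1 -/e2 -/x1 -/x2 -subr_ge0.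
  have -> : (norm2 e1 ^+ 2 + norm2 e2 ^+ 2) * (norm2 x1 ^+ 2 + norm2 x2 ^+ 2)
     - (norm2 e1 * norm2 x1 + norm2 e2 * norm2 x2) ^+ 2 = (norm2 e1 * norm2 x2 - norm2 e2 * norm2 x1) ^+ 2.
    by ring.
  exact: sqr_ge0.
rewrite ge_max; apply/andP; split; (apply: test_mxnorm_le => [|j eta xi]; first exact: test_mxnorm_ge0).
- pose E (T : finType) (f : 'I_n * T -> C) (p : 'I_(n + m) * T) : C :=
    if fintype.split p.1 is inl i then f (i, p.2) else 0.
  have El T f i t : E T f (lshift m i, t) = f (i, t).
    by rewrite /E /= (unsplitK (inl i)).
  have Er T f i t : E T f (rshift n i, t) = 0.
    by rewrite /E /= (unsplitK (inr i)).
  have hE T f : norm2 (E T f) = norm2 f.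
    apply: (@pexpIrn _ 2); rewrite ?nnegrE ?norm2_ge0 // norm2_split.
    rewrite (_ : (fun p : 'I_m * T => _) = fun=> 0) ?norm20 ?expr0n ?addr0; last first.
      by apply/funext => p; rewrite Er.
    by congr (_ ^+ 2); apply: eq_norm2 => -[i t]; rewrite El.
  have := test_form_le (E _ eta) (E _ xi) (block_mx x 0 0 y).
  rewrite !hE test_form_block.
  rewrite [X in _ + X](_ : _ = 0) ?addr0; last first.
    by rewrite /test_form big1 // => i _; rewrite big1 // => k _; rewrite big1 // => l _;
       rewrite Er !mul0r.
  congr (normc _ <= _).
  by apply: eq_bigr => i _; apply: eq_bigr => k _; apply: eq_bigr => l _; rewrite !El.
- pose E (T : finType) (f : 'I_m * T -> C) (p : 'I_(n + m) * T) : C :=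
    if fintype.split p.1 is inr i then f (i, p.2) else 0.
  have El T f i t : E T f (lshift m i, t) = 0.
    by rewrite /E /= (unsplitK (inl i)).
  have Er T f i t : E T f (rshift n i, t) = f (i, t).
    by rewrite /E /= (unsplitK (inr i)).
  have hE T f : norm2 (E T f) = norm2 f.
    apply: (@pexpIrn _ 2); rewrite ?nnegrE ?norm2_ge0 // norm2_split.
    rewrite (_ : (fun p : 'I_n * T => _) = fun=> 0) ?norm20 ?expr0n ?add0r; last first.
      by apply/funext => p; rewrite El.
    by congr (_ ^+ 2); apply: eq_norm2 => -[i t]; rewrite Er.
  have := test_form_le (E _ eta) (E _ xi) (block_mx x 0 0 y).
  rewrite !hE test_form_block.
  rewrite [X in X + _](_ : _ = 0) ?add0r; last first.
    by rewrite /test_form big1 // => i _; rewrite big1 // => k _; rewrite big1 // => l _;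
       rewrite El !mul0r.
  congr (normc _ <= _).
  by apply: eq_bigr => i _; apply: eq_bigr => k _; apply: eq_bigr => l _; rewrite !Er.
Qed.

Definition familySpace : operatorSpace R :=
  @OperatorSpace R X test_mxnorm
    (fun n x _ => @test_mxnorm_eq0 n x) (fun n c x _ => @test_mxnormZ n c x)
    (fun n x y _ => @test_mxnormD n x y) test_mxnorm1
    (fun n a b x _ => @test_mxnorm_ruan1 n a b x) (fun n m x y _ _ => @test_mxnorm_ruan2 n m x y).

End FamilyNorm.

(** * The block contractions *)

Section Haagerup.
Variable R : realType.
Local Notation C := R[i].

Lemma norm2_tensor (A B : finType) (eta : A -> C) (xi : B -> C) :
  norm2 (fun p : A * B => eta p.1 * xi p.2) = norm2 eta * norm2 xi.
Proof.
apply: (@pexpIrn _ 2); rewrite ?nnegrE ?mulr_ge0 ?norm2_ge0 // norm2_pair exprMn.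
rewrite norm2_sqr mulr_suml; apply: eq_bigr => a _ /=.
by rewrite norm2Z exprMn.
Qed.

Lemma norm2_tensor_inj (L A B : finType) (r : L -> A) (c : L -> B) eta xi :
  injective (fun l => (r l, c l)) ->
  norm2 (fun l => eta (r l) * xi (c l) : C) <= norm2 eta * norm2 xi.
Proof.
move=> inj; rewrite -norm2_tensor.
exact: (norm2_inj (fun p : A * B => eta p.1 * xi p.2) inj).
Qed.

(** On a fibre of [r] the map [c] is injective. *)
Lemma norm2_fiber (L A B : finType) (r : L -> A) (c : L -> B) (al : A) (xi : B -> C) :
  injective (fun l => (r l, c l)) ->
  norm2 (fun l => (r l == al)%:R * xi (c l)) <= norm2 xi.
Proof.
move=> inj; apply: le_trans (norm2_tensor_inj (fun a => (a == al)%:R) xi inj) _.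
by rewrite norm2_delta mul1r.
Qed.

Lemma sum_fiber (L A : finType) (r : L -> A) (G : L -> C) :
  \sum_l G l = \sum_al \sum_l (r l == al)%:R * G l.
Proof.
rewrite exchange_big; apply: eq_bigr => l _.
by rewrite (bigD1 (r l)) //= eqxx mul1r big1 ?addr0 // => a; rewrite eq_sym => /negbTE ->; rewrite mul0r.
Qed.

(** The estimate [||sum a_i (x) b_i|| <= ||sum a_i a_i^*||^(1/2) ||sum b_i^*
    b_i||^(1/2)] for matrix units, with the matrix [Z] of norm at most [K]
    between them. Fix a row [r l = al] of the first shape and a column [c'
    l' = be] of the second: the vectors left over on both sides only depend
    on [xi] and on [eta] respectively, and summing over [al] and [be] costs
    the square roots of the numbers of rows and columns. *)
Lemma haagerup_bound (L A B L' A' B' : finType) (r : L -> A) (c : L -> B)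
    (r' : L' -> A') (c' : L' -> B') (Z : L -> L' -> C) (K : R) eta xi :
  injective (fun l => (r l, c l)) -> injective (fun l => (r' l, c' l)) ->
  0 <= K ->
  (forall a b, normc (\sum_l \sum_l' a l * b l' * Z l l') <= K * (norm2 a * norm2 b)) ->
  normc (\sum_l \sum_l' eta (r l, r' l') * xi (c l, c' l') * Z l l') <=
    K * (Num.sqrt #|A|%:R * Num.sqrt #|B'|%:R) * (norm2 eta * norm2 xi).
Proof.
move=> inj inj' K0 hZ.
have -> : \sum_l \sum_l' eta (r l, r' l') * xi (c l, c' l') * Z l l' =
   \sum_al \sum_be \sum_l \sum_l'
     ((r l == al)%:R * xi (c l, be)) * ((c' l' == be)%:R * eta (al, r' l')) * Z l l'.
  rewrite (sum_fiber r); apply: eq_bigr => al _.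
  rewrite [RHS]exchange_big; apply: eq_bigr => l _ /=.
  rewrite mulr_sumr [RHS]exchange_big; apply: eq_bigr => l' _ /=.
  rewrite (bigD1 (c' l')) //= big1 ?addr0 => [|be]; last first.
    by rewrite eq_sym => /negbTE ->; rewrite mul0r mulr0 mul0r.
  by have [<-|_] := eqVneq (r l) al; rewrite ?mul0r // eqxx !mul1r; ring.
apply: (@le_trans _ _ (\sum_al \sum_be K * (norm2 (fun b => xi (b, be)) * norm2 (fun a' => eta (al, a'))))).
  apply: le_trans (normc_sum _ _) _; apply: ler_sum => al _.
  apply: le_trans (normc_sum _ _) _; apply: ler_sum => be _.
  apply: le_trans (hZ _ _) _; rewrite ler_wpM2l // ler_pM ?norm2_ge0 //.
    exact: (norm2_fiber al (fun b => xi (b, be)) inj).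
  apply: (norm2_fiber be (fun a' => eta (al, a')) (r := c') (c := r')).
  by move=> l l' [e1 e2]; apply: inj'; rewrite e1 e2.
have -> : \sum_al \sum_be K * (norm2 (fun b => xi (b, be)) * norm2 (fun a' => eta (al, a'))) =
    K * ((\sum_al norm2 (fun a' => eta (al, a'))) * (\sum_be norm2 (fun b => xi (b, be)))).
  rewrite mulr_suml mulr_sumr; apply: eq_bigr => al _.
  by rewrite mulr_sumr mulr_sumr; apply: eq_bigr => be _; ring.
rewrite -mulrA ler_wpM2l //.
have h1 := sum_norm2_le eta; have h2 := sum_norm2_le (fun p : B' * B => xi (p.2, p.1)).
rewrite (norm2_swap xi) /= in h2.
have n1 : 0 <= \sum_al norm2 (fun a' => eta (al, a')) by apply: sumr_ge0 => *; exact: norm2_ge0.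
have n2 : 0 <= \sum_be norm2 (fun b => xi (b, be)) by apply: sumr_ge0 => *; exact: norm2_ge0.
by apply: le_trans (ler_pM n1 n2 h1 h2) _; rewrite mulrACA.
Qed.

End Haagerup.

Section Family.
Variable R : realType.
Local Notation C := R[i].

(** Written [t] below: the n-th block uses words of [4 t] bits, so [N = 2 ^
    (4 t)], [sqrt N = 2 ^ (2 t)] and the weight [N ^ (-1/4)] is [2 ^ (- t)].
    The value makes [t >= k ^ 2] for all contractions [k < 32 (n + 1)] of
    the block. *)
Definition scale_exp (n : nat) : nat := ((32 * n.+1) ^ 2)%N.
Definition cube (m : nat) : finType := {ffun 'I_m.+1 -> bool}.
Definition bits (n : nat) : finType := cube (4 * scale_exp n).-1.
Definition block_index (n : nat) : countType := (bool * bits n)%type.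
(** Coordinates of l2 that belong to a block. Coordinates that encode
    nothing lie in no block, where the operator space structure is the
    minimal one. *)
Definition block_coord (n : nat) (b : bool) (l : bits n) : nat :=
  pickle (Tagged block_index (b, l) : {n : nat & block_index n}).

Lemma block_coord_inj n b b' (l l' : bits n) : block_coord b l = block_coord b' l' -> (b, l) = (b', l').
Proof.
move=> /(pcan_inj pickleK) /eqP; rewrite -tag_eqE /tag_eq /= eqxx tagged_asE.
by move/eqP.
Qed.

Section Members.
Variables (phase : forall n : nat, nat -> bits n -> C).
Variables (bitperm : forall n : nat, nat -> bits n -> bits n).
Hypothesis normc_phase : forall n j l, normc (@phase n j l) = 1.
Hypothesis bitperm_inj : forall n j, injective (@bitperm n j).

(** Contractions are numbered by one integer [k = 32 * n + j], with [n] the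
    block and [j] the unitary. The spacing 32 makes every gap between shapes
    at least [32 n] in the exponent. *)
Definition block_of (k : nat) := (k %/ 32)%N.
Definition kind_of (k : nat) := (k %% 32)%N.
(** The quotient [col_dim k / row_dim k] is [2 ^ (4 k ^ 2)]: by convexity of
    the square, distinct [k] give quotients that are far apart. *)
Definition row_dim (k : nat) : nat := (2 ^ (2 * scale_exp (block_of k) - 2 * k ^ 2))%N.
Definition col_dim (k : nat) : nat := (2 ^ (2 * scale_exp (block_of k) + 2 * k ^ 2))%N.

Lemma sqr_le_scale_exp k : (k ^ 2 <= scale_exp (block_of k))%N.
Proof. by rewrite /scale_exp leq_sqr /block_of; have := ltn_ceil k (isT : 0 < 32)%N; rewrite mulnC; lia. Qed.

Lemma card_bits n : #|bits n| = (2 ^ (4 * scale_exp n))%N.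
Proof. by rewrite card_ffun card_bool card_ord prednK // muln_gt0 expn_gt0. Qed.

Lemma card_cell k : #|bits (block_of k)| = #|{: 'I_(row_dim k) * 'I_(col_dim k)}|.
Proof.
rewrite card_bits card_prod !card_ord -expnD; congr (2 ^ _)%N.
have := sqr_le_scale_exp k; lia.
Qed.

(** An arbitrary bijection: the position of the numbers in the matrix does
    not interact with the bit structure. *)
Definition cell (k : nat) (l : bits (block_of k)) : 'I_(row_dim k) * 'I_(col_dim k) :=
  enum_val (cast_ord (card_cell k) (enum_rank l)).

Lemma cell_inj k : injective (@cell k).
Proof. by move=> l l' /enum_val_inj /cast_ord_inj /enum_rank_inj. Qed.

Lemma cell_inj2 k : injective (fun l => ((@cell k l).1, (cell l).2)).
Proof. by move=> l l' h; apply: cell_inj; move: h; case: (cell l) (cell l') => a b []. Qed.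

Definition rsqrt2 : R := (Num.sqrt 2)^-1.

Lemma rsqrt2_sqr : rsqrt2 ^+ 2 = 2^-1.
Proof. by rewrite /rsqrt2 exprVn sqr_sqrtr. Qed.

Lemma rsqrt2_ge0 : 0 <= rsqrt2. Proof. by rewrite invr_ge0 sqrtr_ge0. Qed.

(** The unitary is [(g x) l = phase l * x (bitperm l)]; these are the
    coordinates of [(y - g x) / sqrt 2], whose kernel is the graph of [g]. *)
Definition graph_defect n (j : nat) (l : bits n) (x : l2 R) : C :=
  rsqrt2%:C * (x (block_coord true l) - phase j l * x (block_coord false (bitperm j l))).

Lemma graph_defect_linear n j l a (x y : l2 R) :
  @graph_defect n j l (a *: x + y) = a * graph_defect j l x + graph_defect j l y.
Proof. by rewrite /graph_defect !l2D !l2Z; ring. Qed.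

Lemma norm2_graph_defect n j x : norm2 (fun l => @graph_defect n j l x) <= l2nrm x.
Proof.
apply: (@le_trans _ _ (norm2 (fun p : bool * bits n => x (block_coord p.1 p.2)))); last first.
  by apply: norm2_subfamily => -[b l] [b' l'] /block_coord_inj.
apply: norm2_le_sqr; first exact: norm2_ge0.
rewrite norm2_pair big_bool /= !norm2_sqr.
have -> : \sum_(l : bits n) normc (x (block_coord false l)) ^+ 2 =
    \sum_(l : bits n) normc (x (block_coord false (@bitperm n j l))) ^+ 2.
  by apply: reindex_inj; exact: bitperm_inj.
rewrite -big_split ler_sum // => l _ /=; rewrite /graph_defect normcM exprMn.
rewrite normc_real ?rsqrt2_ge0 // rsqrt2_sqr ler_pdivrMl //.
apply: (@le_trans _ _ ((normc (x (block_coord true l)) + normc (x (block_coord false (bitperm j l)))) ^+ 2)).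
  rewrite ler_sqr ?nnegrE ?addr_ge0 ?normc_ge0 //.
  by apply: le_trans (normcB _ _) _; rewrite normcM normc_phase mul1r.
have sq (a b : R) : (a + b) ^+ 2 <= 2 * (a ^+ 2 + b ^+ 2).
  rewrite -subr_ge0 (_ : _ - _ = (a - b) ^+ 2) ?sqr_ge0 //; ring.
exact: sq.
Qed.

(** Functionals of finite support in the unit ball are enough to recover the
    norm of l2. *)
Inductive test_index := Functional (m : nat) (y : 'I_m -> C) (_ : norm2 y <= 1) | Block of nat.

Definition fam_entry (j : test_index) : finType := if j is Block k then bits (block_of k) else unit.
Definition fam_row (j : test_index) : finType := if j is Block k then 'I_(row_dim k) else unit.
Definition fam_col (j : test_index) : finType := if j is Block k then 'I_(col_dim k) else unit.
Definition fam_row_of (j : test_index) : fam_entry j -> fam_row j :=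
  match j with Block k => fun l => (cell l).1 | Functional m y h => fun=> tt end.
Definition fam_col_of (j : test_index) : fam_entry j -> fam_col j :=
  match j with Block k => fun l => (cell l).2 | Functional m y h => fun=> tt end.
Definition weight (k : nat) : R := (2 ^+ scale_exp (block_of k))^-1.
Definition fam_fun (j : test_index) : fam_entry j -> l2 R -> C :=
  match j with
  | Block k => fun l x => (weight k)%:C * graph_defect (kind_of k) l x
  | Functional m y h => fun _ x => \sum_i y i * x i
  end.

Lemma weight_gt0 k : 0 < weight k. Proof. by rewrite invr_gt0 exprn_gt0. Qed.
Lemma weight_le1 k : weight k <= 1.
Proof. by rewrite invf_le1 ?exprn_gt0 // exprn_ege1 // ler1n. Qed.

Lemma fam_fun_linear j (l : fam_entry j) (a : C) (x y : l2cnm R) :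
  fam_fun l (a *: x + y) = a * fam_fun l x + fam_fun l y.
Proof.
case: j l => [m v h|k] l /=; last by rewrite graph_defect_linear; ring.
rewrite mulr_sumr -big_split; apply: eq_bigr => i _ /=.
change (v i * (a * x i + y i) = a * (v i * x i) + v i * y i); ring.
Qed.

Lemma norm2_unit (f : unit -> C) : norm2 f = normc (f tt).
Proof.
rewrite /norm2 (bigD1 tt) //= big1 => [|[]//].
by rewrite addr0 sqrtr_sqr ger0_norm ?normc_ge0.
Qed.

Lemma fam_fun_le j (eta : fam_row j -> C) (xi : fam_col j -> C) (x : l2cnm R) :
  normc (\sum_(l : fam_entry j) eta (fam_row_of l) * xi (fam_col_of l) * fam_fun l x)
    <= norm2 eta * norm2 xi * complex.Re `|x|.
Proof.
change (complex.Re `|x|) with (l2nrm x).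
case: j eta xi => [m v h|k] eta xi /=.
  rewrite (bigD1 tt) //= [X in _ + X]big1 ?addr0 => [|[]//].
  rewrite !norm2_unit normcM normcM ler_wpM2l ?mulr_ge0 ?normc_ge0 //.
  apply: le_trans (cauchy_schwarz _ _) _.
  apply: (@le_trans _ _ (1 * l2nrm x)); last by rewrite mul1r.
  by rewrite ler_pM ?norm2_ge0 ?(norm2_upto_le m x).
apply: le_trans (cauchy_schwarz _ _) _; rewrite ler_pM ?norm2_ge0 //.
  exact: (norm2_tensor_inj eta xi (@cell_inj2 k)).
rewrite norm2Z normc_real ?(ltW (weight_gt0 k)) //.
apply: (@le_trans _ _ (1 * l2nrm x)); last by rewrite mul1r.
by rewrite ler_pM ?norm2_ge0 ?weight_le1 ?(ltW (weight_gt0 k)) ?norm2_graph_defect.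
Qed.

(** Pair a truncation of [x] with its normalized conjugate. *)
Lemma fam_fun_norming (x : l2cnm R) (b : R) :
    (forall j (eta : fam_row j -> C) (xi : fam_col j -> C),
       norm2 eta <= 1 -> norm2 xi <= 1 ->
       normc (\sum_(l : fam_entry j) eta (fam_row_of l) * xi (fam_col_of l) * fam_fun l x)
         <= b) -> complex.Re `|x| <= b.
Proof.
move=> hb; change (complex.Re `|x|) with (l2nrm x).
have key m (y : 'I_m -> C) : norm2 y <= 1 -> normc (\sum_(i < m) y i * x i) <= b.
  move=> h; have := hb (Functional h) (fun=> 1) (fun=> 1); rewrite /= !norm2_unit normc1.
  by move=> /(_ (lexx _) (lexx _)); rewrite (bigD1 tt) //= [X in _ + X]big1 ?addr0 ?mul1r // => -[].
apply: l2nrm_le => m.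
have [h0|hn0] := eqVneq (norm2_upto m x) 0.
  rewrite h0; apply: le_trans (key m (fun=> 0) _); first exact: normc_ge0.
  by rewrite norm20.
have hgt0 : 0 < norm2_upto m x by rewrite lt_def hn0 norm2_ge0.
have ci : normc ((norm2_upto m x)^-1%:C : C) = (norm2_upto m x)^-1.
  by rewrite normc_real ?invr_ge0 ?ltW.
have := key m (fun i => (norm2_upto m x)^-1%:C * (x i)^*).
rewrite norm2Z norm2_conj ci mulVf // => /(_ (lexx _)).
have -> : \sum_(i < m) (norm2_upto m x)^-1%:C * (x i)^* * x i = (norm2_upto m x)^-1%:C * (norm2_upto m x ^+ 2)%:C.
  rewrite /norm2_upto norm2_sqr rmorph_sum mulr_sumr; apply: eq_bigr => i _.
  by rewrite -mulrA mul_conjc.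
by rewrite normcM ci normc_real ?sqr_ge0 // expr2 mulKf.
Qed.

Lemma norm2_empty : norm2 (fun _ : 'I_0 => 0 : C) <= 1.
Proof. by rewrite norm20. Qed.

Definition block_family : testFamily (l2cnm R) :=
  TestFamily (Functional norm2_empty) fam_fun_linear fam_fun_le fam_fun_norming.

Definition block_space : operatorSpace R := familySpace block_family.

End Members.
End Family.

(** * Completely bounded maps are small between kernels and ranges of tests *)

Section LinearMaps.
Variables (K : pzRingType) (V W : lmodType K) (f : V -> W).
Hypothesis lf : linear f.

Lemma lin0 : f 0 = 0.
Proof. by have := lf (-1) 0 0; rewrite scaler0 addr0 scaleN1r addNr. Qed.

Lemma linD x y : f (x + y) = f x + f y.
Proof. by have := lf 1 x y; rewrite !scale1r. Qed.

Lemma linZ c x : f (c *: x) = c *: f x.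
Proof. by have := lf c x 0; rewrite lin0 !addr0. Qed.

Lemma lin_sum (I : Type) (r : seq I) (p : pred I) (g : I -> V) :
  f (\sum_(i <- r | p i) g i) = \sum_(i <- r | p i) f (g i).
Proof. exact: (big_morph f linD lin0). Qed.

End LinearMaps.

Section Elementary.
Variables (R : realType) (X : completeNormedModType R[i]) (F : testFamily X).
Local Notation C := R[i].
Variables (L : finType) (n : nat) (ro ka : L -> 'I_n).

(** The matrix over [X] with [z l] at the cell [(ro l, ka l)], that is, the
    sum of [e_(ro l, ka l) (x) z l]. *)
Definition spread (z : L -> X) : 'M[X]_n :=
  \matrix_(i, k) \sum_l ((i == ro l) && (k == ka l))%:R *: z l.

Lemma test_form_spread (z : L -> X) j (eta : 'I_n * testA F j -> C) xi :
  test_form eta xi (spread z) =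
  \sum_l \sum_(l' : testL F j)
    eta (ro l, test_row l') * xi (ka l, test_col l') * test_fun l' (z l).
Proof.
rewrite /test_form.
transitivity (\sum_l \sum_(l' : testL F j) \sum_i \sum_k
   eta (i, test_row l') * xi (k, test_col l') *
     (((i == ro l) && (k == ka l))%:R * test_fun l' (z l))).
  under eq_bigr do rewrite exchange_big /=.
  rewrite exchange_big [RHS]exchange_big /=; apply: eq_bigr => l' _.
  rewrite [RHS]exchange_big /=; apply: eq_bigr => i _.
  rewrite [RHS]exchange_big /=; apply: eq_bigr => k _.
  rewrite mxE test_fun_sum mulr_sumr; apply: eq_bigr => l _.
  by rewrite test_funZ.
apply: eq_bigr => l _; apply: eq_bigr => l' _.
rewrite (bigD1 (ro l)) //= [X in _ + X]big1 ?addr0 => [|i /negbTE ni]; last first.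
  by rewrite big1 // => k _; rewrite ni /= mul0r mulr0.
rewrite (bigD1 (ka l)) //= [X in _ + X]big1 ?addr0 => [|k /negbTE nk]; last first.
  by rewrite nk andbF mul0r mulr0.
by rewrite !eqxx mul1r.
Qed.

Lemma map_spread (P : X -> X) (z : L -> X) :
  linear P -> map_mx P (spread z) = spread (fun l => P (z l)).
Proof.
move=> lP; apply/matrixP => i k; rewrite !mxE.
rewrite (lin_sum lP); apply: eq_bigr => l _.
by rewrite (linZ lP).
Qed.

End Elementary.

Section TestLemma.
Variable R : realType.
Local Notation C := R[i].
Variables (phase : forall n : nat, nat -> bits n -> C).
Variables (bitperm : forall n : nat, nat -> bits n -> bits n).
Hypothesis normc_phase : forall n j l, normc (@phase n j l) = 1.
Hypothesis bitperm_inj : forall n j, injective (@bitperm n j).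
Local Notation F := (block_family normc_phase bitperm_inj).
Local Notation H := (l2cnm R).

Variables (P : H -> H) (K : R).
Hypothesis linP : linear P.
Hypothesis K0 : 0 <= K.
Hypothesis cbP : forall n (x : 'M[H]_n), (0 < n)%N ->
  test_mxnorm F (map_mx P x) <= K * test_mxnorm F x.

Lemma l2nrm_cb (x : H) : l2nrm (P x) <= K * l2nrm x.
Proof.
have := cbP (const_mx x : 'M[H]_1) isT.
have e1 (y : H) : test_mxnorm F (const_mx y : 'M[H]_1) = l2nrm y.
  by apply: (@complexI R); rewrite test_mxnorm1 mxE.
by rewrite map_const_mx !e1.
Qed.

(** Gaps between squares grow, hence they are at least [k] around [k ^ 2]. *)
Lemma square_gap k k' : k != k' -> (k' ^ 2 + k <= k ^ 2)%N || (k ^ 2 + k <= k' ^ 2)%N.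
Proof.
rewrite neq_ltn => /orP[h|h]; apply/orP; [right|left]; first nia.
nia.
Qed.

Lemma sqrt_pow2 (a : nat) : Num.sqrt (2 ^ (2 * a))%:R = 2 ^+ a :> R.
Proof.
rewrite mulnC expnM natrX sqrtr_sqr ger0_norm ?ler0n //.
by rewrite natrX.
Qed.

Lemma sqrt_rows k : Num.sqrt (row_dim k)%:R = 2 ^+ (scale_exp (block_of k) - k ^ 2) :> R.
Proof. by rewrite /row_dim -mulnBr sqrt_pow2. Qed.

Lemma sqrt_cols k : Num.sqrt (col_dim k)%:R = 2 ^+ (scale_exp (block_of k) + k ^ 2) :> R.
Proof. by rewrite /col_dim -mulnDr sqrt_pow2. Qed.

Lemma pow2_le (a b : nat) : (a <= b)%N -> (2 : R) ^+ a <= 2 ^+ b.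
Proof. by move=> ab; rewrite ler_eXn2l // ltr1n. Qed.

(** What the contraction [k'] sees of a family tailored to [k], after
    [haagerup_bound]; for [k' = k] the left-hand side is [2 ^ t]. *)
Lemma weight_gap_cols k k' : (k' ^ 2 + k <= k ^ 2)%N ->
  weight R k' * (Num.sqrt (row_dim k)%:R * Num.sqrt (col_dim k')%:R)
    <= 2 ^+ (scale_exp (block_of k) - k).
Proof.
move=> h; rewrite sqrt_rows sqrt_cols /weight ler_pdivrMl ?exprn_gt0 // -!exprD.
by apply: pow2_le; have := sqr_le_scale_exp k; lia.
Qed.

Lemma weight_gap_rows k k' : (k ^ 2 + k <= k' ^ 2)%N ->
  weight R k' * (Num.sqrt (col_dim k)%:R * Num.sqrt (row_dim k')%:R)
    <= 2 ^+ (scale_exp (block_of k) - k).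
Proof.
move=> h; rewrite sqrt_rows sqrt_cols /weight ler_pdivrMl ?exprn_gt0 // -!exprD.
by apply: pow2_le; have := sqr_le_scale_exp k; have := sqr_le_scale_exp k'; nia.
Qed.

Variables (k : nat) (I : finType) (f : I -> H).
Hypothesis f_on : forall v : I -> C, l2nrm (\sum_i v i *: f i) <= norm2 v.
Local Notation T := (bits (block_of k)).
Let u (l : T) (x : H) : C := graph_defect phase bitperm (kind_of k) l x.
Hypothesis f_ker : forall i l, u l (f i) = 0.

Let S (l : T) (i : I) : C := u l (P (f i)).
Let z (l : T) : H := \sum_i (S l i)^* *: f i.

Let u_lin l a (x y : H) : u l (a *: x + y) = a * u l x + u l y.
Proof. exact: graph_defect_linear. Qed.

Let u0 l : u l 0 = 0.
Proof. by have := u_lin l (-1) 0 0; rewrite scaler0 addr0 mulN1r addNr. Qed.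

Let uZ l c (x : H) : u l (c *: x) = c * u l x.
Proof. by have := u_lin l c x 0; rewrite addr0 u0 addr0. Qed.

Let u_sum l (J : Type) (r : seq J) (G : J -> H) :
  u l (\sum_(i <- r) G i) = \sum_(i <- r) u l (G i).
Proof.
have uD (x y : H) : u l (x + y) = u l x + u l y.
  by have := u_lin l 1 x y; rewrite scale1r mul1r.
exact: (big_morph _ uD (u0 l)).
Qed.

Let norm2_u (x : H) : norm2 (fun l => u l x) <= l2nrm x.
Proof. exact: norm2_graph_defect. Qed.

Lemma uPz l l' : u l' (P (z l)) = \sum_i (S l i)^* * S l' i.
Proof. by rewrite (lin_sum linP) u_sum; apply: eq_bigr => i _; rewrite (linZ linP) uZ. Qed.

Lemma uz l l' : u l' (z l) = 0.
Proof. by rewrite u_sum big1 // => i _; rewrite uZ f_ker mulr0. Qed.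

(** The vectors [z l] are the images of the coordinate vectors under the
    adjoint of [S], the matrix of [u P] on the orthonormal family [f]; so
    the claim is that the adjoint has norm at most [K]. *)
Lemma adjoint_bound (a : T -> C) : l2nrm (\sum_l a l *: z l) <= K * norm2 a.
Proof.
pose v i := \sum_l a l * (S l i)^*.
have -> : \sum_l a l *: z l = \sum_i v i *: f i.
  rewrite /z; under eq_bigr do rewrite scaler_sumr.
  rewrite exchange_big; apply: eq_bigr => i _; rewrite scaler_suml.
  by apply: eq_bigr => l _; rewrite scalerA.
apply: le_trans (f_on v) _; apply: norm2_dual => [|g]; first by rewrite mulr_ge0 ?norm2_ge0.
have -> : \sum_i g i * v i = \sum_l a l * (u l (P (\sum_i (g i)^* *: f i)))^*.
  rewrite /v; under eq_bigr do rewrite mulr_sumr.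
  rewrite exchange_big; apply: eq_bigr => l _.
  rewrite (lin_sum linP) u_sum cj_sum mulr_sumr; apply: eq_bigr => i _.
  by rewrite (linZ linP) uZ [in RHS]cjM cjK /S; ring.
apply: le_trans (cauchy_schwarz _ _) _; rewrite norm2_conj -mulrA mulrCA ler_wpM2l ?norm2_ge0 //.
apply: le_trans (norm2_u _) _; apply: le_trans (l2nrm_cb _) _.
by rewrite ler_wpM2l // (le_trans (f_on _)) // norm2_conj.
Qed.

Lemma gram_sum : \sum_l u l (P (z l)) = (norm2 (fun p : T * I => S p.1 p.2) ^+ 2)%:C.
Proof.
rewrite norm2_sqr rmorph_sum.
rewrite -(pair_bigA _ (fun l i => (normc (S l i) ^+ 2)%:C)) /=.
by apply: eq_bigr => l _; rewrite uPz; apply: eq_bigr => i _; rewrite mul_conjc.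
Qed.

Let n := (row_dim k + col_dim k)%N.
Let ro (l : T) : 'I_n := lshift (col_dim k) (cell l).1.
Let ka (l : T) : 'I_n := rshift (row_dim k) (cell l).2.

Let rk_inj : injective (fun l => (ro l, ka l)).
Proof.
move=> l l' [] /= h1 /addnI h2; apply: (@cell_inj2 k).
by congr (_, _); apply: val_inj.
Qed.

(** The functionals see at most the operator norm of the adjoint, the
    contraction [k] itself sees nothing because [f] lies in its kernel, and
    every other contraction is controlled by [haagerup_bound], used with
    rows against columns or with columns against rows according to the side
    of the gap. *)
Lemma spread_bound : test_mxnorm F (spread ro ka z) <= K * 2 ^+ (scale_exp (block_of k) - k).
Proof.
have p1 : (1 : R) <= 2 ^+ (scale_exp (block_of k) - k) by rewrite exprn_ege1 // ler1n.
apply: test_mxnorm_le => [|j eta xi]; first by rewrite mulr_ge0 ?exprn_ge0.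
rewrite test_form_spread; case: j eta xi => [m y hy|k'] eta xi.
  have -> : \sum_l \sum_(l' : testL F (Functional hy))
     eta (ro l, test_row l') * xi (ka l, test_col l') * test_fun l' (z l)
     = \sum_(i < m) y i * (\sum_l (eta (ro l, tt) * xi (ka l, tt)) *: z l : H) i.
    transitivity (\sum_l \sum_(i < m) eta (ro l, tt) * xi (ka l, tt) * (y i * (z l : l2 R) i)).
      apply: eq_bigr => l _; rewrite (bigD1 tt) //= [X in _ + X]big1 ?addr0 => [|[]//].
      by rewrite mulr_sumr.
    rewrite exchange_big; apply: eq_bigr => i _ /=.
    rewrite l2sum mulr_sumr; apply: eq_bigr => l _ /=.
    by rewrite [LHS]mulrCA.
  apply: le_trans (cauchy_schwarz _ _) _.
  apply: (@le_trans _ _ (1 * (K * norm2 (fun l => eta (ro l, tt) * xi (ka l, tt))))).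
    rewrite ler_pM ?norm2_ge0 //; apply: le_trans (adjoint_bound _).
    exact: (norm2_upto_le m).
  rewrite mul1r mulrCA ler_wpM2l //.
  apply: (@le_trans _ _ (norm2 (fun i => eta (i, tt)) * norm2 (fun i => xi (i, tt)))).
    exact: (norm2_tensor_inj (fun i => eta (i, tt)) (fun i => xi (i, tt)) rk_inj).
  rewrite -[leLHS]mulr1 ler_pM ?mulr_ge0 ?norm2_ge0 //.
  rewrite ler_pM ?norm2_ge0 //.
    by apply: (norm2_inj eta) => i i' [].
  by apply: (norm2_inj xi) => i i' [].
have [kk|nk] := eqVneq k k'.
  move: eta xi; rewrite -kk => eta xi.
  rewrite big1 ?normc0 ?mulr_ge0 ?norm2_ge0 ?exprn_ge0 // => l _.
  have e l' : graph_defect phase bitperm (kind_of k) l' (z l) = 0 := uz l l'.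
  by rewrite big1 // => l' _ /=; rewrite e !mulr0.
have hZ (a : T -> C) (b : bits (block_of k') -> C) :
   normc (\sum_l \sum_l' a l * b l' * graph_defect phase bitperm (kind_of k') l' (z l)) <= K * (norm2 a * norm2 b).
  have -> : \sum_l \sum_l' a l * b l' * graph_defect phase bitperm (kind_of k') l' (z l) =
     \sum_l' b l' * graph_defect phase bitperm (kind_of k') l' (\sum_l a l *: z l).
    rewrite exchange_big; apply: eq_bigr => l' _ /=.
    have us := @test_fun_sum _ _ F (Block _ k') l'.
    have uz' := @test_funZ _ _ F (Block _ k') l'.
    have wn0 : (weight R k')%:C != 0 :> C by rewrite eq_complex /= gt_eqF ?weight_gt0.
    apply: (mulfI wn0).
    have := us _ (index_enum T) xpredT (fun l => a l *: z l); rewrite /= => e.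
    rewrite mulrCA e !mulr_sumr; apply: eq_bigr => l _.
    by have /= -> := uz' (a l) (z l); ring.
  apply: le_trans (cauchy_schwarz _ _) _; rewrite [norm2 a * _]mulrC mulrCA ler_wpM2l ?norm2_ge0 //.
  have h3 (x : H) : norm2 (fun l' : bits (block_of k') => graph_defect phase bitperm (kind_of k') l' x) <= l2nrm x.
    exact: norm2_graph_defect.
  by apply: le_trans (h3 _) _; exact: adjoint_bound.
have pull (G : T -> bits (block_of k') -> C) :
  \sum_l \sum_(l' : testL F (Block _ k')) G l l' * test_fun l' (z l) =
  (weight R k')%:C * \sum_l \sum_l' G l l' * graph_defect phase bitperm (kind_of k') l' (z l).
  rewrite mulr_sumr; apply: eq_bigr => l _; rewrite mulr_sumr.
  by apply: eq_bigr => l' _ /=; ring.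
rewrite (pull (fun l l' => eta (ro l, (cell l').1) * xi (ka l, (cell l').2))).
rewrite normcM normc_real ?(ltW (weight_gt0 _ _)) //.
pose eta' (p : 'I_(row_dim k) * 'I_(row_dim k')) := eta (lshift (col_dim k) p.1, p.2).
pose xi' (p : 'I_(col_dim k) * 'I_(col_dim k')) := xi (rshift (row_dim k) p.1, p.2).
have he : norm2 eta' <= norm2 eta.
  by apply: (norm2_inj eta) => -[i a] [i' a'] /= [h ->]; congr (_, _); apply: val_inj.
have hx : norm2 xi' <= norm2 xi.
  by apply: (norm2_inj xi) => -[i a] [i' a'] /= [/addnI h ->]; congr (_, _); apply: val_inj.
have hex : norm2 eta' * norm2 xi' <= norm2 eta * norm2 xi by rewrite ler_pM ?norm2_ge0.
have [g1|g2] := orP (square_gap nk).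
  have := haagerup_bound (r := fun l : T => (cell l).1) (c := fun l : T => (cell l).2)
     (r' := fun l => (cell l).1) (c' := fun l => (cell l).2) eta' xi'
     (@cell_inj2 k) (@cell_inj2 k') K0 hZ.
  rewrite !card_ord => h.
  apply: le_trans (ler_wpM2l (ltW (weight_gt0 _ _)) h) _.
  rewrite (mulrA (weight R k')) (mulrCA (weight R k')) [leRHS]mulrC ler_pM ?mulr_ge0 ?norm2_ge0 ?sqrtr_ge0 ?(ltW (weight_gt0 _ _)) //.
  by rewrite ler_wpM2l // weight_gap_cols.
have hZ' (a : T -> C) (b : bits (block_of k') -> C) := hZ a b.
have := haagerup_bound (r := fun l : T => (cell l).2) (c := fun l : T => (cell l).1)
     (r' := fun l => (cell l).2) (c' := fun l => (cell l).1) xi' eta'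
     _ _ K0 hZ.
rewrite !card_ord => h.
have ic (k0 : nat) : injective (fun l => ((@cell k0 l).2, (cell l).1)).
  by move=> l l' [e1 e2]; apply: cell_inj2; rewrite e1 e2.
have {}h := h (ic k) (ic k').
have e : \sum_l \sum_l' eta (ro l, (cell l').1) * xi (ka l, (cell l').2) * graph_defect phase bitperm (kind_of k') l' (z l)
  = \sum_l \sum_l' xi' ((cell l).2, (cell l').2) * eta' ((cell l).1, (cell l').1) * graph_defect phase bitperm (kind_of k') l' (z l).
  by apply: eq_bigr => l _; apply: eq_bigr => l' _; congr (_ * _); rewrite mulrC.
rewrite e; apply: le_trans (ler_wpM2l (ltW (weight_gt0 _ _)) h) _.
rewrite (mulrA (weight R k')) (mulrCA (weight R k')) [leRHS]mulrC ler_pM ?mulr_ge0 ?norm2_ge0 ?sqrtr_ge0 ?(ltW (weight_gt0 _ _)) //.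
  by rewrite ler_wpM2l // weight_gap_rows.
by rewrite mulrC.
Qed.

(** Apply [P] to the matrix [spread ro ka z]. Its image has a large norm in
    the contraction [k], because the trace of [S S^*] is the squared
    Hilbert-Schmidt norm of [S]; the norm before applying [P] is bounded by
    [spread_bound]. *)
Lemma hilbert_schmidt_bound :
  norm2 (fun p : T * I => u p.1 (P (f p.2))) ^+ 2 <=
    K ^+ 2 * (2 ^+ (4 * scale_exp (block_of k)) / 2 ^+ k).
Proof.
have n0 : (0 < n)%N by rewrite addn_gt0 expn_gt0.
(* The unnormalized maximally entangled vectors, which turn the matrix
   coefficient into a trace. *)
pose diag (A B : finType) (i : B -> A) (p : A * B) : C := (p.1 == i p.2)%:R.
have hdiag (A B : finType) (i : B -> A) : norm2 (diag A B i) = Num.sqrt #|B|%:R.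
  apply: (@pexpIrn _ 2); rewrite ?nnegrE ?norm2_ge0 ?sqrtr_ge0 //.
  rewrite -norm2_swap norm2_pair sqr_sqrtr ?ler0n //.
  rewrite (eq_bigr (fun=> 1)) ?sumr_const // => b _.
  rewrite (_ : (fun j => _) = fun j => (j == i b)%:R) ?norm2_delta ?expr1n //.
have := @test_form_le _ _ F n (Block _ k) (diag _ _ (@lshift (row_dim k) (col_dim k))) (diag _ _ (@rshift (row_dim k) (col_dim k)))
   (spread ro ka (fun l => P (z l))).
rewrite test_form_spread !hdiag !card_ord -map_spread //.
have -> : \sum_l \sum_(l' : testL F (Block _ k))
   diag _ _ (@lshift (row_dim k) (col_dim k)) (ro l, test_row l') *
   diag _ _ (@rshift (row_dim k) (col_dim k)) (ka l, test_col l') * test_fun l' (P (z l)) =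
   (weight R k)%:C * \sum_l u l (P (z l)).
  rewrite mulr_sumr; apply: eq_bigr => l _.
  rewrite (bigD1 l) //= [X in _ + X]big1 ?addr0 => [|l' nl].
    by rewrite /diag /ro /ka /= !eqxx !mul1r.
  rewrite /diag /= -natrM mulnb; case: andP => [[/eqP h1 /eqP h2]|_]; last by rewrite mul0r.
  case/eqP: nl; apply: (@cell_inj2 k); apply/eqP; rewrite eq_sym; apply/eqP.
  move: h1 h2; rewrite /ro /ka => /lshift_inj -> /rshift_inj ->.
  by [].
rewrite gram_sum -rmorphM normc_real ?mulr_ge0 ?norm2_ge0 ?(ltW (weight_gt0 _ _)) //.
rewrite sqrt_rows sqrt_cols -exprD.
have -> : (scale_exp (block_of k) - k ^ 2 + (scale_exp (block_of k) + k ^ 2) = 2 * scale_exp (block_of k))%N.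
  by have := sqr_le_scale_exp k; lia.
move=> h1.
have {h1} : weight R k * norm2 (fun p : T * I => S p.1 p.2) ^+ 2 <=
    2 ^+ (2 * scale_exp (block_of k)) * (K * (K * 2 ^+ (scale_exp (block_of k) - k))).
  apply: le_trans h1 _; rewrite ler_wpM2l ?exprn_ge0 //.
  by apply: le_trans (cbP _ n0) _; rewrite ler_wpM2l // spread_bound.
rewrite /weight ler_pdivrMl ?exprn_gt0 // => /le_trans; apply.
have kt : (k <= scale_exp (block_of k))%N by have := sqr_le_scale_exp k; nia.
have -> : (2 : R) ^+ (scale_exp (block_of k) - k) = 2 ^+ scale_exp (block_of k) / 2 ^+ k.
  by rewrite exprB // ?unitfE.
rewrite (_ : (4 * scale_exp (block_of k) = scale_exp (block_of k) + 2 * scale_exp (block_of k) + scale_exp (block_of k))%N); last lia.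
rewrite !exprD expr2 le_eqVlt; apply/orP; left; apply/eqP.
by field; rewrite expf_neq0.
Qed.

End TestLemma.

(** * Arrays on the cube that almost commute with rotation, flip and sign *)

Section Cube.
Variables (R : realType) (m : nat).
Local Notation C := R[i].
Local Notation s := m.+1.
Local Notation T := (cube m).

Definition rotbits (l : T) : T := [ffun i => l (ordS i)].
Definition flip (k : 'I_s) (l : T) : T := [ffun i => l i (+) (i == k)].
Definition signbit (l : T) : C := (-1) ^+ (l ord0).

Lemma rotbits_inj : injective rotbits.
Proof.
move=> l l' /ffunP h; apply/ffunP => i.
by have := h (ord_pred i); rewrite !ffunE ord_predK.
Qed.

Lemma flipK k : involutive (flip k).
Proof. by move=> l; apply/ffunP => i; rewrite !ffunE -addbA addbb addbF. Qed.

Lemma flip_inj k : injective (flip k).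
Proof. exact: inv_inj (flipK k). Qed.

Lemma iter_rotbits k l i : iter k rotbits l i = l (iter k (@ordS s) i).
Proof. by elim: k i => // k IH i; rewrite iterS ffunE IH -iterSr. Qed.

Lemma iter_ordS k : (k <= m)%N -> iter k (@ordS s) ord0 = inord k.
Proof.
elim: k => [_|k IH km] /=; first by apply: val_inj; rewrite /= inordK.
rewrite IH 1?ltnW //; apply: val_inj; rewrite /= !inordK ?ltnS ?(ltnW km) //.
by rewrite modn_small.
Qed.

Lemma iter_rotbits0 (k : 'I_s) l : iter k rotbits l ord0 = l k.
Proof. by rewrite iter_rotbits iter_ordS ?inord_val // -ltnS ltn_ord. Qed.

Lemma iter_rotbits_inj k : injective (iter k rotbits).
Proof. by elim: k => //= k IH l l' /rotbits_inj /IH. Qed.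

(** Conjugation by rotations carries the flip of the first bit to the flip
    of any other. *)
Lemma iter_rotbits_flip (k : 'I_s) l : iter k rotbits (flip k l) = flip ord0 (iter k rotbits l).
Proof.
apply/ffunP => i; rewrite iter_rotbits !ffunE iter_rotbits; congr (_ (+) _).
have ordSk_inj : injective (iter k (@ordS s)).
  by elim: (nat_of_ord k) => //= k' IH a b /(can_inj (@ordSK s)) /IH.
rewrite -[RHS](inj_eq ordSk_inj) (_ : iter k _ ord0 = k) //.
by rewrite iter_ordS ?inord_val // -ltnS ltn_ord.
Qed.

Variables (M : T * T -> C) (h : R).
Hypothesis h0 : 0 <= h.
Hypothesis M_rot : norm2 (fun p => M p - M (rotbits p.1, rotbits p.2)) <= h.
Hypothesis M_flip : norm2 (fun p => M p - M (flip ord0 p.1, flip ord0 p.2)) <= h.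
Hypothesis M_sign : norm2 (fun p => (signbit p.1 - signbit p.2) * M p) <= h.

Lemma norm2_iter (I : finType) (g : I -> I) (F : I -> C) (b : R) k :
  injective g -> norm2 (fun p => F p - F (g p)) <= b ->
  norm2 (fun p => F p - F (iter k g p)) <= k%:R * b.
Proof.
move=> ginj hb; elim: k => [|k IH].
  by rewrite mul0r (_ : (fun p => _) = fun=> 0) ?norm20 //; apply/funext => p; rewrite subrr.
have -> : (fun p => F p - F (iter k.+1 g p)) =
    (fun p => (F p - F (g p)) + (F (g p) - F (iter k g (g p)))).
  by apply/funext => p; rewrite iterSr addrA subrK.
apply: le_trans (norm2D _ _) _; rewrite -natr1 mulrDl mul1r addrC lerD //.
by apply: le_trans IH; apply: (norm2_inj (fun p => F p - F (iter k g p)) ginj).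
Qed.

Definition rotpair (p : T * T) := (rotbits p.1, rotbits p.2).
Lemma rotpair_inj : injective rotpair.
Proof. by move=> [a b] [c d] [/rotbits_inj -> /rotbits_inj ->]. Qed.
Lemma iter_rotpair_inj k : injective (iter k rotpair).
Proof. by elim: k => //= k IH p q /rotpair_inj /IH. Qed.
Lemma iter_rotpair k p : iter k rotpair p = (iter k rotbits p.1, iter k rotbits p.2).
Proof. by elim: k => [|k /= ->]; first case: p. Qed.

(** Only the sign of the first bit is given; rotating the array brings any
    other bit into first position, at the cost of one [h] for each rotation. *)
Lemma norm2_digit (k : 'I_s) :
  norm2 (fun p : T * T => (p.1 k != p.2 k)%:R * M p) <= s%:R * h.
Proof.
pose G (p : T * T) : C := (p.1 ord0 != p.2 ord0)%:R * M p.
have hG : norm2 G <= h.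
  apply: le_trans M_sign; apply: le_norm2 => p; rewrite /G /signbit !normcM.
  rewrite ler_wpM2r ?normc_ge0 //.
  have n2 : normc (1 + 1 : C) = 2.
    by rewrite (_ : 1 + 1 = (2 : R)%:C) ?normc_real // rmorphD.
  case: (p.1 ord0); case: (p.2 ord0); rewrite ?expr0 ?expr1 ?normc0 ?normc1 ?normc_ge0 //.
    by rewrite -opprD normcN1 n2 ler1n.
  by rewrite opprK n2 ler1n.
have -> : (fun p : T * T => (p.1 k != p.2 k)%:R * M p) =
    (fun p : T * T => (p.1 k != p.2 k)%:R * (M p - M (iter k rotpair p)) + G (iter k rotpair p)).
  apply/funext => p; rewrite /G iter_rotpair /= !iter_rotbits0; ring.
apply: le_trans (norm2D _ _) _.
apply: (@le_trans _ _ (k%:R * h + h)).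
  apply: lerD.
    apply: le_trans (norm2_iter k rotpair_inj M_rot).
    apply: le_norm2 => p; rewrite normcM; case: (_ != _); rewrite ?normc0 ?normc1 ?mul1r //.
    by rewrite mul0r normc_ge0.
  by apply: le_trans (norm2_inj G (@iter_rotpair_inj k)) hG.
by rewrite -[X in _ + X]mul1r -mulrDl ler_wpM2r // natr1 ler_nat.
Qed.

(** Words that differ do so in some bit. *)
Lemma norm2_offdiag : norm2 (fun p => (p.1 != p.2)%:R * M p) <= s%:R ^+ 2 * h.
Proof.
apply: (@le_trans _ _ (norm2 (fun p : T * T => \sum_(k < s) (normc ((p.1 k != p.2 k)%:R * M p))%:C))).
  apply: le_norm2 => p; rewrite -rmorph_sum normc_real; last first.
    by apply: sumr_ge0 => *; apply: normc_ge0.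
  have [e|ne] := eqVneq p.1 p.2.
    by rewrite mul0r normc0; apply: sumr_ge0 => *; apply: normc_ge0.
  have [k nk] : exists k, p.1 k != p.2 k.
    apply/existsP; rewrite -negb_forall; apply: contra ne => /forallP e.
    by apply/eqP/ffunP => i; apply/eqP.
  rewrite (bigD1 k) //= nk lerDl; apply: sumr_ge0 => *; exact: normc_ge0.
apply: le_trans (norm2_sum _ _) _.
apply: (@le_trans _ _ (\sum_(k < s) s%:R * h)).
  by apply: ler_sum => k _; rewrite norm2_normc; apply: norm2_digit.
by rewrite sumr_const card_ord -[leLHS]mulr_natl mulrA expr2.
Qed.

Let d (l : T) : C := M (l, l).
Let dg_inj : injective (fun l : T => (l, l)). Proof. by move=> a b []. Qed.

Lemma d_rot : norm2 (fun l => d l - d (rotbits l)) <= h.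
Proof.
apply: le_trans M_rot.
exact: (norm2_inj (fun p => M p - M (rotbits p.1, rotbits p.2)) dg_inj).
Qed.

Lemma d_flip0 : norm2 (fun l => d l - d (flip ord0 l)) <= h.
Proof.
apply: le_trans M_flip.
exact: (norm2_inj (fun p => M p - M (flip ord0 p.1, flip ord0 p.2)) dg_inj).
Qed.

(** Rotate, flip the first bit, rotate back: every step is an injection of
    the cube, so the errors just add up. *)
Lemma d_flip (k : 'I_s) : norm2 (fun l => d l - d (flip k l)) <= 2 * s%:R * h.
Proof.
have -> : (fun l => d l - d (flip k l)) =
  (fun l => (d l - d (iter k rotbits l))
     + ((d (iter k rotbits l) - d (flip ord0 (iter k rotbits l)))
        - (d (flip k l) - d (iter k rotbits (flip k l))))).
  by apply/funext => l; rewrite iter_rotbits_flip; ring.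
have hr := norm2_iter k rotbits_inj d_rot.
apply: le_trans (norm2D _ _) _.
have h2 := norm2B (fun l => d (iter k rotbits l) - d (flip ord0 (iter k rotbits l)))
               (fun l => d (flip k l) - d (iter k rotbits (flip k l))).
apply: le_trans (lerD hr h2) _.
have h3 := le_trans (norm2_inj (fun l => d l - d (flip ord0 l)) (@iter_rotbits_inj k)) d_flip0.
have h4 := le_trans (norm2_inj (fun l => d l - d (iter k rotbits l)) (@flip_inj k)) hr.
apply: le_trans (lerD (lexx _) (lerD h3 h4)) _.
have ks : k%:R + 1 <= s%:R :> R by rewrite natr1 ler_nat.
rewrite -subr_ge0.
have -> : 2 * s%:R * h - (k%:R * h + (h + k%:R * h)) = (2 * (s%:R - (k%:R + 1)) + 1) * h by ring.
by rewrite mulr_ge0 // addr_ge0 // mulr_ge0 // subr_ge0.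
Qed.

Definition shift (c l : T) : T := [ffun i => l i (+) c i].
(** The part of [c] in the first [k] bits: any translation of the cube is
    reached by adding the bits of [c] one at a time. *)
Definition low (k : nat) (c : T) : T := [ffun i : 'I_s => (i < k)%N && c i].

Lemma shift_inj c : injective (shift c).
Proof.
move=> l l' /ffunP e; apply/ffunP => i; have := e i; rewrite !ffunE.
exact: addIb.
Qed.

Lemma shiftC c l : shift c l = shift l c.
Proof. by apply/ffunP => i; rewrite !ffunE addbC. Qed.

Lemma d_low c k : (k <= s)%N ->
  norm2 (fun l => d l - d (shift (low k c) l)) <= k%:R * (2 * s%:R * h).
Proof.
elim: k => [_|k IH ks].
  rewrite mul0r (_ : (fun l => _) = fun=> 0) ?norm20 //; apply/funext => l.
  by rewrite (_ : shift _ _ = l) ?subrr //; apply/ffunP => i; rewrite !ffunE addbF.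
have {}IH := IH (ltnW ks); pose k' := Ordinal ks.
rewrite -natr1 mulrDl mul1r.
have [ck|nck] := boolP (c k'); last first.
  have -> : low k.+1 c = low k c.
    apply/ffunP => i; rewrite !ffunE ltnS leq_eqVlt.
    have [e|//] := eqVneq (i : nat) k; rewrite e ltnn /=.
    by rewrite (_ : i = k') ?(negbTE nck) //; apply: val_inj.
  by apply: le_trans IH _; rewrite lerDl mulr_ge0 ?mulr_ge0.
have e l : shift (low k.+1 c) l = shift (low k c) (flip k' l).
  apply/ffunP => i; rewrite !ffunE ltnS leq_eqVlt -addbA; congr (_ (+) _).
  have [->|ne] := eqVneq i k'; first by rewrite /= eqxx ltnn /= ck.
  by have /negbTE -> : (i != k :> nat) by apply: contra ne => /eqP h'; apply/eqP/val_inj.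
have -> : (fun l => d l - d (shift (low k.+1 c) l)) =
   (fun l => (d l - d (flip k' l)) + (d (flip k' l) - d (shift (low k c) (flip k' l)))).
  by apply/funext => l; rewrite e; ring.
apply: le_trans (norm2D _ _) _; rewrite addrC; apply: lerD; last exact: d_flip.
exact: le_trans (norm2_inj (fun l => d l - d (shift (low k c) l)) (@flip_inj k')) IH.
Qed.

Lemma d_shift c : norm2 (fun l => d l - d (shift c l)) <= 2 * s%:R ^+ 2 * h.
Proof.
have := d_low c (leqnn s).
rewrite (_ : low s c = c); last by apply/ffunP => i; rewrite !ffunE ltn_ord.
by move/le_trans; apply; rewrite le_eqVlt; apply/orP; left; apply/eqP; ring.
Qed.

Definition diag_mean : C := (#|T|%:R)^-1 * \sum_l d l.

(** Averaging over all translations replaces the value of [d] at a translate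
    by the mean of [d]. *)
Lemma d_diag_mean : norm2 (fun l => d l - diag_mean) <= 2 * s%:R ^+ 2 * h.
Proof.
have B0 : 0 <= 2 * s%:R ^+ 2 * h by rewrite !mulr_ge0 ?exprn_ge0.
have N0 : 0 < #|T|%:R :> R by rewrite ltr0n; apply/card_gt0P; exists [ffun=> false].
apply: norm2_le_sqr => //.
have key l : normc (d l - diag_mean) ^+ 2 <= #|T|%:R^-1 * \sum_c normc (d l - d (shift c l)) ^+ 2.
  have -> : d l - diag_mean = (#|T|%:R^-1)%:C * \sum_c (d l - d (shift c l)).
    rewrite sumrB sumr_const mulrBr -[d l *+ _]mulr_natl mulrA.
    have -> : (#|T|%:R^-1)%:C = (#|T|%:R)^-1 :> C by rewrite fmorphV rmorph_nat.
    rewrite mulVf ?mul1r; last by rewrite pnatr_eq0 -lt0n; rewrite ltr0n in N0.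
    congr (_ - _ * _); rewrite (reindex_inj (@shift_inj l)) /=.
    by apply: eq_bigr => c _; rewrite shiftC.
  have i0 : 0 <= #|T|%:R^-1 :> R by rewrite invr_ge0 ltW.
  rewrite normcM normc_real // exprMn (expr2 (#|T|%:R^-1)) -[leLHS]mulrA ler_wpM2l //.
  rewrite ler_pdivrMl //.
  have := @cauchy_schwarz R _ (fun _ : T => 1) (fun c => d l - d (shift c l)).
  under eq_bigr do rewrite mul1r.
  rewrite norm2_const normc1 mulr1 => /(lerXn2r 2) h'.
  have := h' _ _; rewrite !nnegrE normc_ge0 mulr_ge0 ?sqrtr_ge0 ?norm2_ge0 // => /(_ isT isT).
  by rewrite exprMn sqr_sqrtr ?ler0n // norm2_sqr.
apply: le_trans (ler_sum _ (fun l _ => key l)) _.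
rewrite -mulr_sumr exchange_big /= ler_pdivrMl //.
apply: (@le_trans _ _ (\sum_(c : T) (2 * s%:R ^+ 2 * h) ^+ 2)).
  by apply: ler_sum => c _; rewrite -norm2_sqr ler_sqr ?nnegrE ?norm2_ge0 // d_shift.
by rewrite sumr_const -[leLHS]mulr_natl.
Qed.

(** The matrices that commute exactly with the rotation, the flip and the
    sign are scalars; this is the quantitative form, with a loss polynomial
    in the number of bits. *)
Lemma near_scalar :
  norm2 (fun p => M p - (p.1 == p.2)%:R * diag_mean) <= 3 * s%:R ^+ 2 * h.
Proof.
have -> : (fun p => M p - (p.1 == p.2)%:R * diag_mean) =
    (fun p => (p.1 != p.2)%:R * M p + (p.1 == p.2)%:R * (d p.1 - diag_mean)).
  apply/funext => -[a b] /=; have [->|_] := eqVneq a b; rewrite /d /=; ring.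
apply: le_trans (norm2D _ _) _.
have -> : 3 * s%:R ^+ 2 * h = s%:R ^+ 2 * h + 2 * s%:R ^+ 2 * h by ring.
apply: lerD; first exact: norm2_offdiag.
apply: le_trans d_diag_mean; apply: norm2_le_sqr; rewrite ?norm2_ge0 // -norm2_sqr norm2_pair norm2_sqr.
apply: ler_sum => a _; rewrite norm2_sqr (bigD1 a) //= eqxx mul1r big1 ?addr0 //.
by move=> b; rewrite eq_sym => /negbTE ->; rewrite mul0r normc0 expr0n.
Qed.

End Cube.

(** * The compression of a completely bounded map to a block *)

Section Block.
Variable R : realType.
Local Notation C := R[i].
Local Notation H := (l2cnm R).

(** With [bitperm], the six monomial unitaries: 1, -1, i, the rotation, the
    flip and the sign. All further indices give the identity again. *)
Definition phase (n j : nat) (l : bits n) : C :=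
  match j with
  | 1%N => -1 | 2%N => 'i | 5%N => signbit R l | _ => 1
  end.
Definition bitperm (n j : nat) (l : bits n) : bits n :=
  match j with
  | 3%N => rotbits l | 4%N => flip ord0 l | _ => l
  end.

Lemma normc_phase n j l : normc (@phase n j l) = 1.
Proof.
have n1 : normc (-1 : C) = 1 by rewrite normcN1 normc1.
have n0 : normc (1 : C) = 1 by exact: normc1.
case: j => [|[|[|[|[|[|j]]]]]]; [exact: n0|exact: n1|exact: normc_i|exact: n0|exact: n0| |exact: n0].
by rewrite /phase /signbit; case: (l ord0); rewrite ?expr1 ?expr0.
Qed.

Lemma bitperm_inj n j : injective (@bitperm n j).
Proof.
have id_inj : injective (fun l : bits n => l) by [].
do 3?[case: j => [|j]; first exact: id_inj].
case: j => [|j]; first exact: rotbits_inj.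
case: j => [|j]; first exact: flip_inj.
exact: id_inj.
Qed.

Local Notation F := (block_family normc_phase bitperm_inj).

Variables (P : H -> H) (K : R).
Hypothesis linP : linear P.
Hypothesis K0 : 0 <= K.
Hypothesis cbP : forall n (x : 'M[H]_n), (0 < n)%N ->
  test_mxnorm F (map_mx P x) <= K * test_mxnorm F x.

Variable n : nat.
Local Notation T := (bits n).
Local Notation s := (4 * scale_exp n)%N.
(** This is [2 K sqrt (N / 2 ^ (32 n))]: the bound of
    [hilbert_schmidt_bound] for the block [n], with the factor 2 that clears
    the two [1 / sqrt 2] of [graph_defect] and [graph_vec]. *)
Definition slack : R := 2 * K * (2 ^+ (2 * scale_exp n) / 2 ^+ (16 * n)).

Lemma slack_ge0 : 0 <= slack.
Proof. by rewrite !mulr_ge0 ?divr_ge0 ?exprn_ge0. Qed.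

Lemma block_bound j (I : finType) (f : I -> H) : (j < 32)%N ->
  (forall v : I -> C, l2nrm (\sum_i v i *: f i) <= norm2 v) ->
  (forall i (l : T), graph_defect phase bitperm j l (f i) = 0) ->
  norm2 (fun p : T * I => graph_defect phase bitperm j p.1 (P (f p.2))) <= slack / 2.
Proof.
move=> j32 f_on f_ker; pose k := (32 * n + j)%N.
have bk : block_of k = n by rewrite /block_of /k mulnC divnMDl // divn_small // addn0.
have tk : kind_of k = j by rewrite /kind_of /k mulnC modnMDl modn_small.
have := @hilbert_schmidt_bound R phase bitperm normc_phase bitperm_inj P K linP K0 cbP k I f f_on.
rewrite tk; move: k bk {tk} => k bk.
have kn : (32 * n <= k)%N by rewrite -bk /block_of mulnC leq_divM.
move: bk kn f_ker; rewrite /slack; case: n / => kn f_ker /(_ f_ker) h.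
apply: norm2_le_sqr; first by rewrite mulr_ge0 // !mulr_ge0 ?invr_ge0 ?exprn_ge0.
rewrite -norm2_sqr; apply: le_trans h _.
rewrite (_ : 2 * K * _ / 2 = K * (2 ^+ (2 * scale_exp (block_of k)) / 2 ^+ (16 * block_of k))); last by field; rewrite expf_neq0.
rewrite exprMn ler_wpM2l ?exprn_ge0 // expr_div_n -!exprM.
rewrite (_ : (2 * scale_exp (block_of k) * 2 = 4 * scale_exp (block_of k))%N); last lia.
rewrite ler_wpM2l ?exprn_ge0 // lef_pV2 ?posrE ?exprn_gt0 //.
by apply: pow2_le; lia.
Qed.

Local Notation e0 := (fun l : T => l2delta R (block_coord false l) : H).
Local Notation e1 := (fun l : T => l2delta R (block_coord true l) : H).
(** The compression of [P] to the block as a 2 x 2 matrix of arrays on the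
    cube; the first index is the row. *)
Definition M00 (p : T * T) : C := P (e0 p.2) (block_coord false p.1).
Definition M01 (p : T * T) : C := P (e1 p.2) (block_coord false p.1).
Definition M10 (p : T * T) : C := P (e0 p.2) (block_coord true p.1).
Definition M11 (p : T * T) : C := P (e1 p.2) (block_coord true p.1).

(** The orthonormal basis of the graph of the j-th unitary, reindexed by
    [bitperm] so that the inverse of the permutation does not occur. *)
Definition graph_vec (j : nat) (a : T) : H :=
  (rsqrt2 R)%:C *: (e0 (bitperm j a) + phase j a *: e1 a).

Lemma halfC : (2^-1 : R)%:C = 2^-1 :> C.
Proof. by rewrite fmorphV rmorph_nat. Qed.

Lemma rsqrt2C_sqr : (rsqrt2 R)%:C * (rsqrt2 R)%:C = 2^-1 :> C.
Proof. by rewrite -rmorphM -expr2 rsqrt2_sqr; exact: halfC. Qed.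

(** The two halves of all the basis vectors use distinct coordinates, and
    each half carries half of the squared norm. *)
Lemma graph_vec_orthonormal j (v : T -> C) : l2nrm (\sum_a v a *: graph_vec j a) <= norm2 v.
Proof.
pose kk (p : bool * T) := if p.1 then block_coord true p.2 else block_coord false (bitperm j p.2).
have kinj : injective kk.
  move=> [[] l] [[] l'] /block_coord_inj [] //; first by move->.
  by move/bitperm_inj ->.
(* Coefficients of the sum in the coordinate vectors of the block. *)
pose w (p : bool * T) : C := (rsqrt2 R)%:C * (if p.1 then phase j p.2 * v p.2 else v p.2).
have -> : \sum_a v a *: graph_vec j a = \sum_p w p *: (l2delta R (kk p) : H).
  rewrite -(pair_bigA _ (fun b a => w (b, a) *: (l2delta R (kk (b, a)) : H))) /= big_bool /=.
  rewrite -big_split; apply: eq_bigr => a _; apply: l2_eq => i.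
  change (v a * ((rsqrt2 R)%:C * (e0 (bitperm j a) i + phase j a * e1 a i)) =
    (rsqrt2 R)%:C * (phase j a * v a) * e1 a i + (rsqrt2 R)%:C * v a * e0 (bitperm j a) i).
  by move: (e0 _ i) (e1 _ i) => x y; ring.
apply: le_trans (l2nrm_delta_sum w kinj) _.
apply: norm2_le_sqr; rewrite ?norm2_ge0 // -norm2_sqr norm2_pair big_bool /w /= !norm2Z !exprMn.
rewrite normc_real ?rsqrt2_ge0 // rsqrt2_sqr !norm2_sqr.
rewrite (eq_bigr (fun a => normc (v a) ^+ 2)) => [|a _]; last by rewrite normcM normc_phase mul1r.
by rewrite -mulrDl [X in X * _](_ : _ = 1) ?mul1r //; field.
Qed.

Lemma graph_vec_ker j (a l : T) : graph_defect phase bitperm j l (graph_vec j a) = 0.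
Proof.
have E i : graph_vec j a i = (rsqrt2 R)%:C * ((i == block_coord false (bitperm j a))%:R + phase j a * (i == block_coord true a)%:R).
  by [].
rewrite /graph_defect !E.
have kE b b' (x y : T) : (block_coord b x == block_coord b' y) = ((b == b') && (x == y)).
  by apply/eqP/andP => [/block_coord_inj [-> ->]//|[/eqP -> /eqP ->]].
rewrite !kE /= (inj_eq (@bitperm_inj n j)).
have [->|_] := eqVneq l a; rewrite ?mulr0 ?addr0 ?mulr1 ?add0r; ring.
Qed.

(** Twice the entries of [(y - g x) / sqrt 2] after [P], on the basis of the
    graph of [g]. *)
Definition graph_entry (j : nat) (p : T * T) : C :=
  M10 (p.1, bitperm j p.2) + phase j p.2 * M11 p - phase j p.1 * M00 (bitperm j p.1, bitperm j p.2)
  - phase j p.1 * phase j p.2 * M01 (bitperm j p.1, p.2).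

Lemma graph_entry_le j : (j < 32)%N -> norm2 (graph_entry j) <= slack.
Proof.
move=> j32.
have := block_bound j32 (graph_vec_orthonormal j) (fun a l => graph_vec_ker j a l).
have -> : (fun p : T * T => graph_defect phase bitperm j p.1 (P (graph_vec j p.2))) = (fun p => (2^-1 : R)%:C * graph_entry j p).
  apply/funext => -[l a] /=.
  have -> : P (graph_vec j a) = (rsqrt2 R)%:C *: (P (e0 (bitperm j a)) + phase j a *: P (e1 a)).
    by rewrite /graph_vec (linZ linP) (linD linP) (linZ linP).
  set x := P (e0 _); set y := P (e1 _).
  transitivity ((rsqrt2 R)%:C *
    ((rsqrt2 R)%:C * (x (block_coord true l) + phase j a * y (block_coord true l)) -
     phase j l * ((rsqrt2 R)%:C * (x (block_coord false (bitperm j l)) + phase j a * y (block_coord false (bitperm j l)))))).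
    by [].
  rewrite /graph_entry /M00 /M01 /M10 /M11 /= -/x -/y halfC -rsqrt2C_sqr.
  by move: (x _) (y _) (x _) (y _) => *; ring.
rewrite norm2Z normc_real ?invr_ge0 // mulrC; lra.
Qed.

Lemma norm2_combo (f g : T * T -> C) (c : C) (a b : R) :
  norm2 f <= a -> norm2 g <= b -> norm2 (fun p => f p + c * g p) <= a + normc c * b.
Proof.
move=> ha hb; apply: le_trans (norm2D _ _) _; rewrite norm2Z; apply: lerD => //.
by rewrite ler_wpM2l ?normc_ge0.
Qed.

Lemma normc_half : normc (2^-1 : C) = 2^-1.
Proof. by rewrite -halfC normc_real ?invr_ge0. Qed.

(** The difference of the relations for [g = 1] and [g = -1]. *)
Lemma M11_subM00_le : norm2 (fun p => M11 p - M00 p) <= slack.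
Proof.
have := norm2_combo (-1) (graph_entry_le (isT : 0 < 32)%N) (graph_entry_le (isT : 1 < 32)%N).
rewrite normcN1 normc1 mul1r => h.
have -> : (fun p => M11 p - M00 p) = (fun p => 2^-1 * (graph_entry 0 p + -1 * graph_entry 1 p)).
  by apply/funext => -[l a]; rewrite /graph_entry /=; field.
rewrite norm2Z normc_half; lra.
Qed.

(** The sum of the relations for [g = 1] and [g = -1]. *)
Lemma M10_subM01_le : norm2 (fun p => M10 p - M01 p) <= slack.
Proof.
have := norm2_combo 1 (graph_entry_le (isT : 0 < 32)%N) (graph_entry_le (isT : 1 < 32)%N).
rewrite normc1 mul1r => h.
have -> : (fun p => M10 p - M01 p) = (fun p => 2^-1 * (graph_entry 0 p + 1 * graph_entry 1 p)).
  by apply/funext => -[l a]; rewrite /graph_entry /=; field.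
rewrite norm2Z normc_half; lra.
Qed.

(** In the relation for [g = i] the antidiagonal terms enter with the same
    sign. *)
Lemma M10_addM01_le : norm2 (fun p => M10 p + M01 p) <= 2 * slack.
Proof.
have := norm2_combo (- 'i) (graph_entry_le (isT : 2 < 32)%N) M11_subM00_le.
rewrite normcN1 normc_i mul1r => h.
have -> : (fun p => M10 p + M01 p) = (fun p => graph_entry 2 p + - 'i * (M11 p - M00 p)).
  by apply/funext => -[l a]; rewrite /graph_entry /= i_mul_i; ring.
lra.
Qed.

Lemma M10_le : norm2 M10 <= 2 * slack.
Proof.
have := norm2_combo 1 M10_subM01_le M10_addM01_le.
rewrite normc1 mul1r => h.
have -> : M10 = (fun p => 2^-1 * (M10 p - M01 p + 1 * (M10 p + M01 p))).
  by apply/funext => -[l a]; field.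
have := slack_ge0; rewrite norm2Z normc_half; lra.
Qed.

Lemma M01_le : norm2 M01 <= 2 * slack.
Proof.
have := norm2_combo (-1) M10_addM01_le M10_subM01_le.
rewrite normcN1 normc1 mul1r => h.
have -> : M01 = (fun p => 2^-1 * (M10 p + M01 p + -1 * (M10 p - M01 p))).
  by apply/funext => -[l a]; field.
have := slack_ge0; rewrite norm2Z normc_half; lra.
Qed.

Lemma norm2_add4 (f1 f2 f3 f4 : T * T -> C) (b1 b2 b3 b4 : R) :
  norm2 f1 <= b1 -> norm2 f2 <= b2 -> norm2 f3 <= b3 -> norm2 f4 <= b4 ->
  norm2 (fun p => f1 p + f2 p + f3 p + f4 p) <= b1 + b2 + b3 + b4.
Proof.
move=> h1 h2 h3 h4.
apply: le_trans (norm2D _ _) _; apply: lerD => //.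
apply: le_trans (norm2D _ _) _; apply: lerD => //.
by apply: le_trans (norm2D _ _) _; apply: lerD.
Qed.

(** For a permutation [g] the relation of its graph reads [M11 g = g M00],
    up to the antidiagonal terms, and [M11] is close to [M00]. *)
Lemma M00_commute j : (j = 3 \/ j = 4)%N ->
  norm2 (fun p => M00 p - M00 (bitperm j p.1, bitperm j p.2)) <= 6 * slack.
Proof.
move=> j34.
have j32 : (j < 32)%N by case: j34 => ->.
have z1 l : phase j l = 1 :> C by case: j34 => ->.
have hg : norm2 (fun p : T * T => - M10 (p.1, bitperm j p.2)) <= 2 * slack.
  rewrite norm2N; apply: le_trans M10_le.
  apply: (norm2_inj M10 (k := fun p : T * T => (p.1, bitperm j p.2))).
  by move=> [a b] [c d] [-> /bitperm_inj ->].
have hb : norm2 (fun p : T * T => M01 (bitperm j p.1, p.2)) <= 2 * slack.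
  apply: le_trans M01_le.
  apply: (norm2_inj M01 (k := fun p : T * T => (bitperm j p.1, p.2))).
  by move=> [a b] [c d] [/bitperm_inj -> ->].
have hd : norm2 (fun p => - (M11 p - M00 p)) <= slack by rewrite norm2N M11_subM00_le.
have := norm2_add4 (graph_entry_le j32) hg hb hd.
have -> : (fun p => M00 p - M00 (bitperm j p.1, bitperm j p.2)) =
  (fun p => graph_entry j p + - M10 (p.1, bitperm j p.2) + M01 (bitperm j p.1, p.2) + - (M11 p - M00 p)).
  by apply/funext => -[l a]; rewrite /graph_entry /= !z1; ring.
lra.
Qed.

Lemma normc_signbit (l : T) : normc (signbit R l) = 1.
Proof. exact: (normc_phase 5 l). Qed.

Lemma M00_sign : norm2 (fun p => (signbit R p.1 - signbit R p.2) * M00 p) <= 6 * slack.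
Proof.
have h1 : norm2 (fun p => - graph_entry 5 p) <= slack by rewrite norm2N graph_entry_le.
have h3 : norm2 (fun p : T * T => signbit R p.2 * (M11 p - M00 p)) <= slack.
  apply: le_trans M11_subM00_le; apply: le_norm2 => p.
  by rewrite normcM normc_signbit mul1r.
have h4 : norm2 (fun p : T * T => - (signbit R p.1 * signbit R p.2 * M01 p)) <= 2 * slack.
  rewrite norm2N; apply: le_trans M01_le; apply: le_norm2 => p.
  by rewrite !normcM !normc_signbit !mul1r.
have := norm2_add4 h1 M10_le h3 h4.
have -> : (fun p => (signbit R p.1 - signbit R p.2) * M00 p) =
  (fun p => - graph_entry 5 p + M10 p + signbit R p.2 * (M11 p - M00 p) + - (signbit R p.1 * signbit R p.2 * M01 p)).
  by apply/funext => -[l a]; rewrite /graph_entry /=; ring.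
lra.
Qed.

Definition corner_mean : C := diag_mean M00.

Lemma M00_scalar : norm2 (fun p => M00 p - (p.1 == p.2)%:R * corner_mean) <= 18 * s%:R ^+ 2 * slack.
Proof.
have h6 : 0 <= 6 * slack by rewrite mulr_ge0 ?slack_ge0.
have := @near_scalar R _ M00 (6 * slack) h6 (M00_commute (or_introl erefl))
  (M00_commute (or_intror erefl)) M00_sign.
rewrite prednK ?muln_gt0 ?expn_gt0 // => /le_trans; apply.
rewrite le_eqVlt; apply/orP; left; apply/eqP; ring.
Qed.

Definition in_block (c : nat) : bool := [exists b : bool, exists l : T, block_coord b l == c].

Lemma in_blockP b (l : T) : in_block (block_coord b l).
Proof. by apply/existsP; exists b; apply/existsP; exists l. Qed.

(** Coordinate vectors outside the block lie in the kernels for [g = 1] and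
    [g = -1]; the difference of the two relations isolates the first half of
    the block. *)
Lemma outside_le (m : nat) :
  norm2 (fun p : T * 'I_m => if in_block p.2 then 0 else P (l2delta R p.2) (block_coord false p.1)) <= slack.
Proof.
(* Vectors of the block are replaced by 0, so that the index set stays an
   ordinal and the linear combinations of [f] still have norm at most that
   of the coefficients. *)
pose f (c : 'I_m) : H := if in_block c then 0 else l2delta R c.
have f_on (v : 'I_m -> C) : l2nrm (\sum_c v c *: f c) <= norm2 v.
  have -> : \sum_c v c *: f c =
      \sum_(c < m) (if in_block c then 0 else v c) *: (l2delta R (nat_of_ord c) : H).
    by apply: eq_bigr => c _; rewrite /f; case: ifP => _; rewrite ?scaler0 ?scale0r.
  apply: le_trans (l2nrm_delta_sum _ (@ord_inj m)) _.
  by apply: le_norm2 => c; case: ifP => _; rewrite ?normc0 ?normc_ge0.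
have f0 c b (l : T) : f c (block_coord b l) = 0.
  rewrite /f; case: ifPn => // nc; rewrite l2deltaE.
  by case: eqP => // e; case/negP: nc; rewrite -e in_blockP.
have f_ker j c (l : T) : graph_defect phase bitperm j l (f c) = 0.
  by rewrite /graph_defect !f0; ring.
have h0 := block_bound (isT : 0 < 32)%N f_on (f_ker 0%N).
have h1 := block_bound (isT : 1 < 32)%N f_on (f_ker 1%N).
pose G (p : T * 'I_m) : C := P (f p.2) (block_coord false p.1).
have -> : (fun p : T * 'I_m => if in_block p.2 then 0 else P (l2delta R p.2) (block_coord false p.1)) = G.
  by apply/funext => p; rewrite /G /f; case: ifP => // _; rewrite (lin0 linP).
have e : (fun p : T * 'I_m => graph_defect phase bitperm 1 p.1 (P (f p.2)) - graph_defect phase bitperm 0 p.1 (P (f p.2)))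
   = (fun p => (2 * (rsqrt2 R))%:C * G p).
  by apply/funext => p; rewrite /graph_defect /G /= rmorphM rmorph_nat; ring.
have := norm2B (fun p : T * 'I_m => graph_defect phase bitperm 1 p.1 (P (f p.2)))
            (fun p : T * 'I_m => graph_defect phase bitperm 0 p.1 (P (f p.2))).
rewrite e norm2Z normc_real ?mulr_ge0 ?rsqrt2_ge0 // => h2.
have s1 : 1 <= 2 * rsqrt2 R.
  rewrite -(@ler_pXn2r _ 2) ?nnegrE ?mulr_ge0 ?rsqrt2_ge0 // exprMn rsqrt2_sqr expr1n.
  lra.
have : norm2 G <= 2 * rsqrt2 R * norm2 G by rewrite ler_peMl ?norm2_ge0.
lra.
Qed.

End Block.

(** * Traces of idempotents *)

Section Trace.
Variable R : realType.
Local Notation C := R[i].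
Local Notation H := (l2cnm R).
Local Notation F := (block_family (@normc_phase R) bitperm_inj).

Variables (P : H -> H) (K : R).
Hypothesis linP : linear P.
Hypothesis K0 : 0 <= K.
Hypothesis cbP : forall n (x : 'M[H]_n), (0 < n)%N ->
  test_mxnorm F (map_mx P x) <= K * test_mxnorm F x.
Hypothesis idemP : forall x, P (P x) = P x.

Variable n : nat.
Local Notation T := (bits n).
Local Notation s := (4 * scale_exp n)%N.
Local Notation h := (slack K n).
Local Notation e0 := (fun l : T => l2delta R (block_coord false l) : H).
Local Notation e1 := (fun l : T => l2delta R (block_coord true l) : H).
Local Notation M00 := (@M00 R P n).
Local Notation M01 := (@M01 R P n).
Local Notation M10 := (@M10 R P n).

Let nP (x : H) : l2nrm (P x) <= K * l2nrm x.
Proof. exact: (l2nrm_cb cbP). Qed.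

Let y (l : T) : H := P (e0 l).
Let out (l : T) : H := l2mask (fun c => ~~ in_block n c) (y l).

Lemma l2nrm_out l : l2nrm (out l) <= K.
Proof.
apply: le_trans (l2nrm_mask _ _) _; apply: le_trans (nP _) _.
by rewrite ler_piMr // l2nrm_delta.
Qed.

Lemma y_split l : y l = \sum_l' (M00 (l', l) *: e0 l' + M10 (l', l) *: e1 l') + out l.
Proof.
pose kk (p : bool * T) := block_coord p.1 p.2.
have kinj : injective kk by move=> [b a] [b' a'] /block_coord_inj.
have -> : \sum_l' (M00 (l', l) *: e0 l' + M10 (l', l) *: e1 l') =
    \sum_(p : bool * T) y l (kk p) *: (l2delta R (kk p) : H).
  rewrite -(pair_bigA _ (fun (b : bool) (a : T) => y l (block_coord b a) *: (l2delta R (block_coord b a) : H))) /= big_bool /=.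
  by rewrite addrC -big_split.
apply: l2_eq => i.
have E : (\sum_(p : bool * T) y l (kk p) *: (l2delta R (kk p) : H) + out l : H) i =
   \sum_p y l (kk p) * (i == kk p)%:R + (if ~~ in_block n i then y l i else 0).
  by rewrite -[LHS]/(_ + _); congr (_ + _); exact: l2sum.
rewrite {}E; case: ifPn => [ni|/negPn /existsP [b /existsP [a /eqP <-]]].
  rewrite big1 ?add0r // => -[b a] _; case: eqP => [e|_]; last by rewrite mulr0.
  by case/negP: ni; rewrite e in_blockP.
rewrite addr0 (bigD1 (b, a)) //= eqxx mulr1 big1 ?addr0 // => p np.
by rewrite (inj_eq kinj (b, a)) eq_sym (negbTE np) mulr0.
Qed.

(** [P = P ^ 2] on a diagonal entry, with the intermediate vector split into
    its part in the block and the rest. *)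
Lemma M00_diag l : M00 (l, l) =
  \sum_l' (M00 (l', l) * M00 (l, l') + M10 (l', l) * M01 (l, l')) + P (out l) (block_coord false l).
Proof.
have {1}-> : M00 (l, l) = P (y l) (block_coord false l) by rewrite /y idemP.
rewrite {1}y_split (linD linP) (lin_sum linP).
rewrite -[LHS]/(_ + _); congr (_ + _).
have L := @l2sum R _ (index_enum T) xpredT (fun l' => P (M00 (l', l) *: e0 l' + M10 (l', l) *: e1 l')) (block_coord false l).
rewrite [LHS]L; apply: eq_bigr => l' _.
by rewrite (linD linP) !(linZ linP).
Qed.

(** The functionals [x -> P x (block_coord false l)] are continuous, so on
    vectors supported outside the block they are controlled by their
    coordinates there, that is by [outside_le]; Cauchy-Schwarz over [l]
    gives the factor [sqrt N]. *)
Lemma out_sum : \sum_l normc (P (out l) (block_coord false l)) <= Num.sqrt #|T|%:R * (K * h).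
Proof.
apply/ler_addgt0Pr => e egt0.
have N0 : 0 < #|T|%:R :> R by rewrite ltr0n; apply/card_gt0P; exists [ffun=> false].
pose d := e / (#|T|%:R * (K + 1)).
have K1 : 0 < K + 1 by rewrite ltr_wpDl.
have d0 : 0 < d by rewrite divr_gt0 // mulr_gt0.
have /boolp.choice [mf hmf] : forall l, exists m0, forall m, (m0 <= m)%N ->
    l2nrm (out l - l2mask (fun i => (i < m)%N) (out l)) <= d.
  move=> l; have [m0 hm0] := trunc_tail (out l) d0.
  by exists m0 => m m0m; apply: hm0 => i im; apply: leq_trans m0m.
pose m := \max_l mf l.
pose G (p : T * 'I_m) : C := if in_block n p.2 then 0 else P (l2delta R p.2) (block_coord false p.1).
have hG : norm2 G <= h by exact: (outside_le linP K0 cbP).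
have bd l : normc (P (out l) (block_coord false l)) <= K * norm2 (fun c => G (l, c)) + K * d.
  pose o1 : H := l2mask (fun i => (i < m)%N) (out l).
  have -> : P (out l) (block_coord false l) = P o1 (block_coord false l) + P (out l - o1) (block_coord false l).
    by rewrite -[RHS]/((P o1 + P (out l - o1)) (block_coord false l)) -(linD linP) addrC subrK.
  apply: le_trans (normcD _ _) _; apply: lerD; last first.
    apply: le_trans (l2nrm_coord _ _) _; apply: le_trans (nP _) _.
    by rewrite ler_wpM2l // hmf //; apply: leq_bigmax.
  have -> : P o1 (block_coord false l) = \sum_(c < m) out l c * G (l, c).
    have -> : o1 = \sum_(c < m) out l c *: (l2delta R c : H) by exact: mask_upto.
    rewrite (lin_sum linP).
    have L := @l2sum R _ (index_enum 'I_m) xpredT (fun c : 'I_m => P (out l c *: (l2delta R c : H))) (block_coord false l).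
    rewrite [LHS]L; apply: eq_bigr => c _; rewrite (linZ linP) /G /=.
    rewrite -[LHS]/(out l c * P (l2delta R c) (block_coord false l)).
    by rewrite /out l2maskE; case: (in_block n c); rewrite //= !mul0r.
  apply: le_trans (cauchy_schwarz _ _) _; rewrite ler_wpM2r ?norm2_ge0 //.
  exact: le_trans (norm2_upto_le m (out l)) (l2nrm_out l).
apply: le_trans (ler_sum _ (fun l _ => bd l)) _.
rewrite big_split /= -mulr_sumr sumr_const -[X in _ + X]mulr_natl.
apply: lerD.
  rewrite mulrCA ler_wpM2l //; apply: le_trans (sum_norm2_le G) _.
  by rewrite ler_wpM2l ?sqrtr_ge0.
have -> : #|T|%:R * (K * d) = e * (K / (K + 1)).
  by rewrite /d; field; rewrite !gt_eqF.
by rewrite ler_piMr ?(ltW egt0) // ler_pdivrMr // mul1r lerDl.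
Qed.

Local Notation corner_mean := (@corner_mean R P n).

Lemma trace_M00 : \sum_l M00 (l, l) = #|T|%:R * corner_mean.
Proof.
rewrite /corner_mean /diag_mean mulVKf // pnatr_eq0 -lt0n.
by apply/card_gt0P; exists [ffun=> false].
Qed.

Lemma trace_mul_le (f g : T * T -> C) :
  normc (\sum_l \sum_l' f (l, l') * g (l', l)) <= norm2 f * norm2 g.
Proof.
rewrite (pair_bigA _ (fun l l' => f (l, l') * g (l', l))) /=.
rewrite -(norm2_swap g).
apply: le_trans (cauchy_schwarz f (fun p => g (p.2, p.1))).
by rewrite le_eqVlt; apply/orP; left; apply/eqP; congr normc; apply: eq_bigr => -[].
Qed.

(** Subtracting the mean makes [M00] traceless, so the cross terms in the
    trace of its square vanish. What is left is the square of the
    Hilbert-Schmidt distance to the scalars, the antidiagonal terms and the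
    contribution from outside the block. *)
Lemma corner_mean_idem :
  normc (#|T|%:R * (corner_mean - corner_mean ^+ 2)) <=
    (18 * s%:R ^+ 2 * h) ^+ 2 + (2 * h) ^+ 2 + Num.sqrt #|T|%:R * (K * h).
Proof.
pose ao p := M00 p - (p.1 == p.2)%:R * corner_mean.
have hao : norm2 ao <= 18 * s%:R ^+ 2 * h by exact: M00_scalar.
have delta (g : T -> C) l : \sum_l' (l == l')%:R * g l' = g l.
  rewrite (bigD1 l) //= eqxx mul1r big1 ?addr0 // => l'.
  by rewrite eq_sym => /negbTE ->; rewrite mul0r.
have tro : \sum_l ao (l, l) = 0.
  rewrite /ao sumrB trace_M00 /=; under [X in _ - X]eq_bigr do rewrite eqxx mul1r.
  by rewrite sumr_const -[X in _ - X]mulr_natl subrr.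
have sq : \sum_l \sum_l' M00 (l', l) * M00 (l, l') =
   #|T|%:R * corner_mean ^+ 2 + \sum_l \sum_l' ao (l, l') * ao (l', l).
  transitivity (\sum_l (corner_mean ^+ 2 + 2 * corner_mean * ao (l, l) + \sum_l' ao (l, l') * ao (l', l))).
    apply: eq_bigr => l _.
    transitivity (\sum_l' ((l == l')%:R * (corner_mean ^+ 2 + corner_mean * ao (l, l') + corner_mean * ao (l', l))
        + ao (l, l') * ao (l', l))).
      apply: eq_bigr => l' _; rewrite /ao /= (eq_sym l' l).
      by have [->|_] := eqVneq l l'; rewrite ?mulr1n ?mulr0n; ring.
    by rewrite big_split /= delta; congr (_ + _); ring.
  rewrite !big_split /= sumr_const -[corner_mean ^+ 2 *+ _]mulr_natl.
  by rewrite -mulr_sumr tro mulr0 addr0.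
have e : #|T|%:R * (corner_mean - corner_mean ^+ 2) =
   \sum_l \sum_l' ao (l, l') * ao (l', l) + \sum_l \sum_l' M01 (l, l') * M10 (l', l)
   + \sum_l P (out l) (block_coord false l).
  rewrite mulrBr -trace_M00.
  rewrite (eq_bigr _ (fun l _ => M00_diag l)) big_split /=.
  under [X in X + _ - _]eq_bigr do rewrite big_split /=.
  rewrite big_split /= sq.
  have -> : \sum_l \sum_l' M10 (l', l) * M01 (l, l') = \sum_l \sum_l' M01 (l, l') * M10 (l', l).
    by apply: eq_bigr => l _; apply: eq_bigr => l' _; rewrite mulrC.
  by ring.
rewrite e; apply: le_trans (normcD _ _) _; apply: lerD; last first.
  by apply: le_trans (normc_sum _ _) _; exact: out_sum.
apply: le_trans (normcD _ _) _; apply: lerD.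
  by apply: le_trans (trace_mul_le ao ao) _; rewrite expr2 ler_pM ?norm2_ge0.
apply: le_trans (trace_mul_le M01 M10) _; rewrite expr2 ler_pM ?norm2_ge0 //.
  exact: M01_le.
exact: M10_le.
Qed.

End Trace.

(** * Partial sum projections of a basis *)

Section Basis.
Variable R : realType.
Local Notation C := R[i].
Let X : operatorSpace R := block_space (@normc_phase R) bitperm_inj.
Local Notation F := (block_family (@normc_phase R) bitperm_inj).

Variable e : nat -> X.
Hypothesis basis_e : schauder_basis e.

Lemma coordsP x : expands e x (coords e x).
Proof. by have [c [ec _]] := basis_e x; apply: (xgetPex _ (ex_intro _ c ec)). Qed.

Lemma coords_unique x c : expands e x c -> coords e x = c.
Proof.
move=> ec; have [c0 [_ u]] := basis_e x.
by rewrite -(u _ ec) -(u _ (@coordsP x)).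
Qed.

(** Uniqueness of the expansion. *)
Lemma coords_lin a x y k : coords e (a *: x + y) k = a * coords e x k + coords e y k.
Proof.
rewrite (@coords_unique _ (fun k => a * coords e x k + coords e y k)) //.
rewrite /expands.
have -> : series (fun n => (a * coords e x n + coords e y n) *: e n) =
  (fun m => a *: series (fun n => coords e x n *: e n) m + series (fun n => coords e y n *: e n) m).
  apply/funext => m; rewrite /series /= scaler_sumr -big_split /=.
  by apply: eq_bigr => i _; rewrite scalerDl scalerA.
by apply: cvgD; [apply: cvgZl_tmp; exact: coordsP|exact: coordsP].
Qed.

Local Notation P := (basis_proj e).

Lemma proj_lin m : linear (P m).
Proof.
move=> a x y; rewrite /basis_proj /series /= scaler_sumr -big_split /=.
by apply: eq_bigr => i _; rewrite coords_lin scalerDl scalerA.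
Qed.

Lemma proj_succ m x : P m.+1 x = P m x + coords e x m *: e m.
Proof. by rewrite /basis_proj /series /= big_nat_recr. Qed.

Lemma proj0 x : P 0 x = 0.
Proof. by rewrite /basis_proj /series /= big_geq. Qed.

Lemma proj_idem m x : P m (P m x) = P m x.
Proof.
rewrite {1}/basis_proj.
rewrite (@coords_unique (P m x) (fun k => if (k < m)%N then coords e x k else 0)).
  rewrite /basis_proj /series /=; apply: eq_big_nat => i /andP[_ im].
  by rewrite im.
rewrite /expands; apply: cvg_near_cst; exists m => // k /= mk.
rewrite /basis_proj /series /= (big_cat_nat (leq0n m) mk) /= [X in _ + X]big_nat [X in _ + X]big1 ?addr0.
  by apply: eq_big_nat => i /andP[_ im]; rewrite im.
by move=> i /andP[mi _]; rewrite ltnNge mi scale0r.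
Qed.

Lemma proj_cvg x (d : R) : 0 < d -> exists m0, forall m, (m0 <= m)%N -> l2nrm (P m x - x) < d.
Proof.
move=> d0; have h := @coordsP x; have dC : 0 < d%:C :> C by rewrite ltcR.
move/cvgrPdist_lt : h => /(_ _ dC) [m0 _ hm0]; exists m0 => m m0m.
have := hm0 m m0m; rewrite /= -opprB normrN => hh'.
by rewrite -ltcR.
Qed.

Variable K : R.
Hypothesis K1 : 1 <= K.
Hypothesis cbP : forall m n (x : 'M[X]_n), (0 < n)%N ->
  test_mxnorm F (map_mx (P m) x) <= K * test_mxnorm F x.

Let K0 : 0 <= K. Proof. exact: le_trans ler01 K1. Qed.

Let nP m (x : X) : l2nrm (P m x) <= K * l2nrm x.
Proof. exact: (l2nrm_cb (cbP m)). Qed.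

(** The trace of a compression of the rank one operator [P (m + 1) - P m] is
    [coords e y m] for the compression [y] of [e m] to the chosen
    coordinates, and [coords e y m *: e m] is the image of [y] under that
    operator, of norm at most [2 K]. *)
Lemma rank_one_trace m (I : finType) (k : I -> nat) : injective k ->
  normc (\sum_l coords e (l2delta R (k l)) m * (e m : l2 R) (k l)) <= 2 * K.
Proof.
move=> kinj.
have [e0|en0] := eqVneq (l2nrm (e m)) 0.
  have em : forall i, (e m : l2 R) i = 0 by move=> i; rewrite (l2nrm_eq0 e0).
  by rewrite big1 ?normc0 ?mulr_ge0 // => l _; rewrite em mulr0.
have egt0 : 0 < l2nrm (e m) by rewrite lt_def en0 l2nrm_ge0.
pose y : X := \sum_l (e m : l2 R) (k l) *: (l2delta R (k l) : X).
have c0 : coords e 0 m = 0.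
  by have := coords_lin (-1) 0 0 m; rewrite scaler0 addr0 mulN1r addNr.
have cD u v : coords e (u + v) m = coords e u m + coords e v m.
  by have := coords_lin 1 u v m; rewrite scale1r mul1r.
have cZ a u : coords e (a *: u) m = a * coords e u m.
  by have := coords_lin a u 0 m; rewrite c0 !addr0.
have -> : \sum_l coords e (l2delta R (k l)) m * (e m : l2 R) (k l) = coords e y m.
  rewrite /y (big_morph (fun u => coords e u m) cD c0); apply: eq_bigr => l _.
  by rewrite cZ mulrC.
have hy : l2nrm y <= l2nrm (e m).
  apply: le_trans (l2nrm_delta_sum (fun l => (e m : l2 R) (k l)) kinj) _.
  exact: norm2_subfamily.
rewrite -(ler_pM2r egt0) -l2nrmZ.
have -> : coords e y m *: e m = P m.+1 y - P m y by rewrite proj_succ addrC addKr.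
apply: le_trans (l2nrmD _ _) _.
have -> : l2nrm (- P m y) = l2nrm (P m y).
  by rewrite -scaleN1r l2nrmZ normcN1 normc1 mul1r.
have := nP m.+1 y; have := nP m y.
have : K * l2nrm y <= K * l2nrm (e m) by rewrite ler_wpM2l.
lra.
Qed.

Variable n : nat.
Local Notation T := (bits n).
Local Notation N := (#|T|%:R : R).
Local Notation s := (4 * scale_exp n)%N.
Let ta m : C := @corner_mean R (P m) n.

Let Ngt0 : 0 < N.
Proof. by rewrite ltr0n; apply/card_gt0P; exists [ffun=> false]. Qed.

Lemma ta_trace m : N%:C * ta m = \sum_(l : T) (P m (l2delta R (block_coord false l)) : l2 R) (block_coord false l).
Proof.
rewrite rmorph_nat /ta -trace_M00; by apply: eq_bigr => l _.
Qed.

Lemma ta0 : ta 0 = 0.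
Proof.
have Nn : N%:C != 0 :> C by rewrite eq_complex /= gt_eqF.
apply: (mulfI Nn); rewrite ta_trace mulr0 big1 // => l _.
by rewrite proj0.
Qed.

Lemma ta_step m : normc (ta m.+1 - ta m) <= 2 * K / N.
Proof.
rewrite ler_pdivlMr // mulrC -[N](@normc_real R N) ?(ltW Ngt0) // -normcM mulrBr !ta_trace.
have kinj : injective (fun l : T => block_coord false l) by move=> l l' /block_coord_inj [].
have h := rank_one_trace m kinj.
rewrite -sumrB (eq_bigr (fun l : T => coords e (l2delta R (block_coord false l)) m *
    (e m : l2 R) (block_coord false l))) // => l _.
rewrite proj_succ.
rewrite -[LHS]/((P m (l2delta R (block_coord false l)) : l2 R) (block_coord false l)
   + coords e (l2delta R (block_coord false l)) m * (e m : l2 R) (block_coord false l)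
   - (P m (l2delta R (block_coord false l)) : l2 R) (block_coord false l)).
by rewrite addrC addKr.
Qed.

Lemma ta_lim : exists m, 2^-1 < normc (ta m).
Proof.
have h2 : 0 < 2^-1 / 2 :> R by rewrite divr_gt0 ?invr_gt0.
have /boolp.choice [mf hmf] := fun l : T => proj_cvg (l2delta R (block_coord false l)) h2.
pose m := \max_l mf l; exists m.
have hb : normc (ta m - 1) <= 2^-1 / 2.
  rewrite -(ler_pM2l Ngt0) -[X in X * normc _ <= _](@normc_real R N) ?(ltW Ngt0) //.
  rewrite -normcM mulrBr mulr1 ta_trace rmorph_nat.
  have -> : #|T|%:R = \sum_(l : T) (1 : C) by rewrite sumr_const.
  rewrite -sumrB; apply: le_trans (normc_sum _ _) _.
  apply: (@le_trans _ _ (\sum_(l : T) 2^-1 / 2)); last first.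
    by rewrite sumr_const -[leLHS]mulr_natl.
  apply: ler_sum => l _; have hl : (mf l <= m)%N by exact: leq_bigmax.
  apply: le_trans (ltW (hmf l m hl)).
  apply: le_trans (l2nrm_coord _ (block_coord false l)).
  rewrite -[X in _ <= normc X]/((P m (l2delta R (block_coord false l)) : l2 R) (block_coord false l)
      - (l2delta R (block_coord false l)) (block_coord false l)).
  by rewrite l2deltaE eqxx.
have : 1 <= normc (ta m) + normc (ta m - 1).
  have := normcB (ta m) (ta m - 1); rewrite opprB addrCA subrr addr0 normc1 //.
lra.
Qed.

Lemma ta_idem m : normc (N%:C * (ta m - ta m ^+ 2)) <=
    (18 * s%:R ^+ 2 * slack K n) ^+ 2 + (2 * slack K n) ^+ 2 + Num.sqrt N * (K * slack K n).
Proof.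
rewrite rmorph_nat.
exact: (corner_mean_idem (proj_lin m) K0 (cbP m) (proj_idem m)).
Qed.

(** The means start at 0, eventually exceed 1/2 and move by at most 1/4, so
    one of them has modulus between 1/2 and 3/4; there [|tau - tau ^ 2| >=
    1/8]. *)
Lemma no_intermediate_mean :
  2 * K / N <= 4^-1 ->
  (18 * s%:R ^+ 2 * slack K n) ^+ 2 + (2 * slack K n) ^+ 2 + Num.sqrt N * (K * slack K n)
    < N / 8 -> False.
Proof.
move=> hstep hsmall.
have ex : exists m, 2^-1 < normc (ta m) by exact: ta_lim.
(* The first mean of modulus above 1/2. *)
case: (ex_minnP ex) => -[|m] hm hmin.
  by move: hm; rewrite ta0 normc0 ltNge invr_ge0 ler0n.
have hm' : normc (ta m) <= 2^-1.
  rewrite leNgt; apply/negP => /hmin; by rewrite ltnn.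
(* One step from a modulus of at most 1/2 leads to at most 3/4. *)
have h34 : normc (ta m.+1) <= 3 / 4.
  have -> : ta m.+1 = ta m + (ta m.+1 - ta m) by rewrite addrC subrK.
  apply: le_trans (normcD _ _) _; have := ta_step m; lra.
have h14 : 4^-1 <= normc (1 - ta m.+1).
  have := normcD (1 - ta m.+1) (ta m.+1); rewrite subrK normc1; lra.
have := ta_idem m.+1.
have -> : ta m.+1 - ta m.+1 ^+ 2 = ta m.+1 * (1 - ta m.+1) by rewrite mulrBr mulr1 expr2.
rewrite normcM normc_real ?(ltW Ngt0) // (normcM (ta m.+1)) => h1.
have h2 : 2^-1 * 4^-1 <= normc (ta m.+1) * normc (1 - ta m.+1).
  by rewrite ler_pM ?invr_ge0 ?(ltW hm).
have := lt_le_trans hsmall (_ : N / 8 <= N * (normc (ta m.+1) * normc (1 - ta m.+1))).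
rewrite ltNge h1 => /(_ _)/negP; apply => //.
by rewrite ler_wpM2l ?(ltW Ngt0) //; apply: le_trans h2; lra.
Qed.

End Basis.

(** * Failure of cb-bases and the approximation property *)

Section Numeric.
Variable R : realType.

Lemma card_bitsR n : #|bits n|%:R = 2 ^+ (4 * scale_exp n) :> R.
Proof. by rewrite card_bits natrX. Qed.

(** After division by [A ^ 2] each term is at most a constant times [K ^ 2 *
    x]; the bits [s] enter with the fourth power, which the square of [x ^
    16] absorbs. *)
Lemma error_terms (K A x s c : R) : 0 < K -> 0 < A -> 0 <= s -> 0 <= c ->
  0 < x -> x <= 1 -> s * x ^+ 2 <= c ->
  16 * K ^+ 2 * (1296 * c ^+ 4 + 18) * x <= 1 ->
  (18 * s ^+ 2 * (2 * K * (A * x ^+ 16))) ^+ 2 + (2 * (2 * K * (A * x ^+ 16))) ^+ 2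
    + A * (K * (2 * K * (A * x ^+ 16))) < A ^+ 2 / 8.
Proof.
move=> K0 A0 s0 c0 x0 x1 sx hx.
have x_ge0 := ltW x0.
have xpow k : (0 < k)%N -> x ^+ k <= x.
  by move=> k0; rewrite -[leRHS]expr1 ler_wiXn2l.
have s4 : s ^+ 4 * x ^+ 32 <= c ^+ 4 * x.
  have -> : s ^+ 4 * x ^+ 32 = (s * x ^+ 2) ^+ 4 * x ^+ 24.
    by ring.
  rewrite ler_pM ?exprn_ge0 ?mulr_ge0 ?exprn_ge0 ?xpow //.
  by rewrite ler_pXn2r ?nnegrE ?mulr_ge0 ?exprn_ge0.
have x16 := xpow 16 isT; have x32 := xpow 32 isT.
have xx : x ^+ 32 = x ^+ 16 * x ^+ 16 by rewrite -exprD.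
move: (x ^+ 32) (x ^+ 16) s4 x16 x32 xx => X Y s4 x16 x32 xx.
have -> : (18 * s ^+ 2 * (2 * K * (A * Y))) ^+ 2 + (2 * (2 * K * (A * Y))) ^+ 2
   + A * (K * (2 * K * (A * Y))) =
   A ^+ 2 * (K ^+ 2 * (1296 * (s ^+ 4 * X) + 16 * X + 2 * Y)).
  by rewrite xx; ring.
rewrite ltr_pM2l ?exprn_gt0 //.
apply: (@le_lt_trans _ _ (K ^+ 2 * ((1296 * c ^+ 4 + 18) * x))).
  rewrite ler_wpM2l ?exprn_ge0 ?(ltW K0) // (mulrDl (1296 * c ^+ 4)).
  move: (s ^+ 4 * X) (c ^+ 4) s4 => S S' s4; lra.
have e (a b d : R) : 16 * a * b * d = 16 * (a * (b * d)) by ring.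
by move: hx; rewrite e; move: (K ^+ 2 * _) => E; lra.
Qed.

(** The number of bits is quadratic in [n], while [slack K n / sqrt N]
    decays like [2 ^ (- 16 n)]. *)
Lemma large_block (K : R) : 1 <= K -> exists n,
  2 * K / #|bits n|%:R <= 4^-1 /\
  (18 * (4 * scale_exp n)%:R ^+ 2 * slack K n) ^+ 2 + (2 * slack K n) ^+ 2
    + Num.sqrt #|bits n|%:R * (K * slack K n) < #|bits n|%:R / 8.
Proof.
move=> K1; have K0 : 0 < K := lt_le_trans ltr01 K1.
(* The number of bits is [c (n + 1) ^ 2], so at most [c / x ^ 2] for [x = 2
   ^ (- n)]; [D] collects the coefficients of the three terms. *)
pose c : R := (4 * 32 ^ 2)%:R; have c0 : 0 <= c by rewrite ler0n.
have [D [D1 eD]] : exists D, 1 <= D /\ 1296 * c ^+ 4 + 18 = D.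
  exists (1296 * c ^+ 4 + 18); split=> //.
  by move: (c ^+ 4) (exprn_ge0 4 c0) => C C0; clear -C0; lra.
have [n hn] : exists n, 16 * K ^+ 2 * D <= 2 ^+ n.
  exists (Num.bound (16 * K ^+ 2 * D)); apply: le_trans (ltW (archi_boundP _)) _.
    by rewrite !mulr_ge0 ?exprn_ge0 ?(ltW K0) // (le_trans ler01).
  by rewrite -natrX ler_nat ltnW // ltn_expl.
exists n.
have p0 : 0 < 2 ^+ n :> R by rewrite exprn_gt0.
pose x : R := (2 ^+ n)^-1; pose A : R := 2 ^+ (2 * scale_exp n).
have A0 : 0 < A by rewrite exprn_gt0.
have AN : A ^+ 2 = #|bits n|%:R.
  by rewrite card_bitsR /A -exprM mulnAC.
have sq : Num.sqrt #|bits n|%:R = A by rewrite -AN sqrtr_sqr ger0_norm ?ltW.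
have n2 : (n.+1 <= 2 ^ n)%N by exact: ltn_expl.
split.
  rewrite -AN ler_pdivrMr ?exprn_gt0 //.
  have a1 : 2 ^+ n <= A ^+ 2.
    rewrite /A -exprM; apply: pow2_le.
    apply: (@leq_trans (32 * n.+1)); first by rewrite (leq_trans (leqnSn n)) // leq_pmull.
    by rewrite /scale_exp mulnAC -mulnn mulnA leq_pmull // !muln_gt0.
  have K2 : K <= K ^+ 2 * D.
    have : K * 1 <= K * (K * D) by rewrite ler_wpM2l ?(ltW K0) // mulr_ege1.
    by rewrite mulr1 mulrA -expr2.
  move: (A ^+ 2) a1 => N a1.
  have e : 16 * K ^+ 2 * D = 16 * (K ^+ 2 * D) by rewrite mulrA.
  move: hn; rewrite e; move: (K ^+ 2 * D) K2 (2 ^+ n) a1 => E K2 p a1 hn.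
  by clear -K0 K2 a1 hn; lra.
have hE : slack K n = 2 * K * (A * x ^+ 16).
  by rewrite /slack -/A /x exprVn -exprM mulnC.
rewrite sq hE -AN; apply: (@error_terms K A x _ c K0 A0 _ c0).
- exact: ler0n.
- by rewrite invr_gt0.
- by rewrite invf_le1 // exprn_ege1 // ler1n.
- have -> : x ^+ 2 = ((2 ^ n) ^ 2)%:R^-1 by rewrite /x exprVn !natrX.
  have q0 : 0 < ((2 ^ n) ^ 2)%:R :> R by rewrite ltr0n !expn_gt0.
  rewrite (ler_pdivrMr _ _ q0) /c -natrM ler_nat /scale_exp expnMn mulnA.
  by rewrite leq_pmul2l // leq_exp2r.
- by rewrite eD /x ler_pdivrMr // mul1r.
Qed.

End Numeric.

Section NoBasis.
Variable R : realType.
Local Notation C := R[i].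
Let X : operatorSpace R := block_space (@normc_phase R) bitperm_inj.
Local Notation F := (block_family (@normc_phase R) bitperm_inj).

Lemma test_mxnorm_scale n (T : X -> X) (K : R) (x : 'M[X]_n) : (0 < n)%N ->
  linear T -> 0 <= K ->
  (forall x : 'M[X]_n, test_mxnorm F x <= 1 -> test_mxnorm F (map_mx T x) <= K) ->
  test_mxnorm F (map_mx T x) <= K * test_mxnorm F x.
Proof.
move=> n0 lT K0 h.
have [x0|xn0] := eqVneq (test_mxnorm F x) 0.
  have -> : map_mx T x = 0.
    by rewrite (test_mxnorm_eq0 x0); apply/matrixP => i j; rewrite !mxE (lin0 lT).
  have -> : test_mxnorm F (0 : 'M[X]_n) = 0 by rewrite -(test_mxnorm_eq0 x0) x0.
  by rewrite mulr_ge0 // test_mxnorm_ge0.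
have xgt0 : 0 < test_mxnorm F x by rewrite lt_def xn0 test_mxnorm_ge0.
pose c : C := (test_mxnorm F x)^-1%:C.
have nc : normc c = (test_mxnorm F x)^-1 by rewrite normc_real ?invr_ge0 ?test_mxnorm_ge0.
have e : map_mx T (map_mx ( *:%R c) x) = map_mx ( *:%R c) (map_mx T x).
  by apply/matrixP => i j; rewrite !mxE (linZ lT).
have := h (map_mx ( *:%R c) x); rewrite e !test_mxnormZ nc mulVf // => /(_ (lexx _)).
by rewrite ler_pdivrMl // mulrC.
Qed.

Lemma no_cb_basis : ~ has_cb_basis X.
Proof.
case=> e [be hsup].
pose S := ereal_sup [set cb_norm (basis_proj e m) | m in [set m : nat | (0 < m)%N]].
have hS m n (x : 'M[X]_n) : (0 < m)%N -> (0 < n)%N -> test_mxnorm F x <= 1 ->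
    ((test_mxnorm F (map_mx (basis_proj e m) x))%:E <= S)%E.
  move=> m0 n0 x1.
  apply: le_trans (_ : (cb_norm (basis_proj e m) <= S)%E); last first.
    by apply: ereal_sup_ubound; exists m.
  apply: le_trans (_ : (amp_norm (basis_proj e m) n <= _)%E); last first.
    by apply: ereal_sup_ubound; exists n.
  by apply: ereal_sup_ubound; exists x.
have mx0 n : test_mxnorm F (0 : 'M[X]_n) = 0.
  apply/eqP; rewrite eq_le test_mxnorm_ge0 andbT; apply: test_mxnorm_le => // j eta xi.
  rewrite mulr0 /test_form big1 ?normc0 // => i _; rewrite big1 // => k _.
  by rewrite big1 // => l _; rewrite mxE test_fun0 mulr0.
have Sge0 : (0 <= S)%E.
  have := hS 1%N 1%N 0 isT isT; rewrite mx0 => /(_ ler01); apply: le_trans.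
  by rewrite lee_fin test_mxnorm_ge0.
have [K hK] : exists K : R, S = K%:E.
  move: hsup Sge0; rewrite -/S; case: (S) => [r _ _|//|//].
  by exists r.
pose K' := Num.max K 1.
have K1 : 1 <= K' by rewrite le_max lexx orbT.
have K0 : 0 <= K' := le_trans ler01 K1.
have cbP m n (x : 'M[X]_n) : (0 < n)%N ->
    test_mxnorm F (map_mx (basis_proj e m) x) <= K' * test_mxnorm F x.
  move=> n0; case: m => [|m].
    have -> : map_mx (basis_proj e 0) x = 0.
      by apply/matrixP => i j; rewrite !mxE proj0.
    by rewrite mx0 mulr_ge0 ?test_mxnorm_ge0.
  apply: test_mxnorm_scale => // [|y y1]; first exact: proj_lin.
  have := @hS m.+1 n y isT n0 y1; rewrite hK lee_fin => /le_trans; apply.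
  by rewrite le_max lexx.
have [n [h1 h2]] := large_block K1.
exact: (no_intermediate_mean be K1 cbP h1 h2).
Qed.

End NoBasis.

Section Approximation.
Variable R : realType.
Local Notation C := R[i].
Let X : operatorSpace R := block_space (@normc_phase R) bitperm_inj.
Local Notation F := (block_family (@normc_phase R) bitperm_inj).
Local Notation H := (l2cnm R).

Definition decode_coord (i : nat) : option {n : nat & block_index n} := pickle_inv i.

(** Keeps the blocks with index below [m], and the first [m] of the
    coordinates that lie in no block. *)
Definition block_mask (m i : nat) : bool :=
  if decode_coord i is Some p then (tag p < m)%N else (i < m)%N.

Lemma block_mask_coord m n b (l : bits n) : block_mask m (block_coord b l) = (n < m)%N.
Proof. by rewrite /block_mask /decode_coord /block_coord pickleK_inv. Qed.

Lemma block_mask_fin m : exists B, forall i, block_mask m i -> (i < B)%N.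
Proof.
pose B0 := \max_(n < m) \max_(p : bool * bits n) (block_coord p.1 p.2).+1.
exists (maxn m B0) => i; rewrite /block_mask.
have : oapp pickle i (decode_coord i) = i by exact: pickle_invK.
case: (decode_coord i) => [[n [b l]]|] /=; last by move=> _ im; rewrite leq_max im.
move=> <- nm; rewrite leq_max; apply/orP; right.
apply: leq_trans (leq_bigmax (Ordinal nm)) => /=.
exact: (@leq_bigmax _ (fun p : bool * bits n => (block_coord p.1 p.2).+1) (b, l)).
Qed.

Lemma block_mask_exhausts m0 : exists m1, forall m, (m1 <= m)%N ->
  forall i, (i < m0)%N -> block_mask m i.
Proof.
pose th i := if decode_coord i is Some p then (tag p).+1 else i.+1.
exists (\max_(i < m0) th i) => m hm i im.
have : (th i <= m)%N.
  by apply: leq_trans hm; exact: (@leq_bigmax _ (fun i : 'I_m0 => th i) (Ordinal im)).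
by rewrite /th /block_mask; case: (decode_coord i).
Qed.

Definition block_proj (m : nat) (x : H) : H := l2mask (block_mask m) x.
Lemma block_proj_lin m : linear (block_proj m).
Proof. by move=> a x y; exact: l2mask_linear. Qed.
HB.instance Definition _ m := GRing.isLinear.Build C H H *:%R (block_proj m) (block_proj_lin m).

(** Each contraction composed with the truncation is again in the family
    (for functionals), is unchanged, or vanishes. *)
Lemma block_proj_cb m n (x : 'M[H]_n) : test_mxnorm F (map_mx (block_proj m) x) <= test_mxnorm F x.
Proof.
apply: test_mxnorm_le => [|j eta xi]; first exact: test_mxnorm_ge0.
case: j eta xi => [d y hy|k] eta xi.
  pose y' (i : 'I_d) : C := if block_mask m i then y i else 0.
  have hy' : norm2 y' <= 1.
    by apply: (le_trans _ hy); apply: le_norm2 => i; rewrite /y'; case: ifP; rewrite ?normc0 ?normc_ge0.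
  have := @test_form_le _ _ F n (Functional hy') eta xi x.
  rewrite (_ : test_form _ _ _ = test_form eta xi (map_mx (block_proj m) x)) //.
  apply: eq_bigr => i _; apply: eq_bigr => i' _; apply: eq_bigr => l _ /=.
  congr (_ * _); apply: eq_bigr => t _; rewrite mxE /y'.
  rewrite -[block_proj m _ t]/(if block_mask m t then (x i i' : l2 R) t else 0).
  by case: (block_mask m t); rewrite ?mul0r ?mulr0.
have [bm|nbm] := boolP (block_of k < m)%N.
  rewrite (_ : test_form _ _ _ = test_form eta xi x); first exact: test_form_le.
  apply: eq_bigr => i _; apply: eq_bigr => i' _; apply: eq_bigr => l _ /=.
  rewrite mxE /graph_defect.
  have E b (t : bits (block_of k)) : block_proj m (x i i') (block_coord b t) = (x i i' : l2 R) (block_coord b t).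
    by rewrite /block_proj l2maskE block_mask_coord bm.
  by rewrite !E.
rewrite (_ : test_form _ _ _ = 0) ?normc0 ?mulr_ge0 ?norm2_ge0 ?test_mxnorm_ge0 //.
rewrite /test_form big1 // => i _; rewrite big1 // => i' _; rewrite big1 // => l _ /=.
rewrite mxE /graph_defect.
have E b (t : bits (block_of k)) : block_proj m (x i i') (block_coord b t) = 0.
  by rewrite /block_proj l2maskE block_mask_coord (negbTE nbm).
by rewrite !E; ring.
Qed.

Lemma block_space_cbap : CBAP 1 X.
Proof.
exists nat, (fun a b => is_true (a <= b)%N), (fun m => block_proj m : {linear H -> H}); split.
- split; [exact: (inhabits 0%N)|by []|by move=> a b c; exact: leq_trans|].
  by move=> a b; exists (maxn a b); rewrite leq_maxl leq_maxr.
- move=> m; have [B hB] := block_mask_fin m; exists B, (fun i : 'I_B => l2delta R i : H) => x.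
  exists (fun i : 'I_B => block_proj m x i).
  rewrite -mask_upto; apply: l2_eq => i; rewrite l2maskE.
  case: ifPn => // iB; rewrite /block_proj l2maskE; case: ifP => // /hB.
  by rewrite (negbTE iB).
- move=> x A; rewrite -nbhs_ballE => -[e /posC [d d0 ->] hA].
  have d2 : 0 < d / 2 by rewrite divr_gt0.
  have [m0 hm0] := trunc_tail x d2; have [m1 hm1] := block_mask_exhausts m0.
  exists m1 => // m /= m1m; apply: hA.
  rewrite -ball_normE /= -[`|_|]/((l2nrm (x - block_proj m x))%:C) ltcR.
  apply: le_lt_trans (hm0 _ (hm1 m m1m)) _; lra.
- apply: ge_ereal_sup => _ [m _ <-]; apply: ge_ereal_sup => _ [n n0 <-].
  apply: ge_ereal_sup => _ [x x1 <-]; rewrite lee_fin.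
  exact: le_trans (block_proj_cb m x) x1.
Qed.

End Approximation.

(** * The Hilbert space structure of l2 *)

Section Hilbert.
Variable R : realType.
Local Notation C := R[i].
Local Notation H := (l2cnm R).

Definition tends_to (u : nat -> C) (z : C) : Prop :=
  forall d : R, 0 < d -> exists m0, forall m, (m0 <= m)%N -> normc (u m - z) <= d.

Lemma tends_to_uniq u z w : tends_to u z -> tends_to u w -> z = w.
Proof.
move=> hz hw; apply/eqP; rewrite -subr_eq0; apply/eqP/eq0_normc/eqP.
rewrite eq_le normc_ge0 andbT; apply/ler_addgt0Pr => d d0; rewrite add0r.
have d2 : 0 < d / 2 by rewrite divr_gt0.
have [m1 h1] := hz _ d2; have [m2 h2] := hw _ d2.
pose m := maxn m1 m2.
have -> : z - w = (u m - w) - (u m - z) by ring.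
apply: le_trans (normcB _ _) _; rewrite [d]splitr.
by apply: lerD; [apply: h2; rewrite leq_maxr|apply: h1; rewrite leq_maxl].
Qed.

Lemma tends_toD u v z w : tends_to u z -> tends_to v w -> tends_to (fun m => u m + v m) (z + w).
Proof.
move=> hz hw d d0; have d2 : 0 < d / 2 by rewrite divr_gt0.
have [m1 h1] := hz _ d2; have [m2 h2] := hw _ d2.
exists (maxn m1 m2) => m; rewrite geq_max => /andP[m1m m2m].
rewrite opprD addrACA; apply: le_trans (normcD _ _) _; rewrite [d]splitr.
by apply: lerD; [exact: h1|exact: h2].
Qed.

Lemma tends_toZ c u z : tends_to u z -> tends_to (fun m => c * u m) (c * z).
Proof.
move=> hz d d0.
have c1 : 0 < normc c + 1 by rewrite ltr_wpDl ?normc_ge0.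
have [m1 h1] := hz _ (divr_gt0 d0 c1); exists m1 => m m1m.
rewrite -mulrBr normcM.
apply: le_trans (ler_wpM2l (normc_ge0 c) (h1 m m1m)) _.
by rewrite mulrA ler_pdivrMr // mulrC ler_wpM2l ?lerDl // ltW.
Qed.

Lemma tends_to_conj u z : tends_to u z -> tends_to (fun m => (u m)^*) z^*.
Proof.
move=> hz d d0; have [m1 h1] := hz _ d0; exists m1 => m m1m.
have -> : (u m)^* - z^* = (u m - z)^* by rewrite (rmorphB (@conjc R)).
by rewrite normc_conj h1.
Qed.

Definition ip_upto (m : nat) (x y : l2 R) : C := \sum_(i < m) x i * (y i)^*.

Lemma ip_upto_sqr_cvg (x : l2 R) : tends_to (fun m => ip_upto m x x) (l2nrm x ^+ 2)%:C.
Proof.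
have e m : ip_upto m x x = (norm2_upto m x ^+ 2)%:C.
  rewrite /norm2_upto norm2_sqr rmorph_sum; apply: eq_bigr => i _.
  by rewrite mulrC mul_conjc.
move=> d d0; have [x0|xn0] := eqVneq (l2nrm x) 0.
  exists 0%N => m _; rewrite e.
  have -> : norm2_upto m x = 0 by apply/eqP; rewrite eq_le norm2_ge0 andbT -x0 norm2_upto_le.
  by rewrite x0 subrr normc0 ltW.
have xgt0 : 0 < l2nrm x by rewrite lt_def xn0 l2nrm_ge0.
have d1 : 0 < d / (2 * l2nrm x) by rewrite divr_gt0 ?mulr_gt0.
have [_ [m0 _ <-] hm0] := sup_adherent d1 (l2nrm_has_sup x).
exists m0 => m m0m; rewrite e.
have -> : (norm2_upto m x ^+ 2)%:C - (l2nrm x ^+ 2)%:C = - (l2nrm x ^+ 2 - norm2_upto m x ^+ 2)%:C :> C.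
  by rewrite rmorphB opprB.
rewrite normcN1.
have h1 := norm2_upto_le m x; have h2 := norm2_upto_mono x m0m.
rewrite normc_real; last by rewrite subr_ge0 ler_sqr ?nnegrE ?l2nrm_ge0 ?norm2_ge0.
rewrite subr_sqr.
have a1 : l2nrm x - norm2_upto m x <= d / (2 * l2nrm x).
  by rewrite lerBlDr -lerBlDl (le_trans _ h2) // ltW.
have a2 : l2nrm x + norm2_upto m x <= 2 * l2nrm x by lra.
have a3 : 0 <= l2nrm x - norm2_upto m x by rewrite subr_ge0.
have a4 : 0 <= l2nrm x + norm2_upto m x by rewrite addr_ge0 ?l2nrm_ge0 ?norm2_ge0.
apply: le_trans (ler_pM a3 a4 a1 a2) _.
by rewrite divfK // mulf_neq0.
Qed.

Lemma polarization (z w : C) :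
  4^-1 * (((z + w) * (z + w)^* + -1 * ((z - w) * (z - w)^*)) +
    ('i * ((z + 'i * w) * (z + 'i * w)^*) + - 'i * ((z - 'i * w) * (z - 'i * w)^*)))
  = z * w^*.
Proof.
have cji : ('i : C)^* = - 'i by apply/eqP; rewrite eq_complex /= oppr0 !eqxx.
rewrite !cjD !cjN !cjM cji; set z' := z^*; set w' := w^*.
have -> : 'i * ((z + 'i * w) * (z' + - 'i * w')) + - 'i * ((z - 'i * w) * (z' - - 'i * w'))
  = 2 * (('i * 'i) * (w * z' - z * w')) by ring.
by rewrite i_mul_i; field.
Qed.

(** By polarization, from the convergence of the truncated norms. *)
Lemma ip_upto_cvg (x y : l2 R) : exists z, tends_to (fun m => ip_upto m x y) z.
Proof.
pose q (w : l2 R) := (l2nrm w ^+ 2)%:C : C.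
exists (4^-1 * ((q (x + y) + -1 * q (x - y)) + ('i * q (x + 'i *: y) + - 'i * q (x - 'i *: y)))).
have := tends_toZ 4^-1 (tends_toD (tends_toD (ip_upto_sqr_cvg (x + y)) (tends_toZ (-1) (ip_upto_sqr_cvg (x - y))))
  (tends_toD (tends_toZ 'i (ip_upto_sqr_cvg (x + 'i *: y))) (tends_toZ (- 'i) (ip_upto_sqr_cvg (x - 'i *: y))))).
congr tends_to; apply/funext => m; rewrite /ip_upto !mulr_sumr -!big_split /= mulr_sumr.
apply: eq_bigr => i _.
exact: polarization.
Qed.

Definition l2_ip (x y : H) : C := projT1 (cid (ip_upto_cvg x y)).

Lemma l2_ipP (x y : H) : tends_to (fun m => ip_upto m x y) (l2_ip x y).
Proof. by rewrite /l2_ip; case: cid. Qed.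

Lemma l2_ip_unique (x y : H) z : tends_to (fun m => ip_upto m x y) z -> l2_ip x y = z.
Proof. exact: tends_to_uniq (l2_ipP x y). Qed.

Lemma l2_ip_herm (x y : H) : l2_ip x y = (-1) ^+ false * (l2_ip y x)^*.
Proof.
rewrite expr0 mul1r; apply: l2_ip_unique.
have := tends_to_conj (l2_ipP y x); congr tends_to; apply/funext => m.
rewrite /ip_upto cj_sum; apply: eq_bigr => i _.
by rewrite cjM cjK mulrC.
Qed.

Lemma l2_ip_linl (y : H) a (x x' : H) : l2_ip (a *: x + x') y = a * l2_ip x y + l2_ip x' y.
Proof.
apply: l2_ip_unique; have := tends_toD (tends_toZ a (l2_ipP x y)) (l2_ipP x' y).
congr tends_to; apply/funext => m; rewrite /ip_upto mulr_sumr -big_split /=.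
apply: eq_bigr => i _.
by rewrite mulrA -mulrDl.
Qed.

Lemma l2_ip_linr (x : H) a (y y' : H) : l2_ip x (a *: y + y') = a^* * l2_ip x y + l2_ip x y'.
Proof.
rewrite l2_ip_herm l2_ip_linl expr0 mul1r cjD cjM [in RHS]l2_ip_herm [l2_ip x y' in RHS]l2_ip_herm.
by rewrite !expr0 !mul1r.
Qed.

Lemma l2_ip_sqr (x : H) : l2_ip x x = (l2nrm x ^+ 2)%:C.
Proof. by apply: l2_ip_unique; exact: ip_upto_sqr_cvg. Qed.

HB.instance Definition _ := bilinear_isBilinear.Build C H H C
  (GRing.Scale.Law.clone _ _ ( *%R ) _)
  (GRing.Scale.Law.clone _ _ (Num.conj \; *%R ) _) l2_ip (l2_ip_linl, l2_ip_linr).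
HB.instance Definition _ := isHermitianSesquilinear.Build C H false Num.conj l2_ip l2_ip_herm.

Lemma l2_ip_pos (x : H) : x != 0 -> 0 < l2_ip x x.
Proof.
move=> xn0; rewrite l2_ip_sqr ltcR exprn_gt0 // lt_def l2nrm_ge0 andbT.
by apply: contra xn0 => /eqP /l2nrm_eq0 ->.
Qed.
HB.instance Definition _ := isDotProduct.Build C H l2_ip l2_ip_pos.

Lemma l2_hilbert : is_hilbert H.
Proof.
exists (l2_ip : {dot H for Num.conj}) => x.
by rewrite [RHS]l2_ip_sqr rmorphXn.
Qed.

(** More coordinate vectors than the size of a spanning family are
    dependent. *)
Lemma l2_infinite : infinite_dimensional H.
Proof.
case=> n [v hv].
have /boolp.choice [c hc] := fun i : 'I_n.+1 => hv (l2delta R i).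
pose A : 'M[C]_(n.+1, n) := \matrix_(i, j) c i j.
have kn0 : kermx A != 0.
  by rewrite kermx_eq0 /row_free; apply/eqP => e; have := rank_leq_col A; rewrite e ltnn.
have [i hi] : exists i, row i (kermx A) != 0.
  apply/existsP; rewrite -negb_forall; apply: contra kn0 => /forallP h0.
  by apply/eqP/row_matrixP => i; rewrite row0; apply/eqP.
have hA : row i (kermx A) *m A = 0 by rewrite -row_mul mulmx_ker row0.
case/eqP: hi; apply/matrixP => a b; rewrite !ord1 [RHS]mxE.
pose w (k : 'I_n.+1) := row i (kermx A) 0 k.
have z : \sum_k w k *: (l2delta R k : H) = 0.
  under eq_bigr do rewrite hc scaler_sumr.
  rewrite exchange_big big1 // => j _ /=.
  under eq_bigr do rewrite scalerA; rewrite -scaler_suml.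
  have -> : \sum_k w k * c k j = (row i (kermx A) *m A) 0 j.
    by rewrite mxE; apply: eq_bigr => k _; rewrite [A _ _]mxE.
  rewrite hA mxE.
  by rewrite scale0r.
have := congr1 (fun x : H => x b) z.
have -> : (\sum_k w k *: (l2delta R k : H) : l2 R) b = \sum_k w k * (nat_of_ord b == k)%:R.
  exact: l2sum.
rewrite (bigD1 b) //= eqxx mulr1 big1 ?addr0 // => k nk.
by rewrite eq_sym (inj_eq (@ord_inj _)) (negbTE nk) mulr0.
Qed.

Definition ratC (q : rat * rat) : C := ratr q.1 +i* ratr q.2.

Definition ratpt (s : seq (rat * rat)) : H :=
  \sum_(i < size s) ratC (nth (0, 0) s i) *: (l2delta R i : H).

Lemma ratC_dense (z : C) (d : R) : 0 < d -> exists q, normc (z - ratC q) <= d.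
Proof.
move=> d0; have d2 : 0 < d / 2 by rewrite divr_gt0.
have dn (a : R) : exists q : rat, `|a - ratr q| <= d / 2.
  have [|q] := @rat_in_itvoo R (a - d / 2) (a + d / 2); first lra.
  rewrite in_itv /= => /andP[h1 h2]; exists q; rewrite ler_distlC; apply/andP; split; lra.
case: z => a b; have [p hp] := dn a; have [q hq] := dn b; exists (p, q).
have -> : (a +i* b) - ratC (p, q) = (a - ratr p)%:C + 'i * (b - ratr q)%:C by simpc.
apply: le_trans (normcD _ _) _.
rewrite normcM normc_i.
by rewrite mul1r /= expr0n /= !addr0 !sqrtr_sqr [d]splitr lerD.
Qed.

(** Rational combinations of coordinate vectors. *)
Lemma l2_separable : separable H.
Proof.
exists (range ratpt); split; first exact: card_le_trans (card_image_le _ _) (countableP _).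
move=> O [x Ox] oO.
have : nbhs x O by exact: open_nbhs_nbhs.
rewrite -nbhs_ballE => -[e0 /posC [d d0 ->] hO].
have d2 : 0 < d / 4 by rewrite divr_gt0.
have [m hm] := trunc_tail x d2.
have dm : 0 < d / 4 / m.+1%:R by rewrite divr_gt0.
have /boolp.choice [q hq] := fun i => ratC_dense ((x : l2 R) i) dm.
exists (ratpt (mkseq q m)); split; last by exists (mkseq q m).
apply: hO; rewrite -ball_normE /= -[`|_|]/((l2nrm (x - ratpt (mkseq q m)))%:C) ltcR.
pose x1 : H := l2mask (fun i => (i < m)%N) x.
have -> : x - ratpt (mkseq q m) = (x - x1) + (x1 - ratpt (mkseq q m)) by rewrite addrA subrK.
apply: le_lt_trans (l2nrmD _ _) _.
have h1 : l2nrm (x - x1) <= d / 4 by exact: hm.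
have h2 : l2nrm (x1 - ratpt (mkseq q m)) <= d / 4.
  have -> : x1 - ratpt (mkseq q m) = \sum_(i < m) ((x : l2 R) i - ratC (q i)) *: (l2delta R i : H).
    have -> : x1 = \sum_(i < m) (x : l2 R) i *: (l2delta R i : H) by exact: mask_upto.
    rewrite /ratpt size_mkseq -sumrB; apply: eq_bigr => i _.
    by rewrite nth_mkseq // scalerBl.
  apply: le_trans (l2nrm_delta_sum _ (@ord_inj m)) _.
  apply: (@le_trans _ _ (norm2 (fun _ : 'I_m => (d / 4 / m.+1%:R)%:C))).
    by apply: le_norm2 => i; rewrite [leRHS]normc_real ?(ltW dm) //; exact: hq.
  rewrite norm2_const card_ord normc_real ?(ltW dm) //.
  rewrite mulrC mulrAC ler_pdivrMr // ler_wpM2l ?(ltW d2) //.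
  rewrite -ler_sqr ?nnegrE ?sqrtr_ge0 // sqr_sqrtr ?ler0n // -natrX ler_nat; nia.
lra.
Qed.

End Hilbert.

Theorem theorem1 (R : realType) :
  exists X : operatorSpace R,
    [/\ separable X,
        exists H : completeNormedModType R[i]%C,
          [/\ is_hilbert H, infinite_dimensional H & linearly_isometric X H],
        CBAP 1%R X
      & ~ has_cb_basis X].
Proof.
exists (block_space (@normc_phase R) bitperm_inj); split.
- exact: l2_separable.
- exists (l2cnm R); split; [exact: l2_hilbert|exact: l2_infinite|].
  by exists (idfun : {linear l2cnm R -> l2cnm R}); split=> // y; exists y.
- exact: block_space_cbap.
- exact: no_cb_basis.
Qed.
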